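(* Suppose $n\ge 3$ and let $X$ be any subset of $[-1,1]$. Then there exists a Lebesgue measurable $X$-avoiding set $I\subset S^{n-1}$ such that $\lambda(I)=\alpha_X(n)$.
   Context: $S^{n-1}=\{x\in\mathbb{R}^n:\langle x,x\rangle=1\}$ is the unit sphere, with $\langle\cdot,\cdot\rangle$ the standard inner product, and $\lambda$ is the Lebesgue surface measure on $S^{n-1}$, normalised so that $\lambda(S^{n-1})=1$. For $X\subset[-1,1]$, a subset $I\subset S^{n-1}$ is called $X$-avoiding if $\langle\xi,\eta\rangle\notin X$ for all $\xi,\eta\in I$ (including $\xi=\eta$). Define $$\alpha_X(n):=\sup\{\lambda(I): I\subset S^{n-1}\text{ is Lebesgue measurable and } X\text{-avoiding}\}.$$ No measurability assumption is made on $X$. *)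

(* Defs.v *)
From HB Require Import structures.
From mathcomp Require Import all_boot all_order all_algebra.
From mathcomp Require Import all_classical all_reals all_analysis.

Set Implicit Arguments.
Unset Strict Implicit.
Unset Printing Implicit Defensive.

Import Order.TTheory GRing.Theory Num.Theory.

Local Open Scope classical_set_scope.
Local Open Scope ring_scope.

Definition inner (R : realType) (n : nat) (x y : 'rV[R]_n) : R :=
  \sum_(i < n) x 0 i * y 0 i.

(* S^{n-1}, as a subset of R^n. *)
Definition unit_sphere (R : realType) (n : nat) : set 'rV[R]_n :=
  [set x | inner x x = 1].

Definition box (R : realType) (n : nat) (a b : 'rV[R]_n) : set 'rV[R]_n :=
  [set x | forall i, a 0 i < x 0 i <= b 0 i].

Definition box_cover (R : realType) (n : nat) (A : set 'rV[R]_n) :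
    set (nat -> 'rV[R]_n * 'rV[R]_n) :=
  [set c : nat -> 'rV[R]_n * 'rV[R]_n |
    (forall k i, (c k).1 0 i <= (c k).2 0 i) /\
    A `<=` \bigcup_k box (c k).1 (c k).2].

(* n-dimensional Lebesgue outer measure; the Lebesgue measurable subsets of R^n
   are its Caratheodory measurable sets, on which it is Lebesgue measure. *)
Definition lebesgue_outer (R : realType) (n : nat) (A : set 'rV[R]_n) : \bar R :=
  ereal_inf [set (\sum_(k <oo) (\prod_(i < n) ((c k).2 0 i - (c k).1 0 i))%:E)%E
            | c in box_cover A].

Definition sector (R : realType) (n : nat) (E : set 'rV[R]_n) : set 'rV[R]_n :=
  [set t *: x | t in [set` `]0, 1[%R] & x in E].

(* Surface measure on the sphere is taken as in Stein and Shakarchi, Real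
   Analysis, Chapter 6, Section 3.2: E is measurable when its sector is Lebesgue
   measurable in R^n, and its surface measure is n times the Lebesgue measure
   of that sector. *)
Definition sphere_measurable (R : realType) (n : nat) (E : set 'rV[R]_n) : Prop :=
  E `<=` @unit_sphere R n /\ (@lebesgue_outer R n).-caratheodory (sector E).

(* The factor n cancels in the normalisation; [fine] loses nothing, since the
   sector of the sphere is the unit ball without its centre. *)
Definition sphere_measure (R : realType) (n : nat) (E : set 'rV[R]_n) : \bar R :=
  (lebesgue_outer (sector E) *
   (fine (lebesgue_outer (sector (@unit_sphere R n))))^-1%:E)%E.

Definition avoiding (R : realType) (n : nat) (X : set R) (I : set 'rV[R]_n) : Prop :=
  forall xi eta, I xi -> I eta -> ~ X (inner xi eta).

Definition alpha (R : realType) (n : nat) (X : set R) : \bar R :=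
  ereal_sup [set @sphere_measure R n I
            | I in [set I | sphere_measurable I /\ avoiding X I]].
Arguments alpha {R} n X.

(* Main.v *)
(* Let A_k be Borel avoiding sets whose measures tend to the supremum and let f,
   with 0 <= f <= 1, be a weak limit of their indicators. For unit vectors x, y
   with t = <x,y> in (-1,1), the mean over all rotations g of u(gx) v(gy) tends
   to 0 whenever u tends weakly to 0. This needs n >= 3: the points at inner
   product t from y then form a circle, and the inner product of two random
   points of that circle has an absolutely continuous law. Consequently, if t
   is in X, the mean of f(gx) f(gy) is the limit of the mean of the indicators
   of gx in A_k and gy in A_k, which is 0.
   If x and y are density points, in the sense of small rotations, of the set
   {f > 0}, this mean is positive. So the set of density points, whose measure
   is at least the integral of f, contains no pair with inner product in X and
   in (-1,1). If 1 is in X only the empty set is avoiding. If -1 is in X, one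
   keeps a single point of every antipodal pair; no measure is lost, since then
   the integral of f over a symmetric set is at most half of its measure. *)

From HB Require Import structures.
From mathcomp Require Import all_boot all_order all_algebra.
From mathcomp Require Import all_classical all_reals all_analysis.
From mathcomp Require Import measurable_realfun.
From mathcomp Require Import ring lra zify.
Require Import Defs.

Set Implicit Arguments.
Unset Strict Implicit.
Unset Printing Implicit Defensive.

Import Order.TTheory GRing.Theory Num.Theory.
Import numFieldNormedType.Exports.

Local Open Scope classical_set_scope.
Local Open Scope ring_scope.

(** * Lebesgue outer measure *)

Section LebesgueOuter.
Variables (R : realType) (n : nat).
Local Notation Rn := 'rV[R]_n.+1.
Implicit Types (A : set Rn) (a b x : Rn).

(** Products do not pass to weak limits, so avoidance survives only because the mean of u(gx) v(gy)
    decays. There v may vary with the index, so the product of two indicators can be expanded around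
    f in both factors. For the decay, u(gx) is averaged over a circle and the square of that average
    is an integral against a law on inner products; this law has a density that is bounded up to a
    small error, and weak convergence kills a bounded kernel. Each t is treated on its own, which is
    how an arbitrary X is handled; at t = 1 and t = -1 the circle shrinks to a point. Surface
    measure is given by sectors and an outer measure, so the analysis uses a Borel measure [sigma]
    on R^n, the image of Lebesgue measure on the punctured unit ball under radial projection. A
    measurable avoiding set loses little when cut down to a Borel subset, and subsets stay avoiding.
    Rotations are orthonormal frames; invariance under reflections is enough, since two reflections
    carry a pair of vectors to any pair with the same inner products. *)

Definition box_vol (ab : Rn * Rn) : R := \prod_(i < n.+1) (ab.2 0 i - ab.1 0 i).

Lemma box_vol_ge0 (c : nat -> Rn * Rn) A k :
  box_cover A c -> 0 <= box_vol (c k).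
Proof. by move=> [H _]; apply: prodr_ge0 => i _; rewrite subr_ge0. Qed.

Lemma box_vol0 : box_vol (0, 0) = 0.
Proof. by rewrite /box_vol big_ord_recl/= !mxE subrr mul0r. Qed.

Lemma box00 : box (0 : Rn) 0 = set0.
Proof.
by apply/seteqP; split=> // x /(_ 0); rewrite !mxE => /andP[/lt_le_trans h /h]; rewrite ltxx.
Qed.

Lemma lebesgue_outer_ge0 A : (0 <= lebesgue_outer A)%E.
Proof.
apply: le_ereal_inf_tmp => _ [c cA <-].
by apply: nneseries_ge0 => k _ _; rewrite lee_fin; exact: box_vol_ge0 cA.
Qed.

Lemma lebesgue_outer_box a b :
  (forall i, a 0 i <= b 0 i) -> (lebesgue_outer (box a b) <= (box_vol (a, b))%:E)%E.
Proof.
move=> ab; apply: ereal_inf_lbound.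
exists (fun k : nat => if k == 0%N then (a, b) else (0, 0)).
  split; first by case.
  by move=> x abx; exists 0%N.
rewrite (@nneseries_split _ _ 0%N 1%N)/=; last first.
  move=> [|k] _ /=; rewrite lee_fin; first by apply: prodr_ge0 => i _; rewrite subr_ge0.
  by rewrite -/(box_vol (0, 0)) box_vol0.
rewrite eseries0 ?adde0//; first by rewrite big_nat1.
by move=> [|k]//= _ _; rewrite -/(box_vol (0, 0)) box_vol0.
Qed.

Lemma lebesgue_outer0 : lebesgue_outer (set0 : set Rn) = 0%E.
Proof.
apply/eqP; rewrite eq_le lebesgue_outer_ge0 andbT -box00.
by apply: (le_trans (lebesgue_outer_box _)) => //; rewrite box_vol0.
Qed.

Lemma lebesgue_outer_subadditive A (F : (set Rn)^nat) :
  subset_sigma_subadditive (@lebesgue_outer R n.+1) A F.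
Proof.
move=> AF.
have [[i ioo]|] := pselect (exists i, lebesgue_outer (F i) = +oo%E).
  rewrite (eseries_pinfty _ _ ioo) ?leey// => k _.
  by rewrite -ltNye (lt_le_trans _ (lebesgue_outer_ge0 _)).
rewrite -forallNE => Foo.
apply/lee_addgt0Pr => e e0.
have -> : e = (PosNum e0)%:num by [].
rewrite (le_trans _ (epsilon_trick _ _ _))//; last by move=> k; exact: lebesgue_outer_ge0.
set del := fun k => ((PosNum e0)%:num / (2 ^ k.+1)%:R).
have /choice[c Hc] : forall k, exists c, box_cover (F k) c /\
    (\sum_(j <oo) (box_vol (c j))%:E <= lebesgue_outer (F k) + (del k)%:E)%E.
  move=> k; have d0 : 0 < del k by rewrite /del divr_gt0// ltr0n expn_gt0.
  have fin : lebesgue_outer (F k) \is a fin_num.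
    rewrite ge0_fin_numE ?lebesgue_outer_ge0// ltey; exact/eqP.
  have [x [c cF <-] cx] := lb_ereal_inf_adherent d0 fin.
  by exists c; split=> //; exact: ltW.
have vol0 k j : (0 <= (box_vol (c k j))%:E)%E.
  by rewrite lee_fin; exact: box_vol_ge0 (Hc k).1.
have /card_esym/ppcard_eqP[f] := card_nat2.
apply: (@le_trans _ _ (\sum_(k <oo) \sum_(j <oo) (box_vol (c k j))%:E)%E); last first.
  by apply: lee_nneseries => [k _ _|k _]; [by apply: nneseries_ge0 => j _ _; exact: vol0|exact: (Hc k).2].
have -> : (\sum_(k <oo) \sum_(j <oo) (box_vol (c k j))%:E =
    \esum_(p in setT) (box_vol (c p.1 p.2))%:E)%E.
  rewrite nneseries_esumT; last by move=> k; apply: nneseries_ge0 => j _ _; exact: vol0.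
  rewrite (eq_esum (b := fun k => \esum_(j in setT) (box_vol (c k j))%:E)); last first.
    by move=> k _; rewrite nneseries_esumT.
  rewrite esum_esum//; congr esum.
  by apply/seteqP; split=> // -[].
rewrite (reindex_esum setT setT f)//.
rewrite -nneseries_esumT//.
apply: ereal_inf_lbound; exists (fun j => c (f j).1 (f j).2) => //.
split=> [j|x /AF[k _ Fx]]; first exact: (Hc _).1.1.
have [j _ cx] := (Hc k).1.2 _ Fx.
by exists (f^-1%FUN (k, j)) => //=; rewrite invK ?inE.
Qed.

HB.instance Definition _ := isSubsetOuterMeasure.Build R Rn (@lebesgue_outer R n.+1)
  lebesgue_outer0 lebesgue_outer_ge0 lebesgue_outer_subadditive.

End LebesgueOuter.

Section LebesgueOuterTheory.
Variables (R : realType) (n : nat).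
Local Notation Rn := 'rV[R]_n.+1.
Implicit Types (A : set Rn) (a b x : Rn).

Lemma lebesgue_outer_translate A v :
  lebesgue_outer [set x | A (x + v)] = lebesgue_outer A.
Proof.
suff le (B : set Rn) (w : Rn) : (lebesgue_outer [set x : Rn | B (x + w)%R] <= lebesgue_outer B)%E.
  apply/eqP; rewrite eq_le le/=.
  rewrite [leLHS](_ : _ = lebesgue_outer [set x : Rn | A (x - v + v)]) ?(le [set x | A (x + v)])//.
  by congr lebesgue_outer; apply/seteqP; split=> x /=; rewrite subrK.
apply: le_ereal_inf_tmp => _ [c [c0 Bc] <-].
apply: ereal_inf_lbound; exists (fun k => ((c k).1 - w, (c k).2 - w)).
  split=> [k i|x /= /Bc[k _ cx]]; first by rewrite /= !mxE lerB.
  by exists k => // i; move: (cx i); rewrite /= !mxE ltrBlDr lerBrDr.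
apply: eq_eseriesr => k _; congr EFin; apply: eq_bigr => i _.
by rewrite /= !mxE; ring.
Qed.

(** Scaling a cover scales each volume by the same power. One inequality is enough, since only null
    sets are transported. *)
Lemma lebesgue_outer_scale A (t : R) : 0 < t ->
  ((t ^+ n.+1)%:E * lebesgue_outer [set x : Rn | A (t *: x)%R] <= lebesgue_outer A)%E.
Proof.
move=> t0; apply: le_ereal_inf_tmp => _ [c cA <-].
have [c0 Ac] := cA.
have tn0 : 0 < t ^+ n.+1 by rewrite exprn_gt0.
rewrite muleC -lee_pdivlMr//.
apply: ereal_inf_lbound; exists (fun k => (t^-1 *: (c k).1, t^-1 *: (c k).2)).
  split=> [k i|x /= /Ac[k _ cx]].
    by rewrite /= !mxE ler_pM2l ?invr_gt0.
  by exists k => // i; move: (cx i); rewrite /= !mxE [t^-1 * _]mulrC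
    [t^-1 * _]mulrC ltr_pdivrMr// ler_pdivlMr// [t * _]mulrC.
rewrite muleC -nneseriesZl; last first.
  by move=> k _; rewrite lee_fin; exact: box_vol_ge0 cA.
apply: eq_eseriesr => k _; rewrite -EFinM; congr EFin.
have -> : (t ^+ n.+1)^-1 = \prod_(i < n.+1) t^-1 by rewrite prodr_const card_ord exprVn.
rewrite -big_split/=.
by apply: eq_bigr => i _; rewrite !mxE mulrBr.
Qed.

Lemma lebesgue_outer_scale0 A (t : R) : 0 < t -> lebesgue_outer A = 0%E ->
  lebesgue_outer [set x | A (t *: x)] = 0%E.
Proof.
move=> t0 A0; have := lebesgue_outer_scale A t0; rewrite A0 => le0.
apply/eqP; rewrite eq_le lebesgue_outer_ge0 andbT.
by move: le0; rewrite -lee_pdivlMl ?exprn_gt0// mule0.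
Qed.

(* Cutting every box of a cover along the hyperplane preserves total volume. *)
Lemma caratheodory_halfspace (i : 'I_n.+1) (r : R) :
  (@lebesgue_outer R n.+1).-caratheodory [set x : Rn | x 0 i <= r].
Proof.
apply: (le_caratheodory_measurable (mu := @lebesgue_outer R n.+1)) => X.
apply: le_ereal_inf_tmp => _ [c cX <-]; have [c0 Xc] := cX.
pose m k := Num.max ((c k).1 0 i) (Num.min ((c k).2 0 i) r).
have m1 k : (c k).1 0 i <= m k by rewrite /m le_max lexx.
have m2 k : m k <= (c k).2 0 i.
  by rewrite /m ge_max c0/= ge_min lexx.
pose lo k := ((c k).1, \row_j (if j == i then m k else (c k).2 0 j)).
pose hi k := (\row_j (if j == i then m k else (c k).1 0 j), (c k).2).
have clo : box_cover (X `&` [set x | x 0 i <= r]) lo.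
  split=> [k j|x [/Xc[k _ cx]] /= xr].
    by rewrite /lo/= mxE; case: eqP => [->|_//]; exact: m1.
  exists k => // j; rewrite /lo/= mxE; have /andP[lx xu] := cx j.
  rewrite lx/=; case: eqP => [e|_//]; subst j.
  by rewrite /m le_max le_min xu xr orbT.
have chi : box_cover (X `&` ~` [set x | x 0 i <= r]) hi.
  split=> [k j|x [/Xc[k _ cx]] /= /negP]; rewrite -?ltNge.
    by rewrite /hi/= mxE; case: eqP => [->|_//]; exact: m2.
  move=> xr; exists k => // j; rewrite /hi/= mxE; have /andP[lx xu] := cx j.
  rewrite xu andbT; case: eqP => [e|_//]; subst j.
  by rewrite /m gt_max lx gt_min xr orbT.
have volD k : box_vol (c k) = box_vol (lo k) + box_vol (hi k).
  rewrite /box_vol (bigD1 i)//= [in X in _ = X + _](bigD1 i)//=.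
  rewrite [in X in _ = _ + X](bigD1 i)//= !mxE eqxx.
  rewrite [in X in _ = X + _](eq_bigr (fun j => (c k).2 0 j - (c k).1 0 j)); last first.
    by move=> j /negPf ji; rewrite mxE ji.
  rewrite [in X in _ = _ + X](eq_bigr (fun j => (c k).2 0 j - (c k).1 0 j)); last first.
    by move=> j /negPf ji; rewrite mxE ji.
  by rewrite -mulrDl; congr (_ * _); ring.
rewrite -/(box_vol _) (eq_eseriesr (g := fun k => (box_vol (lo k))%:E + (box_vol (hi k))%:E)%E);
  last by move=> k _; rewrite -EFinD -volD.
rewrite nneseriesD; last 2 first.
- by move=> k _ _; rewrite lee_fin; exact: box_vol_ge0 clo.
- by move=> k _ _; rewrite lee_fin; exact: box_vol_ge0 chi.
by apply: leeD; apply: ereal_inf_lbound; [exists lo|exists hi].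
Qed.

Lemma nbhs_open_box (a b x : Rn) : (forall i, a 0 i < x 0 i < b 0 i) ->
  nbhs x [set y : Rn | forall i, a 0 i < y 0 i < b 0 i].
Proof.
move=> abx; exists (fun _ j => [set` `]a 0 j, b 0 j[%R]).
  move=> i j; rewrite ord1; apply: near_in_itvoo; rewrite in_itv/=; exact: abx.
by move=> y /= yab i; have := yab 0 i; rewrite in_itv.
Qed.

Lemma box_vol_enlarge a b (e : R) : 0 < e -> (forall i, a 0 i <= b 0 i) ->
  exists2 d : R, 0 < d & box_vol (a, b + const_mx d) <= box_vol (a, b) + e.
Proof.
move=> e0 ab.
have c : (fun d : R => box_vol (a, b + const_mx d)) @ (0 : R) --> box_vol (a, b + const_mx 0).
  apply: cvg_big => [|i _]; first exact: mul_continuous.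
  under eq_fun do rewrite /= !mxE.
  rewrite /= !mxE; apply: cvgB; last exact: cvg_cst.
  by apply: cvgD; [exact: cvg_cst|exact: cvg_id].
have /cvgrPdist_le/(_ _ e0)[d /= d0 dP] := c.
exists (d / 2); first by rewrite divr_gt0.
have := dP (d / 2); rewrite /ball_/= sub0r normrN ger0_norm ?divr_ge0 ?(ltW d0)//.
rewrite ltr_pdivrMr// ltr_pMr// ltr1n => /(_ isT).
have -> : (const_mx 0 : Rn) = 0 by apply/rowP => i; rewrite !mxE.
by rewrite addr0 distrC => /(le_trans (ler_norm _)); rewrite lerBlDl addrC.
Qed.

(** Holds for arbitrary sets. A cover within e/2 of the infimum is enlarged to open boxes, the k-th
    one gaining at most (e/2) / 2^(k+1) in volume. *)
Lemma lebesgue_outer_regular A (e : R) : 0 < e ->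
  exists U, [/\ open U, A `<=` U & (lebesgue_outer U <= lebesgue_outer A + e%:E)%E].
Proof.
move=> e0; have [Aoo|Afin] := eqVneq (lebesgue_outer A) +oo%E.
  by exists setT; split; [exact: openT|by []|rewrite Aoo addye// leey].
have e20 : 0 < e / 2 by rewrite divr_gt0.
have Afin' : lebesgue_outer A \is a fin_num.
  by rewrite ge0_fin_numE ?lebesgue_outer_ge0// ltey.
have [_ [c cA <-] cle] := lb_ereal_inf_adherent e20 Afin'.
have /choice[d Hd] : forall k, exists d : R, 0 < d /\
   box_vol ((c k).1, (c k).2 + const_mx d) <= box_vol (c k) + e / 2 / (2 ^ k.+1)%:R.
  move=> k; have ek : 0 < e / 2 / (2 ^ k.+1)%:R by rewrite divr_gt0// ltr0n expn_gt0.
  have [d d0 dle] := box_vol_enlarge ek (cA.1 k).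
  by exists d; split=> //; move: dle; case: (c k).
exists (\bigcup_k [set y : Rn | forall i, (c k).1 0 i < y 0 i < ((c k).2 + const_mx (d k)) 0 i]).
split.
- apply: bigcup_open => k _; rewrite openE => x /= xk; exact: nbhs_open_box.
- move=> x /cA.2[k _ cx]; exists k => // i; have /andP[-> xu] := cx i.
  by rewrite /= !mxE (le_lt_trans xu)// ltrDl (Hd k).1.
apply: (@le_trans _ _ (\sum_(k <oo) ((box_vol (c k))%:E + (e / 2 / (2 ^ k.+1)%:R)%:E))%E).
  apply: (@le_trans _ _ (\sum_(k <oo) (box_vol ((c k).1, (c k).2 + const_mx (d k)))%:E)%E).
    apply: ereal_inf_lbound; exists (fun k => ((c k).1, (c k).2 + const_mx (d k))) => //.
    split=> [k i|x [k _ xk]].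
      by rewrite /= !mxE (le_trans (cA.1 k i))// lerDl ltW// (Hd k).1.
    by exists k => // i; have /andP[-> /ltW ->] := xk i.
  apply: lee_nneseries => k _; last by rewrite -EFinD lee_fin (Hd k).2.
  move=> _; rewrite lee_fin; apply: prodr_ge0 => i _; rewrite /= !mxE subr_ge0.
  by rewrite (le_trans (cA.1 k i))// lerDl ltW// (Hd k).1.
apply: (le_trans (epsilon_trick _ _ _)).
- by move=> k; rewrite lee_fin; exact: box_vol_ge0 cA.
- exact: ltW.
rewrite [e in leRHS](splitr e) EFinD addeA leeD2r//; exact: ltW.
Qed.

End LebesgueOuterTheory.

(** * The outer measure of a box is at least its volume *)

Section BoxVolume.
Variable R : realType.

(* Slicing along the first coordinate and integrating reduces the covering
   inequality to dimension one less; [P] selects the boxes met by a slice. *)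
Lemma box_vol_le_cover m (a b : 'rV[R]_m) (c : nat -> 'rV[R]_m * 'rV[R]_m)
    (P : nat -> bool) :
  (forall k i, (c k).1 0 i <= (c k).2 0 i) -> (forall i, a 0 i <= b 0 i) ->
  box a b `<=` [set x | exists2 k, P k & box (c k).1 (c k).2 x] ->
  ((\prod_(i < m) (b 0 i - a 0 i))%:E <=
   \sum_(k <oo) ((P k)%:R * \prod_(i < m) ((c k).2 0 i - (c k).1 0 i))%:E)%E.
Proof.
elim: m => [|m IH] in a b c P *.
  (* In dimension 0 the space is one point and every volume is the empty product 1; the point is
     covered, so some [P k] holds and the sum is at least 1. *)
  move=> c0 ab /(_ 0)[[]//|k Pk _].
  apply: (@le_trans _ _ (\sum_(0 <= j < k.+1) ((P j)%:R * \prod_(i < 0) ((c j).2 0 i - (c j).1 0 i))%:E)%E).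
    rewrite big_nat_recr//= Pk mul1r !big_ord0 leeDr//.
    by apply: sume_ge0 => j _; rewrite big_ord0 mulr1 lee_fin ler0n.
  apply: nneseries_lim_ge => j _ _; rewrite big_ord0 mulr1 lee_fin; exact: ler0n.
move=> c0 ab abc.
pose tl (x : 'rV[R]_m.+1) : 'rV[R]_m := \row_i x 0 (lift ord0 i).
pose c' k := (tl (c k).1, tl (c k).2).
pose vol' k := \prod_(i < m) ((c' k).2 0 i - (c' k).1 0 i).
have vol'0 k : 0 <= vol' k by apply: prodr_ge0 => i _; rewrite subr_ge0 !mxE.
pose v := \prod_(i < m) (tl b 0 i - tl a 0 i).
have v0 : 0 <= v by apply: prodr_ge0 => i _; rewrite subr_ge0 !mxE.
pose J k := `](c k).1 0 ord0, (c k).2 0 ord0]%classic.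
have slice y : y \in `]a 0 ord0, b 0 ord0] ->
    (v%:E <= \sum_(k <oo) ((P k)%:R * vol' k * \1_(J k) y)%:E)%E.
  rewrite in_itv/= => yab.
  have -> : (\sum_(k <oo) ((P k)%:R * vol' k * \1_(J k) y)%:E =
     \sum_(k <oo) ((P k && (y \in J k))%:R * vol' k)%:E)%E.
    apply: eq_eseriesr => k _; congr EFin; rewrite indicE.
    by case: (P k); case: (y \in J k); rewrite /= ?mul1r ?mulr1 ?mul0r ?mulr0.
  apply: IH => [k i|i|x xab]; rewrite ?mxE//.
  pose X : 'rV[R]_m.+1 := \row_i (if unlift ord0 i is Some j then x 0 j else y).
  have [i|k Pk cX] := abc X.
    rewrite mxE; case: unliftP => [j ->|->//].
    by have := xab j; rewrite !mxE.
  exists k; last by move=> i; have := cX (lift ord0 i); rewrite !mxE liftK.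
  rewrite Pk/= inE /J/= in_itv/=.
  by have := cX ord0; rewrite !mxE unlift_none.
pose F k : R -> R := fun y => (P k)%:R * vol' k * \1_(J k) y.
have F0 k y : (0 <= (F k y)%:E)%E by rewrite lee_fin !mulr_ge0// ler0n.
have mF k : measurable_fun setT (EFin \o F k).
  apply/measurable_EFinP; apply: measurable_funM; first exact: measurable_cst.
  by apply: measurable_indic; exact: measurable_itv.
have mSF : measurable_fun setT (fun y => (\sum_(k <oo) (F k y)%:E)%E).
  by apply: ge0_emeasurable_sum => [k y _ _|k _]; [exact: F0|exact: mF].
have itvE (p q : R) : p <= q -> lebesgue_measure `]p, q]%classic = (q - p)%:E.
  move=> pq; rewrite lebesgue_measure_itv/= lte_fin.
  by case: ltP => [//|qp]; rewrite (@le_anti _ _ p q) ?pq ?subrr.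
pose D := `]a 0 ord0, b 0 ord0]%classic.
have mD : measurable D by exact: measurable_itv.
have -> : (\prod_(i < m.+1) (b 0 i - a 0 i))%:E =
    (\int[lebesgue_measure]_(y in D) cst v%:E y)%E.
  rewrite integral_cst//= itvE// -EFinM big_ord_recl mulrC; congr (_ * _)%:E.
  by apply: eq_bigr => i _; rewrite !mxE.
apply: (@le_trans _ _ (\int[lebesgue_measure]_y (\sum_(k <oo) (F k y)%:E))%E).
  apply: (@le_trans _ _ (\int[lebesgue_measure]_(y in D)
     (\sum_(k <oo) (F k y)%:E))%E).
    apply: ge0_le_integral => //.
    exact: measurable_funTS.
  apply: ge0_subset_integral => // y _; apply: nneseries_ge0 => k _ _; exact: F0.
rewrite integral_nneseries//; apply: lee_nneseries => [k _ _|k _].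
  exact: integral_ge0.
rewrite [leLHS](_ : _ = \int[lebesgue_measure]_y
    (((P k)%:R * vol' k)%:E * (\1_(J k) y)%:E))%E//.
rewrite ge0_integralZl//; last by rewrite lee_fin mulr_ge0// ler0n.
  rewrite integral_indic//; last exact: measurable_itv.
  rewrite [X in (_ * X <= _)%E](_ : _ = ((c k).2 0 ord0 - (c k).1 0 ord0)%:E); last by rewrite -itvE//; congr lebesgue_measure; exact: setIT.
  rewrite -EFinM lee_fin big_ord_recl -mulrA ler_wpM2l ?ler0n//.
  rewrite mulrC le_eqVlt; apply/orP; left; apply/eqP; congr (_ * _).
  by apply: eq_bigr => i _; rewrite !mxE.
by apply/measurable_EFinP; by apply: measurable_indic; exact: measurable_itv.
Qed.

Lemma box_vol_le_outer n (a b : 'rV[R]_n.+1) : (forall i, a 0 i <= b 0 i) ->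
  ((box_vol (a, b))%:E <= lebesgue_outer (box a b))%E.
Proof.
move=> ab; apply: le_ereal_inf_tmp => _ [c [c0 abc] <-].
have := @box_vol_le_cover _ a b c xpredT c0 ab; rewrite /box_vol/=.
under eq_eseriesr do rewrite mul1r.
by apply=> x /abc[k _ ?]; exists k.
Qed.

End BoxVolume.

(** * Lebesgue measure on the Borel sets of R^n *)

Definition ratr_row (R : realType) n (a : 'rV[rat]_n) : 'rV[R]_n := map_mx ratr a.

(** Rational corners make this generating family countable: open sets become countable unions of its
    members, and a diagonal extraction can run through it. *)
Definition rat_box (R : realType) n : set (set 'rV[R]_n) :=
  range (fun ab : 'rV[rat]_n * 'rV[rat]_n => box (ratr_row R ab.1) (ratr_row R ab.2)).

(* An alias of ['rV[R]_n.+1] that carries its Borel sigma-algebra. *)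
Definition eucl (R : realType) (n : nat) := g_sigma_algebraType (@rat_box R n.+1).

Section EuclMeasurable.
Variables (R : realType) (n : nat).
Local Notation V := (eucl R n).

Lemma rat_boxI : setI_closed (@rat_box R n.+1).
Proof.
move=> _ _ [[a b] _ <-] [[c d] _ <-].
exists (\row_i Num.max (a 0 i) (c 0 i), \row_i Num.min (b 0 i) (d 0 i)) => //.
have hmax (p q : rat) : ratr (Num.max p q) = Num.max (ratr p) (ratr q) :> R.
  by rewrite !maxElt ltr_rat; case: ifP.
have hmin (p q : rat) : ratr (Num.min p q) = Num.min (ratr p) (ratr q) :> R.
  by rewrite !minElt ltr_rat; case: ifP.
apply/seteqP; split=> [x /= H|x [/= H1 H2] i].
  by split=> i; move: (H i); rewrite /= !mxE hmax hmin gt_max le_min =>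
    /andP[/andP[? ?] /andP[? ?]]; apply/andP.
move: (H1 i) (H2 i); rewrite !mxE hmax hmin gt_max le_min.
by move=> /andP[-> ->] /andP[-> ->].
Qed.

Lemma measurable_rat_box (A : set V) : @rat_box R n.+1 A -> measurable A.
Proof. exact: sub_gen_smallest. Qed.

Lemma rat_lt_ex (r : R) : exists q : rat, ratr q < r.
Proof.
have [|q] := @rat_in_itvoo R (r - 1) r; first by rewrite ltrBlDr ltrDl.
by rewrite in_itv/= => /andP[_ qr]; exists q.
Qed.

Lemma rat_gt_ex (r : R) : exists q : rat, r < ratr q.
Proof.
have [|q] := @rat_in_itvoo R r (r + 1); first by rewrite ltrDl.
by rewrite in_itv/= => /andP[qr _]; exists q.
Qed.

Lemma measurable_coord (i : 'I_n.+1) : measurable_fun setT (fun x : V => x 0 i).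
Proof.
apply: (measurability (@RGenOInfty.G R)); first exact: RGenOInfty.measurableE.
move=> _ [_ [r ->] <-]; rewrite setTI.
rewrite (_ : _ @^-1` _ = \bigcup_(ab : 'rV[rat]_n.+1 * 'rV[rat]_n.+1)
   [set x : V | r <= ratr (ab.1 0 i) /\ box (ratr_row R ab.1) (ratr_row R ab.2) x]).
  apply: countable_bigcupT_measurable => [|ab]; first exact: countableP.
  have [rab|rab] := pselect (r <= ratr (ab.1 0 i)).
    rewrite (_ : [set _ | _] = box (ratr_row R ab.1) (ratr_row R ab.2)).
      by apply: measurable_rat_box; exists ab.
    by apply/seteqP; split=> [x []//|x].
  rewrite (_ : [set _ | _] = set0)//.
  by apply/seteqP; split=> [x []//|x].
apply/seteqP; split=> [x /=|x [ab _ [/= rab /(_ i)]]]; last first.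
  by rewrite !mxE in_itv/= andbT => /andP[/(le_lt_trans rab)].
rewrite in_itv/= andbT => rx.
have /choice[b hb] := fun j : 'I_n.+1 => rat_gt_ex (x 0 j).
have /choice[a ha] : forall j : 'I_n.+1, exists q : rat,
    ratr q < x 0 j /\ (j = i -> r <= ratr q).
  move=> j; have [->|ji] := eqVneq j i; last first.
    by have [q qx] := rat_lt_ex (x 0 j); exists q; split=> // /eqP; rewrite (negPf ji).
  have [q] := rat_in_itvoo rx; rewrite in_itv/= => /andP[rq qx].
  by exists q; split=> // _; exact: ltW.
exists (\row_j a j, \row_j b j) => //=; split; first by rewrite mxE (ha i).2.
by move=> j; rewrite !mxE (ha j).1 (ltW (hb j)).
Qed.

Lemma measurable_eucl d (T : measurableType d) (f : T -> V) :
  (forall i, measurable_fun setT (fun t => f t 0 i)) -> measurable_fun setT f.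
Proof.
move=> mf; apply: (@measurability _ _ T V setT f (@rat_box R n.+1)) => //.
move=> _ [_ [[a b] _ <-] <-]; rewrite setTI.
rewrite (_ : _ @^-1` _ = \bigcap_(i : 'I_n.+1)
   ((fun t => f t 0 i) @^-1` `](ratr_row R a) 0 i, (ratr_row R b) 0 i]%classic)).
  apply: fin_bigcap_measurable => // i _; rewrite -[X in measurable X]setTI.
  by apply: mf => //; exact: measurable_itv.
apply/seteqP; split=> [t /= H i _|t H i]; first by rewrite /= in_itv/= H.
by have /= := H i I; rewrite in_itv.
Qed.

Lemma measurable_open (U : set V) : open (U : set 'rV[R]_n.+1) -> measurable U.
Proof.
move=> oU.
rewrite (_ : U = \bigcup_(ab : 'rV[rat]_n.+1 * 'rV[rat]_n.+1)
   [set x : V | box (ratr_row R ab.1) (ratr_row R ab.2) `<=` U /\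
      box (ratr_row R ab.1) (ratr_row R ab.2) x]).
  apply: countable_bigcupT_measurable => [|ab]; first exact: countableP.
  have [rab|rab] := pselect (box (ratr_row R ab.1) (ratr_row R ab.2) `<=` U).
    rewrite (_ : [set _ | _] = box (ratr_row R ab.1) (ratr_row R ab.2)).
      by apply: measurable_rat_box; exists ab.
    by apply/seteqP; split=> [x []//|x].
  rewrite (_ : [set _ | _] = set0)//.
  by apply/seteqP; split=> [x []//|x].
apply/seteqP; split=> [x Ux|x [ab _ [/= abU /abU//]]].
have : nbhs (x : 'rV[R]_n.+1) U by exact: open_nbhs_nbhs.
move=> /nbhs_ballP[e /= e0 eU].
have /choice[a ha] : forall j : 'I_n.+1, exists q : rat, x 0 j - e < ratr q < x 0 j.
  move=> j; have [|q] := @rat_in_itvoo R (x 0 j - e) (x 0 j).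
    by rewrite ltrBlDr ltrDl.
  by rewrite in_itv/= => qx; exists q.
have /choice[b hb] : forall j : 'I_n.+1, exists q : rat, x 0 j < ratr q < x 0 j + e.
  move=> j; have [|q] := @rat_in_itvoo R (x 0 j) (x 0 j + e).
    by rewrite ltrDl.
  by rewrite in_itv/= => qx; exists q.
exists (\row_j a j, \row_j b j) => //=; split; last first.
  by move=> j; rewrite !mxE; have /andP[_ ->] := ha j; have /andP[/ltW -> _] := hb j.
move=> y abY; apply: eU; split=> [//|i j]; rewrite ord1.
move: (abY j); rewrite !mxE => /andP[ya yb].
have /andP[a1 a2] := ha j; have /andP[b1 b2] := hb j.
rewrite /ball/= ltr_norml; apply/andP; split; lra.
Qed.

Lemma measurable_closed (U : set V) : closed (U : set 'rV[R]_n.+1) -> measurable U.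
Proof.
move=> cU; rewrite -(setCK U); apply: measurableC; apply: measurable_open.
exact: closed_openC.
Qed.

Lemma box_halfspaces (a b : 'rV[R]_n.+1) : box a b =
  \bigcap_(i : 'I_n.+1) ([set x : 'rV[R]_n.+1 | x 0 i <= b 0 i] `&`
     ~` [set x : 'rV[R]_n.+1 | x 0 i <= a 0 i]).
Proof.
apply/seteqP; split=> [x H i _|x H i].
  by have /andP[ax xb] := H i; split=> //=; apply/negP; rewrite -ltNge.
by have [/= xb /negP] := H i I; rewrite -ltNge => ->.
Qed.

(** The Caratheodory sets form a sigma-algebra, and a box is a finite intersection of half-spaces
    and complements of half-spaces. *)
Lemma measurable_caratheodory (A : set V) :
  measurable A -> (@lebesgue_outer R n.+1).-caratheodory A.
Proof.
move=> mA.
suff : (@lebesgue_outer R n.+1).-cara.-measurable A by [].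
apply: mA; split.
  split => [|B mB|F mF]; [exact: measurable0| |exact: bigcupT_measurable].
  by rewrite setTD; exact: measurableC.
move=> _ [[a b] _ <-]; rewrite box_halfspaces.
apply: fin_bigcap_measurable => // i _.
by apply: measurableI; [|apply: measurableC]; exact: caratheodory_halfspace.
Qed.

End EuclMeasurable.

Section FubiniSet.
Context d1 d2 (T1 : measurableType d1) (T2 : measurableType d2) (R : realType).
Variables (m1 : {sigma_finite_measure set T1 -> \bar R}).
Variables (m2 : {sigma_finite_measure set T2 -> \bar R}).

Lemma fubini_set (E : set (T1 * T2)) : measurable E ->
  (\int[m1]_x m2 [set y | E (x, y)] = \int[m2]_y m1 [set x | E (x, y)])%E.
Proof.
move=> mE; have := indic_fubini_tonelli m1 m2 mE.
rewrite indic_fubini_tonelli_FE// indic_fubini_tonelli_GE//.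
rewrite /xsection /ysection /=.
by under eq_integral do under eq_set do rewrite in_setE;
  under [in X in _ = X -> _]eq_integral do under eq_set do rewrite in_setE.
Qed.

End FubiniSet.

Section Inner.
Variables (R : realType) (n : nat).
Implicit Types x y z : 'rV[R]_n.

Lemma innerC x y : inner x y = inner y x.
Proof. by apply: eq_bigr => i _; rewrite mulrC. Qed.

Lemma innerDl x y z : inner (x + y) z = inner x z + inner y z.
Proof. by rewrite -big_split; apply: eq_bigr => i _; rewrite !mxE mulrDl. Qed.

Lemma innerZl (t : R) x y : inner (t *: x) y = t * inner x y.
Proof. by rewrite mulr_sumr; apply: eq_bigr => i _; rewrite !mxE mulrA. Qed.

Lemma innerDr x y z : inner z (x + y) = inner z x + inner z y.
Proof. by rewrite innerC innerDl !(innerC z). Qed.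

Lemma innerZr (t : R) x y : inner x (t *: y) = t * inner x y.
Proof. by rewrite innerC innerZl innerC. Qed.

Lemma innerNl x y : inner (- x) y = - inner x y.
Proof. by rewrite -scaleN1r innerZl mulN1r. Qed.

Lemma innerNr x y : inner x (- y) = - inner x y.
Proof. by rewrite innerC innerNl innerC. Qed.

Lemma inner0l x : inner 0 x = 0.
Proof. by apply: big1 => i _; rewrite mxE mul0r. Qed.

Lemma inner_ge0 x : 0 <= inner x x.
Proof. by apply: sumr_ge0 => i _; rewrite -expr2 sqr_ge0. Qed.

Lemma inner_eq0 x : (inner x x == 0) = (x == 0).
Proof.
apply/eqP/eqP => [x0|->]; last exact: inner0l.
apply/rowP => i; rewrite mxE; apply/eqP; rewrite -sqrf_eq0 expr2.
have : \sum_(i < n) x 0 i ^+ 2 = 0 by rewrite -[RHS]x0; apply: eq_bigr => j _; rewrite expr2.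
by move=> /psumr_eq0P h; rewrite -expr2 h// => j _; exact: sqr_ge0.
Qed.

End Inner.

Lemma measurable_inner (R : realType) n d (T : measurableType d) (f g : T -> eucl R n) :
  measurable_fun setT f -> measurable_fun setT g ->
  measurable_fun setT (fun t => inner (f t) (g t)).
Proof.
move=> mf mg; apply: measurable_sum => i; apply: measurable_funM.
  by apply: (measurableT_comp (@measurable_coord R n i)).
by apply: (measurableT_comp (@measurable_coord R n i)).
Qed.

(** * Lebesgue measure as a sigma-finite Borel measure, and its invariance under isometries *)

Section Leb.
Variables (R : realType) (n : nat).
Local Notation V := (eucl R n).
Local Notation Rn := 'rV[R]_n.+1.

(** The same function as the outer measure, on the type that carries Borel sets. Monotonicity and
    subadditivity of the outer measure therefore remain available for sets not known to be Borel. *)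
Definition leb (A : set V) : \bar R := lebesgue_outer (A : set Rn).

Lemma leb0 : leb set0 = 0%E. Proof. exact: lebesgue_outer0. Qed.

Lemma leb_ge0 A : (0 <= leb A)%E. Proof. exact: lebesgue_outer_ge0. Qed.

Lemma leb_semi_sigma_additive : semi_sigma_additive leb.
Proof.
move=> F mF tF mUF.
apply: (@caratheodory_measure_sigma_additive R Rn (@lebesgue_outer R n.+1)) => //.
- by move=> i; exact: measurable_caratheodory.
- exact: measurable_caratheodory.
Qed.

HB.instance Definition _ := isMeasure.Build _ V R leb leb0 leb_ge0 leb_semi_sigma_additive.

Lemma measurable_box (a b : Rn) : measurable (box a b : set V).
Proof.
rewrite box_halfspaces; apply: fin_bigcap_measurable => // i _.
have mH r : measurable [set x : V | x 0 i <= r].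
  rewrite [X in measurable X](_ : _ = setT `&` (fun x : V => x 0 i) @^-1` `]-oo, r]%classic).
    by apply: measurable_coord => //; exact: measurable_itv.
  by rewrite setTI; apply/seteqP; split=> x /=; rewrite in_itv.
by apply: measurableI; [|apply: measurableC]; exact: mH.
Qed.

Lemma leb_box (a b : Rn) : (forall i, a 0 i <= b 0 i) -> leb (box a b) = (box_vol (a, b))%:E.
Proof.
by move=> ab; apply/eqP; rewrite eq_le box_vol_le_outer// andbT lebesgue_outer_box.
Qed.

Lemma bigcup_box : \bigcup_k box (const_mx (- k%:R) : Rn) (const_mx k%:R) = setT.
Proof.
apply/seteqP; split=> // x _.
pose M := \sum_i `|x 0 i|.
exists (Num.truncn M).+1 => // i; rewrite !mxE.
have xM : `|x 0 i| < (Num.truncn M).+1%:R.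
  apply: (@le_lt_trans _ _ M); last exact: Num.Theory.truncnS_gt.
  by rewrite /M (bigD1 i)//= lerDl sumr_ge0.
by move: xM; rewrite ltr_norml => /andP[-> /ltW ->].
Qed.

Lemma leb_sigma_finite : sigma_finite setT leb.
Proof.
exists (fun k => box (const_mx (- k%:R) : Rn) (const_mx k%:R)).
  by rewrite bigcup_box.
move=> k; split; first exact: measurable_box.
rewrite leb_box ?ltry// => i; rewrite !mxE; have := @ler0n R k; lra.
Qed.

HB.instance Definition _ := Measure_isSigmaFinite.Build _ V R leb leb_sigma_finite.

Lemma leb_translate (A : set V) (v : Rn) : leb [set x : V | A (x + v)] = leb A.
Proof. exact: lebesgue_outer_translate. Qed.

Definition open_ball (r : R) : set V := [set x | inner x x < r].

Lemma measurable_open_ball r : measurable (open_ball r).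
Proof.
have -> : open_ball r = setT `&` (fun x : V => inner x x) @^-1` `]-oo, r[%classic.
  by rewrite setTI; apply/seteqP; split=> x /=; rewrite in_itv.
by apply: measurable_inner => //; exact: measurable_itv.
Qed.

Lemma leb_open_ball_lty r : (leb (open_ball r) < +oo)%E.
Proof.
have [k rk] : exists k : nat, r <= k%:R ^+ 2 /\ (0 < k)%N.
  exists (Num.truncn `|r|).+1; split=> //.
  have rk := @Num.Theory.truncnS_gt R `|r|.
  apply: (le_trans (ler_norm r)); apply: (le_trans (ltW rk)).
  by rewrite expr2 ler_peMr// ler1n.
apply: (@le_lt_trans _ _ (leb (box (const_mx (- k%:R) : Rn) (const_mx k%:R)))); last first.
  rewrite leb_box ?ltry// => i; rewrite !mxE; have := @ler0n R k; lra.
apply: le_measure; rewrite ?inE; [exact: measurable_open_ball|exact: measurable_box|].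
move=> x /= xr i; rewrite !mxE.
have : x 0 i ^+ 2 < k%:R ^+ 2.
  apply: le_lt_trans (lt_le_trans xr rk.1).
  rewrite /inner (bigD1 i)//= -expr2 lerDl sumr_ge0// => j _.
  by rewrite -expr2 sqr_ge0.
rewrite -(ger0_norm (ler0n R k)) -[x 0 i ^+ 2]real_normK ?num_real//.
rewrite ltr_pXn2r ?nnegrE ?normr_ge0 ?ler0n// (ger0_norm (ler0n R k)) ltr_norml => /andP[-> /ltW ->//].
Qed.

Lemma leb_open_ball_gt0 r : 0 < r -> (0 < leb (open_ball r))%E.
Proof.
move=> r0.
(* The box with side [c] at the origin has squared norms at most (n+1) c^2 < s^2, and s^2 <= s <=
   r. *)
pose s := Num.min 1 r; pose c : R := s / n.+2%:R.
have s0 : 0 < s by rewrite lt_min ltr01.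
have c0 : 0 < c by rewrite divr_gt0.
have sub : box (0 : Rn) (const_mx c) `<=` open_ball r.
  move=> x /= xc; rewrite /open_ball/=.
  apply: (@le_lt_trans _ _ (\sum_(i < n.+1) c ^+ 2)).
    apply: ler_sum => i _; rewrite -expr2.
    have := xc i; rewrite !mxE => /andP[x0 xic].
    by rewrite ler_pXn2r// nnegrE ltW.
  rewrite sumr_const card_ord /c exprMn -[ltLHS]mulr_natr.
  have n2 : (0 : R) < n.+2%:R by rewrite ltr0n.
  have -> : s ^+ 2 * n.+2%:R^-1 ^+ 2 * n.+1%:R = s ^+ 2 * (n.+1%:R / n.+2%:R / n.+2%:R) :> R.
    by field; rewrite gt_eqF// ltr0n.
  apply: (@lt_le_trans _ _ s); last by rewrite ge_min lexx orbT.
  apply: (@lt_le_trans _ _ (s ^+ 2)).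
    rewrite gtr_pMr ?exprn_gt0// ltr_pdivrMr// ltr_pdivrMr// mul1r -natrM ltr_nat.
    by rewrite mulSn mulnS; lia.
  by rewrite expr2 ler_piMr ?(ltW s0)// ge_min lexx.
apply: (@lt_le_trans _ _ (leb (box (0 : Rn) (const_mx c)))).
  rewrite leb_box => [|i]; last by rewrite !mxE ltW.
  by rewrite lte_fin; apply: prodr_gt0 => i _; rewrite !mxE subr0.
by apply: le_measure => //; rewrite ?inE; [exact: measurable_box|exact: measurable_open_ball].
Qed.

Lemma measurable_pair_eucl_add d (T : measurableType d) (f g : T -> V) :
  measurable_fun setT f -> measurable_fun setT g ->
  measurable_fun setT ((fun t => f t + g t : Rn) : T -> V).
Proof.
move=> mf mg; apply: measurable_eucl => i.
under eq_fun do rewrite mxE.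
by apply: measurable_funD; apply: (measurableT_comp (@measurable_coord R n i)).
Qed.

(* Uniqueness of translation invariant measures: by Fubini, pairing A with the
   unit ball B in both orders gives leb B * leb A = leb (T^-1 A) * leb B. *)
Lemma leb_isometry (T S : Rn -> Rn) (A : set V) :
  (forall x y, T (x + y) = T x + T y) -> (forall x, T (S x) = x) ->
  (forall x, inner (T x) (T x) = inner x x) ->
  measurable_fun setT (T : V -> V) -> measurable A ->
  leb [set x | A (T x)] = leb A.
Proof.
move=> TD TS Tn mT mA.
pose B : set V := open_ball 1.
have mB : measurable B by exact: measurable_open_ball.
have mAT : measurable [set x : V | A (T x)] by rewrite -[X in measurable X]setTI; exact: mT.
have TN x : T (- x) = - T x.
  have T0 : T 0 = 0 by apply: (@addIr _ (T 0)); rewrite -TD !add0r.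
  by apply/eqP; rewrite -subr_eq0 opprK -TD addNr T0.
have mT1 : measurable_fun setT ((fun z : V * V => T z.1) : V * V -> V).
  exact: measurableT_comp.
have mE1 : measurable [set z : V * V | B z.1 /\ A (T z.1 + z.2)].
  apply: measurableI; first by rewrite -[X in measurable X]setTI; exact: measurable_fst.
  rewrite -[X in measurable X]setTI; apply: measurable_pair_eucl_add => //.
have mE2 : measurable [set z : V * V | B (T z.1 - z.2) /\ A (T z.1)].
  apply: measurableI; last by rewrite -[X in measurable X]setTI; exact: mT1.
  rewrite -[X in measurable X]setTI; apply: measurable_pair_eucl_add => //.
  apply: measurable_eucl => i; under eq_fun do rewrite mxE.
  by apply: measurableT_comp => //; apply: (measurableT_comp (@measurable_coord R n i)).
pose E1 (x : V) : set V := [set y | B x /\ A (T x + y)].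
pose E2 (x : V) : set V := [set y | B (T x - y) /\ A (T x)].
have F1 : (\int[leb]_x leb (E1 x) = \int[leb]_y leb [set x | E1 x y])%E := fubini_set leb leb mE1.
have F2 : (\int[leb]_x leb (E2 x) = \int[leb]_y leb [set x | E2 x y])%E := fubini_set leb leb mE2.
have e1 : (\int[leb]_x leb (E1 x) = leb A * leb B)%E.
  rewrite -integral_cst// [RHS]integral_mkcond; apply: eq_integral => x _.
  rewrite patchE; case: ifPn => [/[!inE] Bx|/negP Bx].
    by rewrite -(leb_translate A (T x)); congr leb; apply/seteqP; split=> y /=;
      rewrite addrC => // -[].
  rewrite (_ : E1 x = set0) ?leb0//; apply/seteqP; split=> // y [Bx' _].
  by apply: Bx; rewrite inE.
have e2 : (\int[leb]_x leb (E2 x) = leb B * leb [set x | A (T x)])%E.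
  rewrite -integral_cst// [RHS]integral_mkcond; apply: eq_integral => x _.
  rewrite patchE; case: ifPn => [/[!inE] Ax|/negP Ax].
    rewrite -(leb_translate B (- T x)); congr leb; apply/seteqP; split=> y /=;
      by rewrite /B /open_ball/= -opprB innerNl innerNr opprK => // -[].
  rewrite (_ : E2 x = set0) ?leb0//; apply/seteqP; split=> // y [_ Ax'].
  by apply: Ax; rewrite inE.
have : (leb A * leb B = leb B * leb [set x | A (T x)])%E.
  rewrite -e1 -e2 F1 F2.
  apply: eq_integral => y _.
  (* The shift by [S y] turns the condition [A (T x + y)] into [A (T x)]; as [T] preserves norms,
     [B (x - S y)] is the same as [B (T x - y)]. *)
  rewrite -(leb_translate [set x | E1 x y] (- S y)).
  congr leb; apply/seteqP; split=> x; rewrite /E1 /E2 /= ?TD ?TN ?TS ?subrK => -[Bx Ax]; split=> //.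
    by move: Bx; rewrite /B /open_ball/= -Tn TD TN TS.
  by rewrite /B /open_ball/= -Tn TD TN TS.
rewrite muleC => AB; apply/eqP; rewrite eq_le.
have B0 : (0 < leb B)%E by exact: leb_open_ball_gt0.
have Bf : leb B \is a fin_num by rewrite ge0_fin_numE ?leb_ge0// leb_open_ball_lty.
by rewrite -(lee_pmul2l Bf B0) AB lexx -(lee_pmul2l Bf B0) AB lexx.
Qed.

End Leb.

(** * Integrals of bounded measurable functions *)

Section BoundedFunctions.
Context d (T : measurableType d) (R : realType).
Implicit Types f g : T -> R.

Definition bdfun f := measurable_fun setT f /\ exists M, forall x, `|f x| <= M.

Lemma bdfun_cst (r : R) : bdfun (fun=> r).
Proof. by split; [exact: measurable_cst|exists `|r|]. Qed.

Lemma bdfunD f g : bdfun f -> bdfun g -> bdfun (fun x => f x + g x).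
Proof.
move=> [mf [M Mf]] [mg [N Ng]]; split; first exact: measurable_funD.
by exists (M + N) => x; rewrite (le_trans (ler_normD _ _))// lerD.
Qed.

Lemma bdfunN f : bdfun f -> bdfun (fun x => - f x).
Proof.
move=> [mf [M Mf]]; split; first exact: measurableT_comp.
by exists M => x; rewrite normrN.
Qed.

Lemma bdfunB f g : bdfun f -> bdfun g -> bdfun (fun x => f x - g x).
Proof. by move=> bf bg; apply: bdfunD => //; exact: bdfunN. Qed.

Lemma bdfunM f g : bdfun f -> bdfun g -> bdfun (fun x => f x * g x).
Proof.
move=> [mf [M Mf]] [mg [N Ng]]; split; first exact: measurable_funM.
by exists (M * N) => x; rewrite normrM ler_pM.
Qed.

Lemma bdfun_norm f : bdfun f -> bdfun (fun x => `|f x|).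
Proof.
move=> [mf [M Mf]]; split; first exact: measurableT_comp.
by exists M => x; rewrite normr_id.
Qed.

Lemma bdfun_indic (A : set T) : measurable A -> bdfun (\1_A : T -> R).
Proof.
move=> mA; split; first exact: measurable_indic.
by exists 1 => x; rewrite indicE ger0_norm// lern1 leq_b1.
Qed.

End BoundedFunctions.

Lemma bdfun_comp d d' (T : measurableType d) (U : measurableType d') (R : realType)
    (g : U -> T) (f : T -> R) :
  bdfun f -> measurable_fun setT g -> bdfun (fun x => f (g x)).
Proof.
move=> [mf [M Mf]] mg; split; first exact: measurableT_comp.
by exists M => x; exact: Mf.
Qed.

Section BoundedIntegrals.
Context d (T : measurableType d) (R : realType).
Implicit Types f g : T -> R.
Variable mu : {finite_measure set T -> \bar R}.

Lemma bdfun_integrable f : bdfun f -> mu.-integrable setT (EFin \o f).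
Proof.
move=> [mf [M Mf]]; apply: measurable_bounded_integrable => //.
  by rewrite ltey_eq fin_num_measure.
by exists M; split; [exact: num_real|move=> y My x _; exact: le_trans (Mf x) (ltW My)].
Qed.

Lemma Rintegral_norm_le f M : bdfun f -> (forall x, `|f x| <= M) ->
  `| \int[mu]_x f x | <= M * fine (mu setT).
Proof.
move=> bf Mf; rewrite -Rintegral_cst//.
apply: (le_trans (le_normr_Rintegral _ (bdfun_integrable bf))) => //.
apply: le_Rintegral => //; first exact: bdfun_integrable (bdfun_norm bf).
exact: bdfun_integrable (bdfun_cst _ M).
Qed.

Lemma bdfun_dominated_cvg0 (f : nat -> T -> R) M :
  (forall k, measurable_fun setT (f k)) -> (forall k x, `|f k x| <= M) ->
  (forall x, f k x @[k --> \oo] --> 0) ->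
  (\int[mu]_x f k x) @[k --> \oo] --> 0.
Proof.
move=> mf Mf f0.
have := @dominated_cvg _ T R mu setT measurableT (fun k x => (f k x)%:E)
  (fun=> 0%E) (fun=> M%:E).
have intM : mu.-integrable setT (fun=> M%:E) by exact: bdfun_integrable (bdfun_cst _ M).
move=> H.
have : (\int[mu]_x (f k x)%:E)%E @[k --> \oo] --> (\int[mu]_x (fun=> 0%E) x)%E.
  apply: H => //.
  - by move=> k; apply/measurable_EFinP; exact: mf.
  - by move=> x _; apply/fine_cvgP; split; [exact: nearW|exact: f0].
  - by move=> k x _; rewrite lee_fin.
by rewrite integral0 => /fine_cvg.
Qed.

Lemma Rintegral_image d' (U : measurableType d') (phi : T -> U)
    (nu : {measure set U -> \bar R}) (f : U -> R) :
  measurable_fun setT phi -> (forall A, measurable A -> nu A = mu (phi @^-1` A)) ->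
  bdfun f ->
  \int[nu]_x f x = \int[mu]_x f (phi x).
Proof.
move=> mphi nuE bf; rewrite /Rintegral; congr fine.
have := @integral_pushforward _ _ _ _ _ phi mphi mu setT (EFin \o f).
move=> /(_ _ _ measurableT) <-.
- by apply: eq_measure_integral => A mA _; exact: nuE.
- by apply/measurable_EFinP; exact: bf.1.
- by apply: bdfun_integrable; exact: bdfun_comp.
Qed.

End BoundedIntegrals.

Section BoundedFubini.
Context d1 d2 (T1 : measurableType d1) (T2 : measurableType d2) (R : realType).
Variables (m1 : {finite_measure set T1 -> \bar R}).
Variables (m2 : {finite_measure set T2 -> \bar R}).
Variable f : T1 * T2 -> R.
Hypothesis bf : bdfun f.

Lemma bdfun_section1 x : bdfun (fun y => f (x, y)).
Proof. by apply: bdfun_comp bf _; exact: pair1_measurable. Qed.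

Lemma bdfun_section2 y : bdfun (fun x => f (x, y)).
Proof. by apply: bdfun_comp bf _; exact: pair2_measurable. Qed.

Lemma bdfun_integrable_prod : (m1 \x m2)%E.-integrable setT (EFin \o f).
Proof.
have [mf [M Mf]] := bf.
have mEf : measurable_fun setT (EFin \o f) by apply/measurable_EFinP.
apply/(integrable12ltyP _ _ mEf).
apply: (@le_lt_trans _ _ (\int[m1]_x cst (M%:E * m2 setT) x)%E).
  apply: ge0_le_integral => //.
  - by move=> x _; exact: integral_ge0.
  - apply: (measurable_fun_fubini_tonelli_F (fun z => `|(f z)%:E|%E)) => //.
    exact: measurableT_comp.
  - move=> x _; rewrite -[leRHS]/(M%:E * m2 setT)%E -integral_cst//.
    apply: ge0_le_integral => //.
    + apply: measurableT_comp => //; apply/measurable_EFinP.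
      exact: (bdfun_section1 x).1.
    by move=> y _; rewrite lee_fin (le_trans _ (Mf (x, y))).
rewrite integral_cst// ltey_eq; apply/orP; left.
by apply: fin_numM; [apply: fin_numM|]; rewrite ?fin_num_measure.
Qed.

Let inner1 x : (\int[m2]_y f (x, y))%:E = (\int[m2]_y (f (x, y))%:E)%E.
Proof.
by rewrite /Rintegral fineK//; apply: integrable_fin_num => //;
  exact: bdfun_integrable (bdfun_section1 x).
Qed.

Let inner2 y : (\int[m1]_x f (x, y))%:E = (\int[m1]_x (f (x, y))%:E)%E.
Proof.
by rewrite /Rintegral fineK//; apply: integrable_fin_num => //;
  exact: bdfun_integrable (bdfun_section2 y).
Qed.

Lemma bdfun_Fubini :
  \int[m1]_x \int[m2]_y f (x, y) = \int[m2]_y \int[m1]_x f (x, y).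
Proof.
rewrite /Rintegral; congr fine.
transitivity (\int[m1]_x \int[m2]_y (f (x, y))%:E)%E.
  by apply: eq_integral => x _; rewrite -inner1.
rewrite (Fubini bdfun_integrable_prod).
by apply: eq_integral => y _; rewrite -inner2.
Qed.

End BoundedFubini.

Lemma bdfun_Rintegral d1 d2 (T1 : measurableType d1) (T2 : measurableType d2)
    (R : realType) (m2 : {finite_measure set T2 -> \bar R}) (f : T1 * T2 -> R) :
  bdfun f -> bdfun (fun x => \int[m2]_y f (x, y)).
Proof.
move=> bf; split.
  apply/measurable_EFinP.
  rewrite (_ : _ \o _ = fubini_F m2 (EFin \o f)).
    (* Joint integrability is only a means to measurability here, so any finite measure may be put
       on the first factor; the zero measure is taken. *)
    exact: measurable_fubini_F (bdfun_integrable_prod mzero m2 bf).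
  apply/funext => x; rewrite /= /Rintegral fineK//; apply: integrable_fin_num => //.
  exact: bdfun_integrable (bdfun_section1 bf x).
have [_ [M Mf]] := bf.
exists (M * fine (m2 setT)) => x.
by apply: Rintegral_norm_le => [|y]; [exact: bdfun_section1|exact: Mf].
Qed.

(** The formula is the definition of the measure, so it holds for every set [A], measurable or
    not. *)
Lemma image_measure_ex d d' (T : measurableType d) (U : measurableType d') (R : realType)
    (mu : {finite_measure set T -> \bar R}) (phi : T -> U) : measurable_fun setT phi ->
  exists nu : {finite_measure set U -> \bar R},
    forall A, nu A = mu (phi @^-1` A).
Proof.
move=> mphi.
pose image A : \bar R := mu (phi @^-1` A).
have mpre A : measurable A -> measurable (phi @^-1` A).
  by move=> mA; rewrite -[X in measurable X]setTI; exact: mphi.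
have m0 : image set0 = 0%E by rewrite /image preimage_set0 measure0.
have mge0 A : (0 <= image A)%E by exact: measure_ge0.
have msa : semi_sigma_additive image.
  move=> F mF tF mUF; rewrite /image preimage_bigcup.
  apply: measure_semi_sigma_additive => [k||]; first exact: mpre.
    by move=> i j _ _ [x [/= Fi Fj]]; apply: tF => //; exists (phi x).
  by rewrite -preimage_bigcup; exact: mpre.
have mfin : fin_num_fun image by move=> A mA; apply: fin_num_measure; exact: mpre.
pose mm := isMeasure.Build _ _ _ image m0 mge0 msa.
pose nu0 : {measure set U -> \bar R} := HB.pack image mm.
pose mf := Measure_isFinite.Build _ _ _ nu0 mfin.
pose nu : {finite_measure set U -> \bar R} := HB.pack image mm mf.
by exists nu.
Qed.

(** A Radon-Nikodym density may be unbounded, but the set where it exceeds N has [nu]-measure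
    tending to 0. Cutting the density off there keeps the kernel among the bounded test functions,
    at the price of an error proportional to the bound on f. *)
Lemma bounded_density d (T : measurableType d) (R : realType)
    (nu mu : {finite_measure set T -> \bar R}) (e : R) : 0 < e ->
  (forall A, measurable A -> mu A = 0%E -> nu A = 0%E) ->
  exists2 rho : T -> R, bdfun rho &
    forall f M, bdfun f -> (forall x, `|f x| <= M) ->
    `| \int[nu]_x f x - \int[mu]_x (f x * rho x) | <= M * e.
Proof.
move=> e0 ac.
have numu : nu `<< mu by apply/null_content_dominatesP => A mA; exact: ac.
pose g := Radon_Nikodym (charge_of_finite_measure nu) mu.
pose r x := fine (g x).
have gr x : g x = (r x)%:E by rewrite fineK// Radon_Nikodym_fin_num.
have mr : measurable_fun setT r.
  apply/measurable_EFinP; rewrite (_ : _ \o _ = g).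
    have gint : mu.-integrable setT g by exact: Radon_Nikodym_integrable.
    exact: measurable_int gint.
  by apply/funext => x /=; rewrite gr.
pose B (N : nat) := (fun x => `|r x|) @^-1` `]-oo, N%:R]%classic.
have mB N : measurable (B N).
  rewrite -[X in measurable X]setTI.
  by apply: (measurableT_comp (@normr_measurable _ _) mr) => //; exact: measurable_itv.
have mCB N : measurable (~` B N) by exact: measurableC.
have cvgB : (nu \o (fun N => ~` B N)) N @[N --> \oo] --> 0%E.
  rewrite -(measure0 nu) (_ : set0 = \bigcap_N ~` B N); last first.
    rewrite -setC_bigcup (_ : \bigcup_N B N = setT) ?setCT//.
    apply/seteqP; split=> // x _; exists (Num.truncn `|r x|).+1 => //.
    by rewrite /B/= in_itv/= ltW// Num.Theory.truncnS_gt.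
  apply: nonincreasing_cvg_mu => //.
  - by rewrite ltey_eq fin_num_measure.
  - exact: bigcapT_measurable.
  - move=> m N mN; apply/subsetPset => x /= Bx Bm; apply: Bx; move: Bm.
    by rewrite /B/= !in_itv/= => /le_trans; apply; rewrite ler_nat.
have [N BN] : exists N, fine (nu (~` B N)) <= e.
  have : fine (nu (~` B N)) @[N --> \oo] --> 0 by exact: fine_cvg cvgB.
  move=> /cvgrPdist_le/(_ _ e0)[N _ /(_ N (leqnn N))] /=.
  by rewrite sub0r normrN ger0_norm ?fine_ge0//; exists N.
exists (fun x => r x * \1_(B N) x).
  split; first by apply: measurable_funM => //; exact: measurable_indic.
  exists N%:R => x; rewrite indicE; case: (boolP (x \in B N)) => [|_]; last by rewrite mulr0 normr0.
  by rewrite inE /B/= in_itv/= mulr1.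
move=> f M bf fM.
have intf := bdfun_integrable nu bf.
have intfS A : measurable A -> nu.-integrable A (EFin \o f).
  by move=> mA; exact: integrableS intf.
have -> : \int[mu]_x (f x * (r x * \1_(B N) x)) = \int[nu]_(x in B N) f x.
  rewrite /Rintegral; congr fine.
  rewrite -(Radon_Nikodym_change_of_variables numu (mB N) (intfS _ (mB N))).
  rewrite [RHS]integral_mkcond; apply: eq_integral => x _.
  rewrite patchE indicE; case: (boolP (x \in B N)) => _; last by rewrite !mulr0.
  by rewrite -/(g x) gr -EFinM mulr1.
have -> : \int[nu]_x f x = \int[nu]_(x in B N) f x + \int[nu]_(x in ~` B N) f x.
  by rewrite -Rintegral_setU// ?setUv//; apply/eqP; exact: setICr.
rewrite addrC addKr.
apply: (le_trans (le_normr_Rintegral _ (intfS _ (mCB N)))) => //.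
have M0 : 0 <= M by apply: le_trans (fM point).
apply: le_trans (ler_wpM2l M0 BN); rewrite -Rintegral_cst//.
apply: le_Rintegral => //.
- by apply: (integrableS measurableT) => //; exact: bdfun_integrable (bdfun_norm bf).
- by apply: (integrableS measurableT) => //; exact: bdfun_integrable (bdfun_cst _ M).
Qed.

Lemma bdfun_ae_eq_Rintegral d (T : measurableType d) (R : realType)
    (mu : {finite_measure set T -> \bar R}) (S : set T) (f g : T -> R) :
  measurable S -> mu (~` S) = 0%E -> bdfun f -> bdfun g ->
  {in S, f =1 g} -> \int[mu]_x f x = \int[mu]_x g x.
Proof.
move=> mS S0 bf bg fg; rewrite /Rintegral; congr fine.
apply: ae_eq_integral => //.
- by apply/measurable_EFinP; exact: bf.1.
- by apply/measurable_EFinP; exact: bg.1.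
exists (~` S); split=> //; first exact: measurableC.
move=> x /= H Sx; apply: H => _; congr EFin; apply: fg.
by rewrite inE.
Qed.

(** * Compactness of averages over rotations *)

Section Compactness.
Context (R : realType) dV (V : measurableType dV) dO (Om : measurableType dO)
  dI (I : measurableType dI).
Variables (ip : V -> V -> R) (act : Om -> V -> V) (Sph : set V).
Variables (sigma : {finite_measure set V -> \bar R}).
Variables (P : {finite_measure set Om -> \bar R}).
Variables (tau : {finite_measure set I -> \bar R}).
Hypothesis tau1 : tau setT = 1%E.
Hypothesis mip : measurable_fun setT (fun z : V * V => ip z.1 z.2).
Hypothesis mact : measurable_fun setT (fun z : Om * V => act z.1 z.2).
Hypothesis ip_act : forall om x y, ip (act om x) (act om y) = ip x y.
Hypothesis sigma_act : forall om A, measurable A -> sigma (act om @^-1` A) = sigma A.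
Hypothesis mSph : measurable Sph.
Hypothesis sigma_Sph : sigma (~` Sph) = 0%E.
Hypothesis P_pair : forall x y x' y', Sph x -> Sph y -> Sph x' -> Sph y' ->
  ip x y = ip x' y' -> forall f g : V -> R, bdfun f -> bdfun g ->
  \int[P]_om (f (act om x) * g (act om y)) =
  \int[P]_om (f (act om x') * g (act om y')).

Variables (x0 y0 : V).
Hypotheses (Sx0 : Sph x0) (Sy0 : Sph y0).
Variable pt : R -> V.
Hypothesis mpt : measurable_fun setT pt.
Hypothesis ptP : forall a b, Sph a -> Sph b ->
  Sph (pt (ip a b)) /\ ip x0 (pt (ip a b)) = ip a b.
Variable w : I -> V.
Hypothesis mw : measurable_fun setT w.
Hypothesis Sw : forall s, Sph (w s).
Hypothesis ipw : forall s, ip (w s) y0 = ip x0 y0.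
Variable Lam : {finite_measure set R -> \bar R}.
Hypothesis LamE : forall f : R -> R, bdfun f ->
  \int[tau]_s \int[tau]_s' f (ip (w s) (w s')) = \int[Lam]_r f r.
Hypothesis Lam_ac : forall Z : set R, measurable Z ->
  sigma [set z | Z (ip x0 z)] = 0%E -> Lam Z = 0%E.

Variables (u v : nat -> V -> R).
Hypotheses (mu_ : forall k, measurable_fun setT (u k)) (mv_ : forall k, measurable_fun setT (v k)).
Hypotheses (u1 : forall k x, `|u k x| <= 1) (v1 : forall k x, `|v k x| <= 1).
Hypothesis u_weak : forall h : V -> R, bdfun h ->
  (\int[sigma]_x (u k x * h x)) @[k --> \oo] --> 0.

Let bu k : bdfun (u k). Proof. by split => //; exists 1. Qed.
Let bv k : bdfun (v k). Proof. by split => //; exists 1. Qed.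

Let K : R := fine (P setT).

Let macto d' (T : measurableType d') (f : T -> Om) (g : T -> V) :
  measurable_fun setT f -> measurable_fun setT g -> measurable_fun setT (fun t => act (f t) (g t)).
Proof.
by move=> mf mg; exact: (measurableT_comp mact (measurable_fun_pair mf mg)).
Qed.

Let mipo d' (T : measurableType d') (f g : T -> V) :
  measurable_fun setT f -> measurable_fun setT g -> measurable_fun setT (fun t => ip (f t) (g t)).
Proof.
by move=> mf mg; exact: (measurableT_comp mip (measurable_fun_pair mf mg)).
Qed.

Let bpair d' (T : measurableType d') k (f : T -> Om) (g h : T -> V) :
  measurable_fun setT f -> measurable_fun setT g -> measurable_fun setT h ->
  bdfun (fun t => u k (act (f t) (g t)) * u k (act (f t) (h t))).
Proof. by move=> mf mg mh; apply: bdfunM; apply: bdfun_comp (bu k) _; exact: macto. Qed.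

(** The correlation of [u k] with itself over all rotations. By [P_pair] it depends only on the
    inner product of the two points; [c] expresses it as a function of that number, through the
    points [pt r] at inner product r with [x0]. *)
Let C k x z := \int[P]_om (u k (act om x) * u k (act om z)).
Let c k r := C k x0 (pt r).

Let CE k a b : Sph a -> Sph b -> C k a b = c k (ip a b).
Proof.
by move=> Sa Sb; have [Sp ipp] := ptP Sa Sb; apply: P_pair => //; rewrite ipp.
Qed.

Let bC d' (T : measurableType d') k (g h : T -> V) :
  measurable_fun setT g -> measurable_fun setT h ->
  bdfun (fun t => C k (g t) (h t)).
Proof.
move=> mg mh.
apply: (@bdfun_Rintegral _ _ _ _ _ P
  (fun z : T * Om => u k (act z.2 (g z.1)) * u k (act z.2 (h z.1)))).
by apply: bpair => //; exact: measurableT_comp.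
Qed.

Let bc k : bdfun (c k). Proof. exact: bC. Qed.

Let c_le k r : `|c k r| <= K.
Proof.
rewrite -[leRHS]mul1r; apply: Rintegral_norm_le.
  by apply: bpair => //; exact: measurable_id.
by move=> om; rewrite normrM mulr_ile1.
Qed.

(** After exchanging the integrals, the rotation is moved from z to the kernel by invariance of
    [sigma]. The inner integral becomes [A k om], that is, [u k] tested against the bounded function
    [rho (ip (act om x0) z)]; it tends to 0 for each rotation, and dominated convergence
    concludes. *)
Let kernel_cvg0 (rho : R -> R) : bdfun rho ->
  (\int[sigma]_z (c k (ip x0 z) * rho (ip x0 z))) @[k --> \oo] --> 0.
Proof.
move=> brho.
have mipx x : measurable_fun setT (ip x) by apply: mipo => //; exact: measurable_cst.
pose A k om := \int[sigma]_z (u k z * rho (ip (act om x0) z)).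
have bA2 k : bdfun (fun z : Om * V => u k z.2 * rho (ip (act z.1 x0) z.2)).
  apply: bdfunM; first exact: bdfun_comp (bu k) _.
  by apply: bdfun_comp brho _; apply: mipo => //; exact: macto.
have E k : \int[sigma]_z (c k (ip x0 z) * rho (ip x0 z)) =
    \int[P]_om (u k (act om x0) * A k om).
  transitivity (\int[sigma]_z (C k x0 z * rho (ip x0 z))).
    apply: (bdfun_ae_eq_Rintegral mSph) => //.
    - by apply: bdfunM; [exact: bdfun_comp (bc k) _|exact: bdfun_comp brho _].
    - by apply: bdfunM; [exact: bC|exact: bdfun_comp brho _].
    - by move=> z; rewrite inE => Sz; rewrite CE.
  transitivity (\int[sigma]_z \int[P]_om
      (u k (act om x0) * u k (act om z) * rho (ip x0 z))).
    apply: eq_Rintegral => z _; rewrite RintegralZr//.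
    by apply: bdfun_integrable; apply: bpair => //; exact: measurable_id.
  rewrite (@bdfun_Fubini _ _ _ _ _ sigma P (fun zo : V * Om =>
      u k (act zo.2 x0) * u k (act zo.2 zo.1) * rho (ip x0 zo.1))); last first.
    by apply: bdfunM; [exact: bpair|apply: bdfun_comp brho _; exact: measurableT_comp].
  apply: eq_Rintegral => om _ /=.
  have mo : measurable_fun setT (act om) by exact: macto.
  under eq_Rintegral do rewrite -mulrA.
  rewrite RintegralZl//; last first.
    apply: bdfun_integrable; apply: bdfunM; first exact: bdfun_comp (bu k) _.
    exact: bdfun_comp brho _.
  congr (_ * _); rewrite /A.
  rewrite [RHS](@Rintegral_image _ _ _ sigma _ _ (act om) sigma)//.
  - by apply: eq_Rintegral => z _; rewrite ip_act.
  - by move=> B mB; rewrite sigma_act.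
  - apply: bdfunM => //; exact: bdfun_comp brho _.
under eq_fun do rewrite E.
have [_ [N rhoN]] := brho.
apply: (@bdfun_dominated_cvg0 _ _ _ _ _ (N * fine (sigma setT))).
- move=> k; apply: measurable_funM; first by apply: measurableT_comp => //; exact: macto.
  exact: (bdfun_Rintegral sigma (bA2 k)).1.
- move=> k om; rewrite normrM -[leRHS]mul1r ler_pM//.
  apply: Rintegral_norm_le; first exact: bdfun_section1 (bA2 k) om.
  by move=> z; rewrite normrM -[leRHS]mul1r ler_pM.
- move=> om; apply/cvgr0Pnorm_le => e e0.
  have : A k om @[k --> \oo] --> 0.
    apply: u_weak; apply: bdfun_comp brho _; apply: mipo => //; exact: measurable_cst.
  move=> /cvgr0Pnorm_le/(_ _ e0); apply: filterS => k Ae.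
  by rewrite normrM -[leRHS]mul1r ler_pM.
Qed.

Let Q k := \int[tau]_s \int[tau]_s' C k (w s) (w s').

(** [Q k] is the integral of [c k] against [Lam], which is absolutely continuous with respect to the
    law of [ip x0 z]. Replacing [Lam] by a bounded density costs at most e/2; [K + 1] is used
    because [K] may vanish. *)
Let Q_cvg0 : Q k @[k --> \oo] --> 0.
Proof.
have QE k : Q k = \int[Lam]_r c k r.
  have <- := LamE (bc k).
  rewrite /Q; apply: eq_Rintegral => s _; apply: eq_Rintegral => s' _.
  exact: CE.
under eq_fun do rewrite QE.
have mipx : measurable_fun setT (ip x0) by apply: mipo => //; exact: measurable_cst.
have [M ME] := image_measure_ex sigma mipx.
have K0 : 0 <= K by exact: fine_ge0.
apply/cvgr0Pnorm_le => e e0.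
have e'0 : 0 < e / 2 / (K + 1) by rewrite !divr_gt0// ltr_wpDl.
have [|rho brho rhoP] := @bounded_density _ _ _ Lam M _ e'0.
  by move=> A mA; rewrite ME => /Lam_ac ->.
have e20 : 0 < e / 2 by rewrite divr_gt0.
have := kernel_cvg0 brho.
move=> /cvgr0Pnorm_le/(_ _ e20); apply: filterS => k ke.
have := rhoP (c k) K (bc k) (c_le k).
rewrite (@Rintegral_image _ _ _ sigma _ _ (ip x0) M)//; last exact: bdfunM.
have : K * (e / 2 / (K + 1)) <= e / 2.
  rewrite mulrCA ler_piMr ?(ltW e20)// ler_pdivrMr ?mul1r ?lerDl//.
  by rewrite ltr_wpDl.
move: ke; set a := (\int[sigma]_x _); set b := (\int[Lam]_r _) => a1 a2 a3.
rewrite (_ : b = (b - a) + a); last by rewrite subrK.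
apply: (le_trans (ler_normD _ _)).
  by rewrite [leRHS](splitr e) lerD// (le_trans a3).
by move=> B _; exact: ME.
Qed.

(* The circle [w] stays at constant inner product with [y0], so the average
   does not change when [x0] becomes [w s]. Averaging over [s] and applying the
   Cauchy-Schwarz inequality bounds its square by a multiple of the mean of
   C (ip (w s) (w s')), where C (ip x z) is the average of u (g x) * u (g z).
   As [Lam] has a density with respect to the law of [ip x0 z], that mean is
   an integral of u against an integrable kernel. *)
Lemma bilinear_cvg0 : (\int[P]_om (u k (act om x0) * v k (act om y0))) @[k --> \oo] --> 0.
Proof.
pose W k om := \int[tau]_s u k (act om (w s)).
have bU k : bdfun (fun z : Om * I => u k (act z.1 (w z.2))).
  by apply: bdfun_comp (bu k) _; apply: macto => //; exact: measurableT_comp.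
have bW k : bdfun (W k) by exact: (bdfun_Rintegral tau (bU k)).
have mactx x : measurable_fun setT (act^~ x) by apply: macto => //; exact: measurable_id.
have W2 k : \int[P]_om (W k om * W k om) = Q k.
  transitivity (\int[P]_om \int[tau]_s (u k (act om (w s)) * W k om)).
    apply: eq_Rintegral => om _; rewrite RintegralZr//.
    exact: bdfun_integrable (bdfun_section1 (bU k) om).
  rewrite (@bdfun_Fubini _ _ _ _ _ P tau (fun z : Om * I => u k (act z.1 (w z.2)) * W k z.1)); last first.
    by apply: bdfunM => //; exact: bdfun_comp (bW k) _.
  apply: eq_Rintegral => s _ /=.
  transitivity (\int[P]_om \int[tau]_s' (u k (act om (w s)) * u k (act om (w s')))).
    apply: eq_Rintegral => om _; rewrite RintegralZl//.
    exact: bdfun_integrable (bdfun_section1 (bU k) om).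
  rewrite (@bdfun_Fubini _ _ _ _ _ P tau
    (fun z : Om * I => u k (act z.1 (w s)) * u k (act z.1 (w z.2))))//.
  by apply: bpair => //; exact: measurableT_comp.
have DE k : \int[P]_om (u k (act om x0) * v k (act om y0)) =
    \int[P]_om (W k om * v k (act om y0)).
  transitivity (\int[tau]_s \int[P]_om (u k (act om (w s)) * v k (act om y0))).
    rewrite -[LHS]mulr1 -[1]/(fine 1%E) -tau1 -Rintegral_cst//.
    by apply: eq_Rintegral => s _; apply: P_pair.
  rewrite -(@bdfun_Fubini _ _ _ _ _ P tau
    (fun z : Om * I => u k (act z.1 (w z.2)) * v k (act z.1 y0))); last first.
    by apply: bdfunM => //; apply: bdfun_comp (bv k) _; exact: macto.
  apply: eq_Rintegral => om _ /=; rewrite RintegralZr//.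
  exact: bdfun_integrable (bdfun_section1 (bU k) om).
under eq_fun do rewrite DE.
have K0 : 0 <= K by exact: fine_ge0.
have K1 : 0 < K + 1 by rewrite ltr_wpDl.
apply/cvgr0Pnorm_le => e e0.
(* The Cauchy-Schwarz inequality is used in the form |W| <= d/2 + W^2/(2d). With this [d] the first
   term integrates to at most e/2, and so does the second once |Q k| <= d e. *)
have [d d0 dK] : exists2 d, 0 < d & d * (K + 1) = e.
  by exists (e / (K + 1)); [rewrite divr_gt0|rewrite divfK// gt_eqF].
have de0 : 0 < d * e by rewrite mulr_gt0.
have := Q_cvg0 => /cvgr0Pnorm_le/(_ _ de0); apply: filterS => k Qk.
have bWW : bdfun (fun om => W k om * W k om) by exact: bdfunM.
have bWv : bdfun (fun om => W k om * v k (act om y0)).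
  by apply: bdfunM => //; exact: bdfun_comp (bv k) _.
apply: (le_trans (le_normr_Rintegral _ (bdfun_integrable P bWv))) => //.
apply: (@le_trans _ _ (\int[P]_om (d / 2 + (d * 2)^-1 * (W k om * W k om)))).
  apply: le_Rintegral => //.
  - exact: bdfun_integrable (bdfun_norm bWv).
  - by apply: bdfun_integrable; apply: bdfunD; [exact: bdfun_cst|apply: bdfunM => //; exact: bdfun_cst].
  move=> om _; rewrite normrM.
  apply: (@le_trans _ _ `|W k om|); first by rewrite ler_piMr.
  have -> : W k om * W k om = `|W k om| ^+ 2 by rewrite real_normK ?num_real// expr2.
  set a := `|W k om|.
  have -> : d / 2 + (d * 2)^-1 * a ^+ 2 = (d ^+ 2 + a ^+ 2) / (d * 2).
    by field; exact: lt0r_neq0.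
  rewrite ler_pdivlMr ?mulr_gt0//.
  by rewrite -subr_ge0 (_ : _ - _ = (d - a) ^+ 2) ?sqr_ge0//; ring.
have -> : \int[P]_om (d / 2 + (d * 2)^-1 * (W k om * W k om)) = d / 2 * K + (d * 2)^-1 * Q k.
  transitivity (\int[P]_om (d / 2) + \int[P]_om ((d * 2)^-1 * (W k om * W k om))).
    apply: RintegralD => //; first exact: bdfun_integrable (bdfun_cst _ _).
    by apply: bdfun_integrable; apply: bdfunM => //; exact: bdfun_cst.
  rewrite Rintegral_cst// RintegralZl//; last exact: bdfun_integrable bWW.
  by rewrite W2.
rewrite [leRHS](splitr e) lerD//.
  by rewrite mulrAC ler_pM2r// -dK ler_pM2l// lerDl.
have -> : e / 2 = (d * 2)^-1 * (d * e) by field; exact: lt0r_neq0.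
rewrite ler_wpM2l ?invr_ge0 ?mulr_ge0 ?(ltW d0)//.
exact: le_trans (ler_norm _) Qk.
Qed.

End Compactness.

(** * Weak limits of indicator functions *)

Lemma cvgn_approx (R : realType) (a : nat -> R) :
  (forall e, 0 < e -> exists b : nat -> R, cvgn b /\ forall k, `|a k - b k| <= e) ->
  cvgn a.
Proof.
move=> H; apply/cauchy_cvgP; apply/cauchy_exP => e e0.
have e20 : 0 < e / 2 by rewrite divr_gt0.
have [b [cb ab]] := H _ e20.
exists (limn b).
have /cvgrPdist_lt/(_ _ e20) := cb.
apply: filterS => k bk; rewrite /ball/=.
rewrite (_ : _ - _ = (limn b - b k) - (a k - b k)); last by ring.
by rewrite (le_lt_trans (ler_normB _ _))// (splitr e) ltr_leD.
Qed.

Lemma fmap_ultra (T U : Type) (f : T -> U) (F : set_system T) :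
  UltraFilter F -> UltraFilter (f @ F).
Proof.
move=> uF; split=> [|G pG FG]; first exact: fmap_proper_filter.
apply/seteqP; split=> // A GA.
have [//|FC] := in_ultra_setVsetC (f @^-1` A) uF.
by exfalso; apply: (@filter_not_empty _ G); rewrite -(setICr A); apply: filterI => //; exact: FG.
Qed.

(* A limit along an ultrafilter replaces the extraction of subsequences. *)
Lemma diagonal_subsequence (R : realType) (x : nat -> nat -> R) (M : R) :
  (forall k j, 0 <= x k j <= M) ->
  exists2 phi : nat -> nat, (forall k, (k <= phi k)%N) &
    forall j, cvgn (fun k => x (phi k) j).
Proof.
move=> xM.
have [U [uU ooU]] := @ultraFilterLemma nat \oo _.
have /choice[L HL] : forall j, exists l : R, (x k j) @[k --> U] --> l.
  move=> j; have := @segment_compact R 0 M; rewrite compact_ultra.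
  have UA : ((fun k => x k j) @ U) `[0, M]%classic.
    apply: (@filterS _ U _ setT); last exact: filterT.
    by move=> k _; rewrite /= in_itv; exact: (xM k j).
  by move=> /(_ _ (fmap_ultra _ _) UA)[l [_ Ul]]; exists l.
(* Along the ultrafilter finitely many coordinates are close to their limits at the same time. Each
   such set has an element, and the one chosen for N is [phi N]. *)
have near N : U [set k | (N <= k)%N /\ forall j, (j < N)%N -> `|L j - x k j| <= N.+1%:R^-1].
  have U1 : U [set k | (N <= k)%N] by apply: ooU; exists N.
  suff U2 m : U [set k | forall j, (j < m)%N -> `|L j - x k j| <= N.+1%:R^-1].
    by apply: filterS (filterI U1 (U2 N)) => k [].
  elim: m => [|m IH]; first by apply: filterS (@filterT _ U _).
  have /cvgrPdist_le/(_ N.+1%:R^-1) := HL m.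
  rewrite invr_gt0 ltr0n => /(_ isT) Um.
  apply: filterS (filterI IH Um) => k [h1 /= h2] j; rewrite ltnS leq_eqVlt.
  by move=> /orP[/eqP ->|/h1].
have /choice[phi Hphi] : forall N, exists k, (N <= k)%N /\
    forall j, (j < N)%N -> `|L j - x k j| <= N.+1%:R^-1.
  by move=> N; exact: filter_ex (near N).
exists phi => [k|j]; first exact: (Hphi k).1.
apply/cvg_ex; exists (L j); apply/cvgrPdist_le => e e0.
exists (maxn j.+1 (Num.truncn e^-1).+1) => // N /=; rewrite geq_max => /andP[jN eN].
apply: (le_trans ((Hphi N).2 _ jN)).
rewrite -[leRHS]invrK lef_pV2 ?posrE ?invr_gt0 ?ltr0n//.
apply: ltW; apply: (lt_le_trans (Num.Theory.truncnS_gt _)).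
by rewrite ler_nat; apply: leq_trans eN _.
Qed.

Lemma pos_integral_le0_null d (T : measurableType d) (R : realType)
    (mu : {measure set T -> \bar R}) (h : T -> R) :
  mu.-integrable setT (EFin \o h) ->
  (\int[mu]_(x in [set x | 0 < h x]%R) (h x)%:E <= 0)%E -> mu [set x | 0 < h x]%R = 0%E.
Proof.
move=> inth le0.
have mh : measurable_fun setT h by apply/measurable_EFinP; exact: measurable_int inth.
have mD : measurable [set x | 0 < h x]%R.
  rewrite (_ : [set _ | _] = setT `&` h @^-1` `]0, +oo[%classic).
    by apply: mh => //; exact: measurable_itv.
  by rewrite setTI; apply/seteqP; split=> x /=; rewrite in_itv/= andbT.
have mhD : measurable_fun [set x | 0 < h x]%R (EFin \o h).
  by apply: measurable_funTS; exact: measurable_int inth.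
have /(ae_eq_integral_abs mu mD mhD)[N [mN N0 DN]] :
    (\int[mu]_(x in [set x | 0 < h x]%R) `|(EFin \o h) x| = 0)%E.
  apply/eqP; rewrite eq_le integral_ge0// andbT.
  rewrite (eq_integral (EFin \o h))// => x; rewrite inE/= => hx.
  by rewrite gtr0_norm.
apply: (subset_measure0 mD mN) => // x hx; apply: DN => /= /(_ hx)[] h0.
by move: hx; rewrite /= h0 ltxx.
Qed.

Lemma bdfun_sum d (T : measurableType d) (R : realType) (f : nat -> T -> R) m :
  (forall i, bdfun (f i)) -> bdfun (fun x => \sum_(i < m) f i x).
Proof.
move=> bf; elim: m => [|m IH].
  rewrite (_ : (fun x => _) = fun=> 0); first exact: bdfun_cst.
  by apply/funext => x; rewrite big_ord0.
rewrite (_ : (fun x => _) = fun x => \sum_(i < m) f i x + f m x); first exact: bdfunD.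
by apply/funext => x; rewrite big_ord_recr.
Qed.

(** [h + M] is approximated uniformly within d' by a layered sum: x lies in as many of the sets
    [D i] as d' fits into [h x + M], so d' times the sum of their indicators rounds [h + M] down to
    a multiple of d'. *)
Lemma weak_cvg_indic d (T : measurableType d) (R : realType)
    (mu : {finite_measure set T -> \bar R}) (g : nat -> T -> R) :
  (forall k, measurable_fun setT (g k)) -> (forall k x, `|g k x| <= 1) ->
  (forall D, measurable D -> (\int[mu]_x (g k x * \1_D x)) @[k --> \oo] --> 0) ->
  forall h : T -> R, bdfun h -> (\int[mu]_x (g k x * h x)) @[k --> \oo] --> 0.
Proof.
move=> mg g1 gD h bh; have [mh [M0 M0h]] := bh.
have bg k : bdfun (g k) by split=> //; exists 1.
pose M := `|M0| + 1.
have Mh x : `|h x| < M.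
  by rewrite (le_lt_trans (M0h x))// (le_lt_trans (ler_norm _))// ltrDl.
have M_gt0 : 0 < M by rewrite ltr_wpDl.
apply/cvgr0Pnorm_le => e e0.
pose K := fine (mu setT).
have K0 : 0 <= K by exact: fine_ge0.
have K1 : 0 < K + 1 by rewrite ltr_wpDl.
have [d' d0 dK] : exists2 d', 0 < d' & d' * (K + 1) = e / 2.
  by exists (e / 2 / (K + 1)); [rewrite !divr_gt0|rewrite divfK// gt_eqF].
pose D i := [set x | i.+1%:R * d' <= h x + M].
have mD i : measurable (D i).
  rewrite (_ : D i = setT `&` (fun x => h x + M) @^-1` `[i.+1%:R * d', +oo[%classic).
    by apply: measurable_funD => //; exact: measurable_itv.
  by rewrite setTI; apply/seteqP; split=> x /=; rewrite in_itv/= andbT.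
have cvgS m : (\int[mu]_x (g k x * \sum_(i < m) \1_(D i) x)) @[k --> \oo] --> 0.
  elim: m => [|m IH].
    under eq_fun do under eq_Rintegral do rewrite big_ord0 mulr0.
    by under eq_fun do rewrite Rintegral_cst// mul0r; exact: cvg_cst.
  have bS : bdfun (fun x => \sum_(i < m) \1_(D i) x : R).
    by apply: (@bdfun_sum _ _ _ (fun i => \1_(D i)) m) => i; exact: bdfun_indic.
  rewrite (_ : (fun k => _) = (fun k => \int[mu]_x (g k x * \sum_(i < m) \1_(D i) x) +
      \int[mu]_x (g k x * \1_(D m) x))).
    have H := cvgD IH (gD _ (mD m)); rewrite addr0 in H; exact: H.
  apply/funext => k.
  rewrite -RintegralD//; last 2 first.
  - by apply: bdfun_integrable; exact: bdfunM.
  - by apply: bdfun_integrable; apply: bdfunM => //; exact: bdfun_indic.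
  by apply: eq_Rintegral => x _; rewrite big_ord_recr mulrDr.
pose m := (Num.truncn ((M + M) / d')).+1.
pose s x : R := \sum_(i < m) \1_(D i) x.
have bs : bdfun s by apply: (@bdfun_sum _ _ _ (fun i => \1_(D i)) m) => i; exact: bdfun_indic.
have hs x : `|h x - (d' * s x - M)| <= d'.
  have y0 : 0 <= h x + M by have := Mh x; rewrite ltr_norml => /andP[]; lra.
  pose t := Num.truncn ((h x + M) / d').
  have y0' : 0 <= (h x + M) / d' by rewrite divr_ge0// ltW.
  have tm : (t <= m)%N.
    apply: leqW; apply: Num.Theory.le_truncn; rewrite ler_pM2r ?invr_gt0// lerD2r.
    by rewrite ltW// (le_lt_trans (ler_norm _)).
  have -> : s x = t%:R.
    rewrite /s (eq_bigr (fun i : 'I_m => (i < t)%:R)).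
      elim: {s bs} m tm => [|p IH]; first by rewrite leqn0 => /eqP ->; rewrite big_ord0.
      rewrite big_ord_recr/= leq_eqVlt => /orP[/eqP te|tp].
        rewrite te ltnSn (eq_bigr (fun=> 1)); last first.
          by move=> i _; rewrite ltnS ltnW.
        by rewrite sumr_const card_ord -natrD addn1.
      by rewrite IH// ltnNge -ltnS tp addr0.
    move=> i _; rewrite indicE; congr (_%:R).
    rewrite /t Num.Theory.truncn_ge_nat// ler_pdivlMr//.
    by congr nat_of_bool; apply/idP/idP; rewrite inE.
  have /andP[t1 t2] := Num.Theory.truncn_itv y0'.
  move: t1 t2; rewrite -/t ler_pdivlMr// ltr_pdivrMr// -natr1 mulrDl mul1r.
  by rewrite ler_norml; set z := t%:R * d'; move=> t1 t2; rewrite -/z [d' * _]mulrC -/z; lra.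
have c1 : (d' * \int[mu]_x (g k x * s x) - M * \int[mu]_x (g k x * \1_setT x)) @[k --> \oo] --> 0.
  have H := cvgB (cvgMl_tmp (a := d') (cvgS m)) (cvgMl_tmp (a := M) (gD _ measurableT)).
  rewrite !mulr0 subrr in H; exact: H.
have e20 : 0 < e / 2 by rewrite divr_gt0.
have /cvgr0Pnorm_le/(_ _ e20) := c1; apply: filterS => k.
set q := (X in `|X| <= _) => qe.
have bgs : bdfun (fun x => g k x * s x) by exact: bdfunM.
have bg1 : bdfun (fun x => g k x * \1_setT x) by apply: bdfunM => //; exact: bdfun_indic.
have b2 : bdfun (fun x => g k x * (d' * s x - M)).
  by apply: bdfunM => //; apply: bdfunB; [apply: bdfunM => //; exact: bdfun_cst|exact: bdfun_cst].
have qE : q = \int[mu]_x (g k x * (d' * s x - M)).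
  rewrite /q -!RintegralZl//; [|exact: bdfun_integrable..].
  rewrite -RintegralB//; [|by apply: bdfun_integrable; apply: bdfunM => //; exact: bdfun_cst..].
  by apply: eq_Rintegral => x _; rewrite indicT /=; ring.
have bgh : bdfun (fun x => g k x * h x) by exact: bdfunM.
rewrite (_ : \int[mu]_x (g k x * h x) = \int[mu]_x (g k x * (h x - (d' * s x - M))) + q); last first.
  rewrite qE -RintegralD//; [|apply: bdfun_integrable; apply: bdfunM => //|exact: bdfun_integrable].
    by apply: eq_Rintegral => x _; ring.
  by apply: bdfunB => //; apply: bdfunB; [apply: bdfunM => //; exact: bdfun_cst|exact: bdfun_cst].
rewrite (le_trans (ler_normD _ _))// [leRHS](splitr e) lerD//.
apply: (@le_trans _ _ (d' * K)); last by rewrite -dK ler_pM2l// lerDl.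
apply: Rintegral_norm_le.
  apply: bdfunM => //; apply: bdfunB => //.
  by apply: bdfunB; [apply: bdfunM => //; exact: bdfun_cst|exact: bdfun_cst].
by move=> x; rewrite normrM -[leRHS]mul1r ler_pM.
Qed.

Section FineMeasure.
Context d (T : measurableType d) (R : realType) (mu : {finite_measure set T -> \bar R}).

Lemma fine_measureU (B C : set T) : measurable B -> measurable C -> B `&` C = set0 ->
  fine (mu (B `|` C)) = fine (mu B) + fine (mu C).
Proof. by move=> mB mC BC; rewrite measureU// fineD// fin_num_measure. Qed.

Lemma Rintegral_indic (B : set T) : measurable B -> \int[mu]_x (\1_B x : R) = fine (mu B).
Proof. by move=> mB; rewrite /Rintegral integral_indic// setIT. Qed.

End FineMeasure.

Section WeakLimit.
Context (R : realType) d (V : measurableType d).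
Variables (sigma : {finite_measure set V -> \bar R}) (Gen : nat -> set V).
Hypothesis genE : d.-measurable = <<s range Gen >>.
Hypothesis genI : setI_closed (range Gen).
Variable A : nat -> set V.
Hypothesis mA : forall k, measurable (A k).

Let a k D : R := fine (sigma (A k `&` D)).
Let b D : R := fine (sigma D).

Let a_le k D : measurable D -> 0 <= a k D <= b D.
Proof.
move=> mD; have mAD := measurableI _ _ (mA k) mD.
by rewrite fine_ge0//= fine_le ?fin_num_measure// measureIr.
Qed.

Let aU k D E : measurable D -> measurable E -> D `&` E = set0 ->
  a k (D `|` E) = a k D + a k E.
Proof.
move=> mD mE DE; rewrite /a setIUr fine_measureU//; [exact: measurableI|exact: measurableI|].
by rewrite setIACA DE setI0.
Qed.

Let aC k D : measurable D -> a k (~` D) = a k setT - a k D.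
Proof.
move=> mD; apply/eqP; rewrite eq_sym subr_eq addrC -aU ?setUv ?setICr//.
exact: measurableC.
Qed.

Let b_ge0 D : 0 <= b D. Proof. exact: fine_ge0. Qed.

Let tail (F : nat -> set V) N := \bigcup_(i in [set i | (N <= i)%N]) F i.

Let mtail (F : nat -> set V) N : (forall i, measurable (F i)) -> measurable (tail F N).
Proof. by move=> mF; exact: bigcup_measurable. Qed.

Let bigcup_tail (F : nat -> set V) N : trivIset setT F ->
  \bigcup_i F i = (\big[setU/set0]_(i < N) F i) `|` tail F N /\
  (\big[setU/set0]_(i < N) F i) `&` tail F N = set0.
Proof.
move=> tF; rewrite -bigcup_mkord; split.
  apply/seteqP; split=> [x [i _ Fx]|x [[i _ Fx]|[i _ Fx]]]; last 2 first.
  - by exists i.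
  - by exists i.
  by case: (ltnP i N) => iN; [left|right]; exists i.
apply/seteqP; split=> // x [[i /= iN Fi] [j /= Nj Fj]].
have ij : i = j by apply: tF => //; exists x.
by move: iN; rewrite ij ltnNge Nj.
Qed.

Let tail_cvg0 (F : nat -> set V) : (forall i, measurable (F i)) -> trivIset setT F ->
  b (tail F N) @[N --> \oo] --> 0.
Proof.
move=> mF tF.
have h : (sigma \o tail F) N @[N --> \oo] --> sigma (\bigcap_N tail F N).
  apply: nonincreasing_cvg_mu.
  - by rewrite ltey_eq fin_num_measure//; exact: mtail.
  - by move=> N; exact: mtail.
  - by apply: bigcapT_measurable => N; exact: mtail.
  - move=> m N mN; apply/subsetPset => x [i /= Ni Fx]; exists i => //=.
    exact: leq_trans mN Ni.
have t0 : \bigcap_N tail F N = set0.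
  apply/seteqP; split=> // x H; have [i _ Fi] := H 0%N I.
  have [j /= ij Fj] := H i.+1 I.
  have e : i = j by apply: tF => //; exists x.
  by move: ij; rewrite e ltnn.
by move: h; rewrite t0 measure0 => /fine_cvg.
Qed.

Let a_bigsetU k (F : nat -> set V) N : (forall i, measurable (F i)) -> trivIset setT F ->
  a k (\big[setU/set0]_(i < N) F i) = \sum_(i < N) a k (F i).
Proof.
move=> mF tF; elim: N => [|N IH]; first by rewrite !big_ord0 /a setI0 measure0.
rewrite !big_ord_recr/= aU ?IH//; first exact: bigsetU_measurable.
rewrite -bigcup_mkord; apply/seteqP; split=> // x [[i /= iN Fi] FN].
have e : i = N by apply: tF => //; exists x.
by move: iN; rewrite e ltnn.
Qed.

(** Convergence of the masses of [A (phi k)] is arranged on a countable pi-system and spreads to all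
    measurable sets by Dynkin induction. For disjoint unions the tails are bounded by their
    [sigma]-measure, uniformly in k; the same bound makes the limit countably additive and
    absolutely continuous, and f is its density. *)
Lemma weak_limit : exists phi : nat -> nat, exists f : V -> R,
  [/\ (forall k, (k <= phi k)%N), bdfun f, (forall x, 0 <= f x <= 1) &
   forall h : V -> R, bdfun h ->
     (\int[sigma]_x ((\1_(A (phi k)) x - f x) * h x)) @[k --> \oo] --> 0].
Proof.
have mG j : measurable (Gen j) by rewrite genE; apply: sub_gen_smallest; exists j.
(* Index 0 stands for the whole space, which is needed to pass to complements; index j+1 stands for
   [Gen j]. *)
have [|phi phik phiP] := @diagonal_subsequence R
    (fun k j => if j is j'.+1 then a k (Gen j') else a k setT) (b setT).
  move=> k [|j]; first exact: a_le.
  have /andP[h0 h1] := a_le k (mG j).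
  apply/andP; split; [exact: h0|apply: (le_trans h1)].
  by rewrite fine_le ?fin_num_measure// le_measure// inE.
have cvgT : cvgn (fun k => a (phi k) setT) := phiP 0%N.
have cvgA D : measurable D -> cvgn (fun k => a (phi k) D).
  rewrite {1}genE; apply: (@dynkin_induction _ V (range Gen) (fun D => cvgn (fun k => a (phi k) D)) genE genI) => //.
  - by move=> _ [j _ <-]; exact: (phiP j.+1).
  - move=> S mS cS; rewrite (_ : (fun k => _) = fun k => a (phi k) setT - a (phi k) S).
      exact: is_cvgB.
    by apply/funext => k; rewrite aC.
  - move=> F mF tF cF; apply: cvgn_approx => e e0.
    have /cvgrPdist_le/(_ _ e0)[N _ /(_ N (leqnn N))] := tail_cvg0 mF tF.
    rewrite /= sub0r normrN ger0_norm// => tN.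
    exists (fun k => \sum_(i < N) a (phi k) (F i)); split.
      apply/cvg_ex; exists (\sum_(i < N) limn (fun k => a (phi k) (F i))).
      by apply: cvg_big => [|i _]; [exact: add_continuous|exact: cF].
    move=> k.
    have [-> dis] := bigcup_tail N tF.
    have mt := mtail N mF.
    have mb : measurable (\big[setU/set0]_(i < N) F i) by exact: bigsetU_measurable.
    rewrite aU// a_bigsetU//.
    rewrite addrC addKr; have /andP[h1 h2] := a_le (phi k) mt.
    by rewrite ger0_norm// (le_trans h2).
pose L D := limn (fun k => a (phi k) D).
have L_le D : measurable D -> 0 <= L D <= b D.
  move=> mD; apply/andP; split; [apply: limr_ge|apply: limr_le]; do ?exact: cvgA;
    by apply: nearW => k; have /andP[] := a_le (phi k) mD.
have LU D E : measurable D -> measurable E -> D `&` E = set0 -> L (D `|` E) = L D + L E.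
  move=> mD mE DE; apply/cvg_lim => //.
  rewrite (_ : (fun k => _) = fun k => a (phi k) D + a (phi k) E).
    by apply: cvgD; exact: cvgA.
  by apply/funext => k; rewrite aU.
have LS (F : nat -> set V) N : (forall i, measurable (F i)) -> trivIset setT F ->
    L (\big[setU/set0]_(i < N) F i) = \sum_(i < N) L (F i).
  move=> mF tF; apply/cvg_lim => //.
  rewrite (_ : (fun k => _) = fun k => \sum_(i < N) a (phi k) (F i)).
    by apply: cvg_big => [|i _]; [exact: add_continuous|exact: cvgA].
  by apply/funext => k; rewrite a_bigsetU.
(* A measure must be nonnegative on every set, whereas [limn] is controlled only on measurable ones;
   hence the absolute value. *)
pose nuf D : \bar R := `|L D|%:E.
have nufE D : measurable D -> nuf D = (L D)%:E.
  by move=> mD; rewrite /nuf ger0_norm//; have /andP[] := L_le _ mD.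
have nuf0 : nuf set0 = 0%E.
  rewrite nufE//; congr EFin; apply/le_anti.
  by have := L_le _ measurable0; rewrite /b measure0 andbC.
have nuf_ge0 D : (0 <= nuf D)%E by rewrite lee_fin.
have nuf_sa : semi_sigma_additive nuf.
  move=> F mF tF mUF; rewrite nufE//.
  rewrite (_ : (fun N => _) = fun N => (\sum_(i < N) L (F i))%:E); last first.
    by apply/funext => N; rewrite big_mkord -sumEFin; apply: eq_bigr => i _; rewrite nufE.
  apply/fine_cvgP; split; first exact: nearW.
  rewrite (_ : _ \o _ = fun N => L (\bigcup_i F i) - L (tail F N)); last first.
    apply/funext => N /=; have [-> dis] := bigcup_tail N tF.
    by rewrite LU ?LS ?addrK//; [exact: bigsetU_measurable|exact: mtail].
  rewrite -[X in _ --> X]subr0; apply: cvgB; first exact: cvg_cst.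
  apply: (@squeeze_cvgr _ _ _ _ (fun=> 0) (fun N => b (tail F N))).
  - by apply: nearW => N; exact: L_le (mtail N mF).
  - exact: cvg_cst.
  - exact: tail_cvg0.
have nuf_fin : fin_num_fun nuf by move=> D mD.
pose mm := isMeasure.Build _ _ _ nuf nuf0 nuf_ge0 nuf_sa.
pose nu0 : {measure set V -> \bar R} := HB.pack nuf mm.
pose mf := Measure_isFinite.Build _ _ _ nu0 nuf_fin.
pose nu : {finite_measure set V -> \bar R} := HB.pack nuf mm mf.
have numu : nu `<< sigma.
  apply/null_content_dominatesP => D mD D0; rewrite [LHS]nufE//; congr EFin; apply/le_anti.
  by have := L_le _ mD; rewrite /b D0 andbC.
pose g := Radon_Nikodym (charge_of_finite_measure nu) sigma.
pose r x := fine (g x).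
have gr x : g x = (r x)%:E by rewrite fineK// Radon_Nikodym_fin_num.
have intr : sigma.-integrable setT (EFin \o r).
  rewrite (_ : _ \o _ = g); first exact: Radon_Nikodym_integrable.
  by apply/funext => x /=; rewrite gr.
have mr : measurable_fun setT r by apply/measurable_EFinP; exact: measurable_int intr.
have rE D : measurable D -> (\int[sigma]_(x in D) (r x)%:E)%E = (L D)%:E.
  move=> mD; rewrite -nufE//; have := @Radon_Nikodym_integral _ _ _ (charge_of_finite_measure nu) sigma D numu mD.
  by move=> /= ->; apply: eq_integral => x _; rewrite -gr.
have intS D (h : V -> R) : measurable D -> sigma.-integrable setT (EFin \o h) -> sigma.-integrable D (EFin \o h).
  by move=> mD; exact: integrableS.
have int1 : sigma.-integrable setT (EFin \o (fun=> 1 : R)).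
  exact: bdfun_integrable (bdfun_cst _ 1).
have mpos (h : V -> R) : measurable_fun setT h -> measurable [set x | 0 < h x].
  move=> mh; rewrite (_ : [set _ | _] = setT `&` h @^-1` `]0, +oo[%classic).
    by apply: mh => //; exact: measurable_itv.
  by rewrite setTI; apply/seteqP; split=> x /=; rewrite in_itv/= andbT.
have N1 : sigma [set x | 0 < r x - 1] = 0%E.
  apply: pos_integral_le0_null.
    by rewrite (_ : _ \o _ = (EFin \o r) \- (EFin \o (fun=> 1%R)))%E//; exact: integrableB.
  set D := [set x | _].
  have mD : measurable D by apply: mpos; exact: measurable_funB.
  under eq_integral do rewrite EFinB.
  rewrite (integralB mD (intS _ _ mD intr) (intS _ _ mD int1)) rE// integral_cst// mul1e.
  have /andP[_] := L_le _ mD; rewrite -lee_fin /b fineK ?fin_num_measure// => h.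
  by rewrite leeBlDr ?fin_num_measure// add0e.
have N0 : sigma [set x | 0 < - r x] = 0%E.
  apply: pos_integral_le0_null.
    by rewrite (_ : _ \o _ = \- (EFin \o r))%E//; exact: integrableN.
  set D := [set x | _].
  have mD : measurable D by apply: mpos; exact: measurableT_comp.
  have int0 : sigma.-integrable setT (EFin \o (fun=> 0 : R)).
    exact: bdfun_integrable (bdfun_cst _ 0).
  under eq_integral do rewrite -sub0r EFinB.
  rewrite (integralB mD (intS _ _ mD int0) (intS _ _ mD intr)) rE// integral0 sub0e.
  by rewrite leeNl oppe0 lee_fin; have /andP[] := L_le _ mD.
(* The density lies in [0, 1] outside the two null sets just found. Clipping it gives the bounds at
   every point. *)
pose f x := Num.max 0 (Num.min 1 (r x)).
have f01 x : 0 <= f x <= 1.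
  by rewrite /f le_max lexx/= ge_max ler01/= ge_min lexx.
have bf : bdfun f.
  split; last by exists 1 => x; have /andP[h0 h1] := f01 x; rewrite ger0_norm.
  apply: measurable_maxr; first exact: measurable_cst.
  by apply: measurable_minr => //; exact: measurable_cst.
exists phi, f; split=> //.
have mA1 k : bdfun (fun x => \1_(A k) x - f x) by apply: bdfunB => //; exact: bdfun_indic.
apply: weak_cvg_indic.
- by move=> k; exact: (mA1 _).1.
- move=> k x; have /andP[h0 h1] := f01 x; rewrite indicE ler_norml.
  by case: (x \in _) => /=; lra.
move=> D mD.
have fD : \int[sigma]_x (f x * \1_D x) = L D.
  rewrite -[RHS]/(fine (L D)%:E) -rE// /Rintegral; congr fine.
  rewrite [RHS]integral_mkcond.
  rewrite (_ : _ \_ _ = EFin \o (fun x => r x * \1_D x)); last first.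
    by apply/funext => x; rewrite patchE /= indicE; case: (x \in D) => /=; rewrite ?mulr1 ?mulr0.
  have mN : measurable ([set x | 0 < r x - 1] `|` [set x | 0 < - r x]).
    by apply: measurableU; apply: mpos; [exact: measurable_funB|exact: measurableT_comp].
  apply: ae_eq_integral => //.
  - by apply/measurable_EFinP; apply: measurable_funM => //; exact: bf.1.
  - by apply/measurable_EFinP; apply: measurable_funM => //; exact: measurable_indic.
  exists ([set x | 0 < r x - 1] `|` [set x | 0 < - r x]); split=> //.
    have m1 : measurable [set x | 0 < r x - 1] by apply: mpos; exact: measurable_funB.
    have m0 : measurable [set x | 0 < - r x] by apply: mpos; exact: measurableT_comp.
    apply/eqP; rewrite eq_le measure_ge0 andbT.
    apply: (le_trans (measureU2 sigma m1 m0)).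
    rewrite [leLHS](_ : _ = 0 + 0)%E ?adde0//.
    transitivity (0 + 0 : \bar R)%E; last exact: adde0.
    exact: (f_equal2 (fun x y : \bar R => (x + y)%E) N1 N0).
  move=> x /= H; apply: contrapT => /not_orP[/negP]; rewrite -leNgt => h1 /negP.
  rewrite -leNgt => h0; apply: H => _; congr (_ * _)%:E.
  by rewrite /f min_r ?max_r; lra.
rewrite (_ : (fun k => _) = fun k => a (phi k) D - L D).
  by rewrite -(subrr (L D)); apply: cvgB; [exact: cvgA|exact: cvg_cst].
apply/funext => k; rewrite -fD.
have -> : a (phi k) D = \int[sigma]_x (\1_(A (phi k) `&` D) x).
  by rewrite /Rintegral integral_indic ?setIT//; exact: measurableI.
rewrite -RintegralB//.
- by apply: eq_Rintegral => x _; rewrite indicI/= mulrBl.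
- by apply: bdfun_integrable; apply: bdfun_indic; exact: measurableI.
- by apply: bdfun_integrable; apply: bdfunM => //; exact: bdfun_indic.
Qed.

End WeakLimit.

(** * Surface measure and reflections *)

Section Reflections.
Variables (R : realType) (n : nat).
Implicit Types a x y : 'rV[R]_n.

(** The reflection in the hyperplane orthogonal to [a]. For [a = 0] the convention that 0 has
    inverse 0 makes it the identity, so the lemmas below have no nonvanishing condition. *)
Definition refl a x : 'rV[R]_n := x - (2 * inner a x / inner a a) *: a.

Lemma reflD a x y : refl a (x + y) = refl a x + refl a y.
Proof. by rewrite /refl innerDr; apply/rowP => i; rewrite !mxE; ring. Qed.

Lemma reflZ a (t : R) x : refl a (t *: x) = t *: refl a x.
Proof. by rewrite /refl innerZr; apply/rowP => i; rewrite !mxE; ring. Qed.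

Lemma inner_refl a x y : inner (refl a x) (refl a y) = inner x y.
Proof.
rewrite /refl innerDl !innerDr !innerNl !innerNr !innerZl !innerZr.
have [a0|a0] := eqVneq (inner a a) 0; first by rewrite a0 invr0; ring.
by rewrite (innerC x a); field.
Qed.

Lemma reflK a x : refl a (refl a x) = x.
Proof.
rewrite {1}/refl {2}/refl innerDr innerNr innerZr.
have [a0|a0] := eqVneq (inner a a) 0.
  by rewrite /refl a0 invr0 !mulr0 !scale0r !subr0.
by rewrite /refl; apply/rowP => i; rewrite !mxE; field.
Qed.

Lemma refl_orth a x : inner a x = 0 -> refl a x = x.
Proof. by move=> ax; rewrite /refl ax mulr0 mul0r scale0r subr0. Qed.

Lemma refl_swap x y : inner x x = inner y y -> refl (x - y) x = y.
Proof.
move=> xy; have [/eqP|xy0] := eqVneq (inner (x - y) (x - y)) 0.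
  by rewrite inner_eq0 subr_eq0 => /eqP ->; rewrite /refl subrr scaler0 subr0.
have e : 2 * inner (x - y) x = inner (x - y) (x - y).
  by rewrite !innerDr !innerDl !innerNl !innerNr ?innerNl (innerC y x) xy; ring.
by rewrite /refl e divff// scale1r opprB addrC subrK.
Qed.

(** The first reflection carries x to x' and y to some z. Then z and y' have the same norm and the
    same inner product with x', so the reflection exchanging z and y' fixes x'. *)
Lemma refl_pair x y x' y' : inner x x = inner x' x' -> inner y y = inner y' y' ->
  inner x y = inner x' y' ->
  exists a b, refl b (refl a x) = x' /\ refl b (refl a y) = y'.
Proof.
move=> xx yy xy.
pose a := x - x'; pose z := refl a y.
have ax : refl a x = x' by exact: refl_swap.
exists a, (z - y'); rewrite ax -/z; split; last first.
  by apply: refl_swap; rewrite inner_refl.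
apply: refl_orth; rewrite innerDl innerNl -{1}ax inner_refl innerC xy innerC.
by rewrite (innerC y') subrr.
Qed.

End Reflections.

Section SphereMeasure.
Variables (R : realType) (n : nat).
Local Notation V := (eucl R n).
Local Notation Rn := 'rV[R]_n.+1.

Lemma measurable_scale d (T : measurableType d) (f : T -> R) (g : T -> V) :
  measurable_fun setT f -> measurable_fun setT g ->
  measurable_fun setT ((fun t => f t *: (g t : Rn)) : T -> V).
Proof.
move=> mf mg; apply: measurable_eucl => i; under eq_fun do rewrite mxE.
apply: measurable_funM => //; exact: (measurableT_comp (@measurable_coord R n i)).
Qed.

Lemma measurable_euclN d (T : measurableType d) (g : T -> V) :
  measurable_fun setT g -> measurable_fun setT ((fun t => - (g t : Rn)) : T -> V).
Proof.
move=> mg; under eq_fun do rewrite -scaleN1r.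
by apply: measurable_scale => //; exact: measurable_cst.
Qed.

Lemma measurable_invr d (T : measurableType d) (f : T -> R) :
  measurable_fun setT f -> measurable_fun setT (fun t => (f t)^-1).
Proof.
move=> mf; apply: (measurableT_comp _ mf).
pose A : set R := [set x | x != 0].
have oA : open A by exact: open_neq.
have mA : measurable A by exact: open_measurable.
have -> : [set: R] = A `|` ~` A by rewrite setUv.
apply/measurable_funU => //; first exact: measurableC.
split.
  apply: open_continuous_measurable_fun => //.
  by move=> x; rewrite inE => /= x0; exact: inv_continuous.
refine (eq_measurable_fun (fun=> 0 : R) _ (measurable_cst _)).
by move=> x; rewrite inE /A /= => /negP; rewrite negbK => /eqP ->; rewrite invr0.
Qed.

Lemma measurable_refl a : measurable_fun setT (refl a : V -> V).
Proof.
apply: measurable_pair_eucl_add; first exact: measurable_id.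
apply: measurable_euclN; apply: measurable_scale; last exact: measurable_cst.
apply: measurable_funM; last exact: measurable_cst.
apply: measurable_funM; first exact: measurable_cst.
by apply: measurable_inner; [exact: measurable_cst|exact: measurable_id].
Qed.

(** Radial projection to the sphere, with [dir 0 = 0]. *)
Definition dir (x : Rn) : Rn := (Num.sqrt (inner x x))^-1 *: x.

Lemma measurable_dir : measurable_fun setT (dir : V -> V).
Proof.
apply: measurable_scale; last exact: measurable_id.
have msqrt : measurable_fun setT (Num.sqrt : R -> R).
  by apply: continuous_measurable_fun; exact: sqrt_continuous.
have mxx : measurable_fun setT (fun x : V => inner x x).
  by apply: measurable_inner; exact: measurable_id.
by apply: measurable_invr; exact: (measurableT_comp msqrt mxx).
Qed.

Lemma inner_dir x : x != 0 -> inner (dir x) (dir x) = 1.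
Proof.
move=> x0; have xx : 0 < inner x x by rewrite lt_def inner_ge0 inner_eq0 x0.
rewrite /dir innerZl innerZr mulrA -invfM -expr2 sqr_sqrtr ?inner_ge0//.
by rewrite mulVf// gt_eqF.
Qed.

Lemma dir_id x : inner x x = 1 -> dir x = x.
Proof. by move=> x1; rewrite /dir x1 sqrtr1 invr1 scale1r. Qed.

Lemma dirZ t x : 0 < t -> dir (t *: x) = dir x.
Proof.
move=> t0; rewrite /dir innerZl innerZr mulrA -expr2 sqrtrM ?sqr_ge0//.
rewrite sqrtr_sqr gtr0_norm// scalerA invfM; congr (_ *: _).
by rewrite mulrAC mulVf ?mul1r// gt_eqF.
Qed.

Lemma dir_isom (T : Rn -> Rn) x : (forall t y, T (t *: y) = t *: T y) ->
  (forall y, inner (T y) (T y) = inner y y) -> dir (T x) = T (dir x).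
Proof. by move=> TZ Tn; rewrite /dir Tn TZ. Qed.

(** The punctured open unit ball is the sector of the whole sphere; the puncture removes the one
    point that [dir] does not send to the sphere. *)
Definition pball : set V := [set x | 0 < inner x x < 1].

Lemma measurable_pball : measurable pball.
Proof.
rewrite (_ : pball = setT `&` (fun x : V => inner x x) @^-1` `]0, 1[%classic).
  apply: measurable_inner => //; exact: measurable_itv.
by rewrite setTI; apply/seteqP; split=> x /=; rewrite in_itv.
Qed.

Lemma pball_dir x : pball x -> inner (dir x) (dir x) = 1.
Proof. by move=> /andP[x0 _]; apply: inner_dir; rewrite -inner_eq0 gt_eqF. Qed.

Lemma leb_pball_lty : (leb pball < +oo)%E.
Proof.
apply: le_lt_trans (leb_open_ball_lty n 1).
apply: le_measure; rewrite ?inE; [exact: measurable_pball|exact: measurable_open_ball|].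
by move=> x /andP[].
Qed.

Lemma leb_set1 (x : V) : leb [set x] = 0%E.
Proof.
apply/eqP; rewrite eq_le leb_ge0 andbT; apply/lee_addgt0Pr => e e0; rewrite add0e.
pose d := Num.min 1 e.
have d0 : 0 < d by rewrite lt_min ltr01.
have sub : [set x] `<=` box ((x : Rn) - const_mx d) x.
  by move=> y -> i; rewrite !mxE lexx andbT ltrBlDr ltrDl.
apply: (@le_trans _ _ (leb (box ((x : Rn) - const_mx d) x))).
  exact: (le_outer_measure (@lebesgue_outer R n.+1)).
rewrite leb_box => [|i]; last by rewrite !mxE lerBlDr lerDl ltW.
rewrite lee_fin /box_vol (eq_bigr (fun=> d)).
  rewrite prodr_const card_ord exprS; apply: (@le_trans _ _ d).
    by rewrite ler_piMr ?(ltW d0)// exprn_ile1 ?(ltW d0)// ge_min lexx.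
  by rewrite ge_min lexx orbT.
by move=> i _; rewrite !mxE; ring.
Qed.

(** Surface measure without normalisation and without the dimension factor, as a finite Borel
    measure on the ambient space that is concentrated on the sphere. *)
Lemma cone_measure_ex : exists sigma : {finite_measure set V -> \bar R},
  forall A, sigma A = leb ((dir : V -> V) @^-1` A `&` pball).
Proof.
have [sigma sE] := image_measure_ex (mfrestr measurable_pball leb_pball_lty) measurable_dir.
by exists sigma => A; rewrite sE.
Qed.

Lemma sectorE (E : set Rn) : E `<=` @unit_sphere R n.+1 ->
  sector E = (dir : V -> V) @^-1` E `&` pball.
Proof.
move=> ES; apply/seteqP; split=> [_ [t /= t01 [x Ex <-]]|p [/= Ep /andP[p0 p1]]].
  move: t01; rewrite in_itv/= => /andP[t0 t1].
  have x1 : inner x x = 1 := ES _ Ex.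
  split; first by rewrite /= dirZ// dir_id.
  rewrite /pball/= innerZl innerZr x1 mulr1 -expr2 exprn_gt0//=.
  by rewrite exprn_ilt1// ltW.
have s0 : 0 < Num.sqrt (inner p p) by rewrite sqrtr_gt0.
exists (Num.sqrt (inner p p)).
  rewrite /= in_itv/= s0/=.
  by rewrite -(ltr_pXn2r (n := 2))// ?nnegrE ?ltW// sqr_sqrtr ?inner_ge0// expr1n.
by exists (dir p) => //; rewrite /dir scalerA divff ?scale1r// gt_eqF.
Qed.

Variable sigma : {finite_measure set V -> \bar R}.
Hypothesis sigmaE : forall A, sigma A = leb ((dir : V -> V) @^-1` A `&` pball).

Lemma measurable_sphere : measurable (@unit_sphere R n.+1 : set V).
Proof.
rewrite -[X in measurable X]/((fun x : V => inner x x) @^-1` [set 1]) -[X in measurable X]setTI.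
by apply: measurable_inner => //; exact: measurable_id.
Qed.

Lemma cone_measure_sphere : sigma (~` @unit_sphere R n.+1) = 0%E.
Proof.
rewrite sigmaE (_ : _ `&` _ = set0) ?leb0//.
by apply/seteqP; split=> // x [/= h /pball_dir].
Qed.

Lemma cone_measure_isom (T S : Rn -> Rn) (A : set V) :
  (forall x y, T (x + y) = T x + T y) -> (forall t y, T (t *: y) = t *: T y) ->
  (forall x, T (S x) = x) -> (forall x, inner (T x) (T x) = inner x x) ->
  measurable_fun setT (T : V -> V) -> measurable A ->
  sigma ((T : V -> V) @^-1` A) = sigma A.
Proof.
move=> TD TZ TS Tn mT mA; rewrite !sigmaE.
rewrite -(leb_isometry TD TS Tn mT (A := (dir : V -> V) @^-1` A `&` pball)).
  congr leb; apply/seteqP; split=> x; rewrite /= /pball/= Tn dir_isom//.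
apply: measurableI; last exact: measurable_pball.
by rewrite -[X in measurable X]setTI; exact: measurable_dir.
Qed.

End SphereMeasure.

(** * Random rotations *)

Section GramSchmidt.
Variables (R : realType) (n : nat).
Local Notation V := (eucl R n).
Local Notation Rn := 'rV[R]_n.+1.
Implicit Types (r : nat -> Rn) (x y : Rn).

(* The component of [x] orthogonal to the first [k] Gram-Schmidt vectors of [r]. *)
Fixpoint gs_res r k x : Rn :=
  if k is k'.+1 then
    let y := gs_res r k' x in let q := dir (gs_res r k' (r k')) in y - inner y q *: q
  else x.

Definition gs r k := dir (gs_res r k (r k)).

(** As [dir 0 = 0], unit length at every step means that no residual vanishes, that is, the first
    n+1 vectors of [r] are linearly independent. *)
Definition gs_good r := forall k, (k < n.+1)%N -> inner (gs r k) (gs r k) = 1.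

Lemma gs_resS r k x : gs_res r k.+1 x =
  gs_res r k x - inner (gs_res r k x) (gs r k) *: gs r k.
Proof. by []. Qed.

Lemma gs_res_orth r k i x : gs_good r -> (i < k)%N -> (k <= n.+1)%N ->
  inner (gs_res r k x) (gs r i) = 0.
Proof.
move=> g; elim: k x => [//|k IH] x; rewrite ltnS leq_eqVlt => ik kn.
rewrite gs_resS innerDl innerNl innerZl.
case/orP: ik => [/eqP ->|ik]; first by rewrite g// mulr1 subrr.
rewrite IH// ?(ltnW kn)// {2}/gs /dir innerZl IH// ?(ltnW kn)//.
by rewrite !mulr0 subr0.
Qed.

Lemma gs_orth r i j : gs_good r -> (i < n.+1)%N -> (j < n.+1)%N ->
  inner (gs r i) (gs r j) = (i == j)%:R.
Proof.
move=> g; wlog ij : i j / (i <= j)%N.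
  move=> H iN jN; case: (leqP i j) => [ij|/ltnW ij]; first exact: H.
  by rewrite innerC eq_sym; exact: H.
move=> iN jN; case: (eqVneq i j) => [<-|ne]; first by rewrite g.
rewrite innerC {1}/gs /dir innerZl gs_res_orth ?mulr0//; last exact: ltnW.
by rewrite ltn_neqAle ne.
Qed.

(** The construction uses only linear operations and inner products, so it commutes with linear
    isometries. The invariance of random frames comes from here. *)
Lemma gs_equiv (T : Rn -> Rn) r : (forall x y, T (x + y) = T x + T y) ->
  (forall t y, T (t *: y) = t *: T y) ->
  (forall x y, inner (T x) (T y) = inner x y) ->
  forall k, gs (T \o r) k = T (gs r k).
Proof.
move=> TD TZ Tn.
have dirT x : dir (T x) = T (dir x) by exact: dir_isom.
have TB x y : T (x - y) = T x - T y by rewrite TD -scaleN1r TZ scaleN1r.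
have resT k x : gs_res (T \o r) k (T x) = T (gs_res r k x).
  elim: k x => [//|k IH] x; rewrite !gs_resS /gs /= !IH dirT Tn TB TZ.
  by [].
by move=> k; rewrite /gs /= resT dirT.
Qed.

Definition frame_coord r x : Rn := \row_j inner x (gs r j).

Lemma inner_mx x y : inner x y = (x *m y^T) 0 0.
Proof. by rewrite mxE; apply: eq_bigr => i _; rewrite mxE. Qed.

(** Orthonormality of the frame says Q Q^T = 1. Since Q is square, Q^T Q = 1 follows, and this makes
    x Q^T preserve inner products. *)
Lemma inner_frame_coord r x y : gs_good r ->
  inner (frame_coord r x) (frame_coord r y) = inner x y.
Proof.
move=> g; pose Q : 'M[R]_n.+1 := \matrix_(i, j) gs r i 0 j.
have QQ : Q *m Q^T = 1%:M.
  apply/matrixP => i j; rewrite !mxE -[i == j]/(nat_of_ord i == nat_of_ord j) -(gs_orth g (ltn_ord i) (ltn_ord j)).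
  by apply: eq_bigr => k _; rewrite !mxE.
have E z : frame_coord r z = z *m Q^T.
  by apply/rowP => j; rewrite !mxE; apply: eq_bigr => k _; rewrite !mxE.
rewrite !inner_mx !E trmx_mul trmxK -mulmxA (mulmxA Q^T).
by rewrite (mulmx1C QQ) mul1mx.
Qed.

Definition frame_inv r x : Rn := \sum_(i < n.+1) x 0 i *: gs r i.

Lemma frame_coordK r x : gs_good r -> frame_coord r (frame_inv r x) = x.
Proof.
move=> g; apply/rowP => j; rewrite mxE /frame_inv.
have -> : inner (\sum_(i < n.+1) x 0 i *: gs r i) (gs r j) =
    \sum_(i < n.+1) x 0 i * inner (gs r i) (gs r j).
  elim/big_rec2: _ => [|i a b _ <-]; first exact: inner0l.
  by rewrite innerDl innerZl.
rewrite (bigD1 j)//= gs_orth// eqxx mulr1 big1 ?addr0// => i ij.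
by rewrite gs_orth// (inj_eq val_inj) (negPf ij) mulr0.
Qed.

Lemma measurable_gs_res d (T : measurableType d) (r : T -> nat -> V) k (x : T -> V) :
  (forall i, measurable_fun setT (r^~ i)) -> measurable_fun setT x ->
  measurable_fun setT ((fun t => gs_res (r t) k (x t)) : T -> V).
Proof.
move=> mr; elim: k x => [//|k IH] x mx.
have mq : measurable_fun setT ((fun t => gs (r t) k) : T -> V).
  exact: (measurableT_comp (@measurable_dir R n) (IH _ (mr k))).
apply: measurable_pair_eucl_add; first exact: IH.
by apply: measurable_euclN; apply: measurable_scale => //; apply: measurable_inner => //; exact: IH.
Qed.

Lemma measurable_gs d (T : measurableType d) (r : T -> nat -> V) k :
  (forall i, measurable_fun setT (r^~ i)) ->
  measurable_fun setT ((fun t => gs (r t) k) : T -> V).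
Proof.
move=> mr; have m := measurable_gs_res k mr (mr k).
exact: (measurableT_comp (@measurable_dir R n) m).
Qed.

(** * Continuity of the Gram-Schmidt process at an orthonormal frame *)

Section GSContinuity.
Context (T : Type) (F : set_system T) {FF : ProperFilter F}.

Definition cvgv (x : T -> Rn) (l : Rn) := forall j, (x t 0 j) @[t --> F] --> l 0 j.

Lemma cvgv_inner (x y : T -> Rn) (l m : Rn) : cvgv x l -> cvgv y m ->
  (inner (x t) (y t)) @[t --> F] --> inner l m.
Proof.
move=> xl ym; apply: cvg_big => [|i _]; first exact: add_continuous.
exact: cvgM (xl i) (ym i).
Qed.

Lemma cvgvB (x y : T -> Rn) (l m : Rn) : cvgv x l -> cvgv y m -> cvgv (fun t => x t - y t) (l - m).
Proof.
move=> xl ym j; under eq_fun do rewrite !mxE.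
by rewrite !mxE; exact: cvgB (xl j) (ym j).
Qed.

Lemma cvgvZ (a : T -> R) (b : R) (x : T -> Rn) (l : Rn) : a t @[t --> F] --> b -> cvgv x l ->
  cvgv (fun t => a t *: x t) (b *: l).
Proof.
move=> ab xl j; under eq_fun do rewrite !mxE.
by rewrite !mxE; exact: cvgM ab (xl j).
Qed.

Lemma cvgv_dir (x : T -> Rn) (l : Rn) : inner l l = 1 -> cvgv x l -> cvgv (fun t => dir (x t)) l.
Proof.
move=> l1 xl; rewrite -[X in cvgv _ X](dir_id l1).
apply: cvgvZ => //; apply: cvgV; first by rewrite l1 sqrtr1.
have /= := cvgv_inner xl xl.
exact: (continuous_cvg _ (@sqrt_continuous R _)).
Qed.

(** Each projection subtracted tends to 0, because [l] is orthogonal to the limit frame, and the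
    normalising lengths tend to 1, so [dir] is used only where it is continuous. *)
Lemma cvgv_gs_res (r : T -> nat -> Rn) (e : nat -> Rn) k (x : T -> Rn) (l : Rn) :
  (forall i, cvgv (r^~ i) (e i)) -> (k <= n.+1)%N ->
  (forall i j, (i < n.+1)%N -> (j < n.+1)%N -> inner (e i) (e j) = (i == j)%:R) ->
  cvgv x l -> (forall i, (i < k)%N -> inner l (e i) = 0) ->
  cvgv (fun t => gs_res (r t) k (x t)) l.
Proof.
move=> re kn ee; elim: k x l kn => [//|k IH] x l kn xl lo.
have cr := IH x l (ltnW kn) xl (fun i ik => lo i (ltnW ik)).
have ce : cvgv (fun t => gs (r t) k) (e k).
  apply: cvgv_dir; first by rewrite ee// eqxx.
  apply: IH => //; first exact: ltnW.
  by move=> i ik; rewrite ee ?gtn_eqF//; exact: ltn_trans ik kn.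
rewrite -[X in cvgv _ X]subr0 -(scale0r (e k)) -(lo k (ltnSn k)).
by apply: cvgvB => //; apply: cvgvZ => //; exact: cvgv_inner.
Qed.

Lemma cvgv_gs (r : T -> nat -> Rn) (e : nat -> Rn) k :
  (forall i, cvgv (r^~ i) (e i)) -> (k < n.+1)%N ->
  (forall i j, (i < n.+1)%N -> (j < n.+1)%N -> inner (e i) (e j) = (i == j)%:R) ->
  cvgv (fun t => gs (r t) k) (e k) /\
  \forall t \near F, inner (gs (r t) k) (gs (r t) k) = 1.
Proof.
move=> re kn ee.
have c : cvgv (fun t => gs_res (r t) k (r t k)) (e k).
  apply: (cvgv_gs_res re) => //; first exact: ltnW.
  by move=> i ik; rewrite ee ?gtn_eqF//; exact: ltn_trans ik kn.
split; first by apply: cvgv_dir => //; rewrite ee// eqxx.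
have := cvgv_inner c c; rewrite ee// eqxx => /cvgr_gt/(_ _ ltr01).
apply: filterS => t h; apply: inner_dir; rewrite -inner_eq0.
by rewrite gt_eqF.
Qed.

End GSContinuity.

End GramSchmidt.

(** * The invariant measure on frames and the action of frames on vectors *)

Section Haar.
Variables (R : realType) (n : nat).
Local Notation V := (eucl R n).
Local Notation Rn := 'rV[R]_n.+1.
Local Notation N := (n.+1 * n.+1).-1.
Local Notation Om := (eucl R N).
Local Notation RN := 'rV[R]_N.+1.

Lemma sqr_dimE : (n.+1 * n.+1)%N = N.+1. Proof. by []. Qed.

(** Matrices are stored as row vectors so that Lebesgue measure applies to them. The type [eucl R N]
    has dimension [N.+1], hence the predecessor in [N] and the casts. *)
Definition unvec (M : RN) : 'M[R]_n.+1 := vec_mx (castmx (erefl, esym sqr_dimE) M).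
Definition tovec (A : 'M[R]_n.+1) : RN := castmx (erefl, sqr_dimE) (mxvec A).

Lemma unvecK : cancel unvec tovec.
Proof. by move=> M; rewrite /tovec /unvec vec_mxK castmx_comp castmx_id. Qed.

Lemma tovecK : cancel tovec unvec.
Proof. by move=> A; rewrite /tovec /unvec castmx_comp castmx_id mxvecK. Qed.

Lemma unvecE M i j : unvec M i j = M 0 (cast_ord sqr_dimE (mxvec_index i j)).
Proof. by rewrite /unvec mxE castmxE cast_ord_id esymK. Qed.

Lemma inner_unvec (M M' : RN) :
  inner M M' = \sum_i inner (row i (unvec M)) (row i (unvec M')).
Proof.
rewrite {1}/inner (reindex (cast_ord sqr_dimE)) /=; last first.
  by exists (cast_ord (esym sqr_dimE)) => k _; rewrite ?cast_ordK ?cast_ordKV.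
rewrite (reindex _ (curry_mxvec_bij n.+1 n.+1)) /=.
rewrite (eq_bigr (fun p => unvec M p.1 p.2 * unvec M' p.1 p.2)); last first.
  by case=> i j _; rewrite !unvecE.
rewrite -(pair_bigA _ (fun i j => unvec M i j * unvec M' i j))/=.
by apply: eq_bigr => i _; apply: eq_bigr => j _; rewrite !mxE.
Qed.

Definition frame_rows (M : RN) (i : nat) : Rn := row (inord i) (unvec M).

Definition map_rows (T : Rn -> Rn) (M : RN) : RN :=
  tovec (\matrix_i T (row i (unvec M))).

Lemma row_map_rows T M i : row i (unvec (map_rows T M)) = T (row i (unvec M)).
Proof. by rewrite /map_rows tovecK rowK. Qed.

Lemma frame_rows_map T M : frame_rows (map_rows T M) = T \o frame_rows M.
Proof. by apply/funext => i; rewrite /frame_rows row_map_rows. Qed.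

Lemma unvec_rowP M M' : (forall i, row i (unvec M) = row i (unvec M')) -> M = M'.
Proof. by move=> h; apply: (can_inj unvecK); apply/row_matrixP. Qed.

Lemma measurable_unvec_row d (T : measurableType d) (f : T -> Om) i :
  measurable_fun setT f -> measurable_fun setT ((fun t => row i (unvec (f t))) : T -> V).
Proof.
move=> mf; apply: measurable_eucl => j; under eq_fun do rewrite mxE unvecE.
exact: (measurableT_comp (@measurable_coord R N _) mf).
Qed.

Lemma measurable_map_rows (T : Rn -> Rn) : measurable_fun setT (T : V -> V) ->
  measurable_fun setT (map_rows T : Om -> Om).
Proof.
move=> mT; apply: measurable_eucl => k.
rewrite -(cast_ordKV sqr_dimE k).
move: (cast_ord (esym sqr_dimE) k) => k'; case/mxvec_indexP: k' => i j.
have mi : measurable_fun setT ((fun M : Om => T (row i (unvec M))) : Om -> V).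
  by apply: (measurableT_comp mT); apply: measurable_unvec_row.
rewrite (_ : (fun M => _) = (fun M : Om => T (row i (unvec M)) 0 j)).
  exact: (measurableT_comp (@measurable_coord R n j) mi).
by apply/funext => M; rewrite -unvecE -row_map_rows [RHS]mxE.
Qed.

Definition good_frames : set Om := [set M | gs_good (frame_rows M)].

Lemma measurable_frame_rows i : measurable_fun setT ((fun M : Om => frame_rows M i) : Om -> V).
Proof. exact: measurable_unvec_row. Qed.

Lemma measurable_good_frames : measurable good_frames.
Proof.
rewrite (_ : good_frames = \bigcap_(k : 'I_n.+1) ((fun M : Om => inner (gs (frame_rows M) k) (gs (frame_rows M) k)) @^-1` [set 1])).
  apply: fin_bigcap_measurable => // k _; rewrite -[X in measurable X]setTI.
  by apply: measurable_inner => //; apply: measurable_gs; exact: measurable_frame_rows.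
apply/seteqP; split=> [M g k _|M H k kn]; first exact: g.
exact: (H (Ordinal kn) I).
Qed.

(* Lebesgue measure on a ball of square matrices is invariant under an isometry
   of all rows at once, so the Gram-Schmidt frame of a random matrix is a
   uniformly distributed rotation. *)
Definition haar_dom : set Om := good_frames `&` open_ball (n.+1%:R + 1).

Lemma measurable_haar_dom : measurable haar_dom.
Proof. by apply: measurableI; [exact: measurable_good_frames|exact: measurable_open_ball]. Qed.

Lemma leb_haar_dom_lty : (leb haar_dom < +oo)%E.
Proof.
apply: le_lt_trans (@leb_open_ball_lty R N (n.+1%:R + 1)).
by apply: le_measure; rewrite ?inE;
  [exact: measurable_haar_dom|exact: measurable_open_ball|move=> x []].
Qed.

Definition haar := mfrestr measurable_haar_dom leb_haar_dom_lty.
HB.instance Definition _ := FiniteMeasure.on haar.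

Section Isometry.
Variable T : Rn -> Rn.
Hypothesis TD : forall x y, T (x + y) = T x + T y.
Hypothesis TZ : forall t y, T (t *: y) = t *: T y.
Hypothesis TT : forall x, T (T x) = x.
Hypothesis Tn : forall x y, inner (T x) (T y) = inner x y.
Hypothesis mT : measurable_fun setT (T : V -> V).

Lemma gs_map_rows M k : gs (frame_rows (map_rows T M)) k = T (gs (frame_rows M) k).
Proof. by rewrite frame_rows_map gs_equiv. Qed.

Lemma good_frames_map M : good_frames (map_rows T M) = good_frames M.
Proof.
by apply/propext; split=> g k kn; have := g k kn; rewrite gs_map_rows Tn.
Qed.

Lemma inner_map_rows M : inner (map_rows T M) (map_rows T M) = inner M M.
Proof. by rewrite !inner_unvec; apply: eq_bigr => i _; rewrite row_map_rows Tn. Qed.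

Lemma haar_map_rows A : measurable A -> haar ((map_rows T : Om -> Om) @^-1` A) = haar A.
Proof.
move=> mA; rewrite /haar /mfrestr /mrestr.
have mAD : measurable (A `&` haar_dom) by apply: measurableI => //; exact: measurable_haar_dom.
rewrite -[RHS](leb_isometry (T := map_rows T) (S := map_rows T) _ _ _ _ mAD).
- congr leb; apply/seteqP; split=> M; rewrite /= /haar_dom/= /open_ball/= inner_map_rows.
    by rewrite [X in _ -> _ /\ (X /\ _)]good_frames_map.
  by rewrite [X in _ /\ (X /\ _) -> _]good_frames_map.
- move=> M M'; apply: unvec_rowP => i.
  have rowD X Y : row i (unvec (X + Y)) = row i (unvec X) + row i (unvec Y).
    by apply/rowP => j; rewrite [LHS]mxE [RHS]mxE ![row i _ 0 j]mxE !unvecE mxE.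
  by rewrite rowD !row_map_rows rowD TD.
- by move=> M; apply: unvec_rowP => i; rewrite !row_map_rows TT.
- exact: inner_map_rows.
- exact: measurable_map_rows.
Qed.

End Isometry.

(** Taking the identity on degenerate matrices, a [haar]-null set, makes [act M] a linear isometry
    for every [M]. *)
Definition act (M : Om) (x : V) : V :=
  if `[< good_frames M >] then frame_coord (frame_rows M) x else x.

Lemma act_good M x : good_frames M -> act M x = frame_coord (frame_rows M) x.
Proof. by move=> g; rewrite /act; case: asboolP. Qed.

Lemma inner_act M x y : inner (act M x) (act M y) = inner x y.
Proof. by rewrite /act; case: asboolP => // g; exact: inner_frame_coord. Qed.

Lemma measurable_act : measurable_fun setT ((fun z => act z.1 z.2) : Om * V -> V).
Proof.
apply: (@measurable_fun_ifT _ _ (Om * V)%type V).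
- apply: (@measurable_fun_bool _ _ _ _ true); rewrite setTI.
  rewrite (_ : _ @^-1` _ = fst @^-1` good_frames).
    by rewrite -[X in measurable X]setTI; apply: measurable_fst => //; exact: measurable_good_frames.
  by apply/seteqP; split=> z /= /asboolP.
- apply: measurable_eucl => j; under eq_fun do rewrite mxE.
  apply: measurable_inner; first exact: measurable_snd.
  apply: measurable_gs => i.
  exact: (measurableT_comp (measurable_frame_rows i) measurable_fst).
- exact: measurable_snd.
Qed.

Lemma frame_coordD r (x y : Rn) : frame_coord r (x + y) = frame_coord r x + frame_coord r y.
Proof. by apply/rowP => j; rewrite !mxE innerDl. Qed.

Lemma frame_coordZ r t (x : Rn) : frame_coord r (t *: x) = t *: frame_coord r x.
Proof. by apply/rowP => j; rewrite !mxE innerZl. Qed.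

Lemma actD M (x y : Rn) : act M (x + y) = (act M x : Rn) + act M y.
Proof. by rewrite /act; case: asboolP => // g; exact: frame_coordD. Qed.

Lemma actZ M t (x : Rn) : act M (t *: x) = t *: (act M x : Rn).
Proof. by rewrite /act; case: asboolP => // g; exact: frame_coordZ. Qed.

Lemma act_surj M : exists S : Rn -> Rn, forall x, act M (S x) = x.
Proof.
rewrite /act; case: asboolP => g; last by exists id.
by exists (frame_inv (frame_rows M)) => x; exact: frame_coordK.
Qed.

Lemma measurable_act1 M : measurable_fun setT (act M).
Proof. exact: (measurableT_comp measurable_act (pair1_measurable M)). Qed.

Lemma measurable_act2 x : measurable_fun setT (act^~ x).
Proof. exact: (measurableT_comp measurable_act (pair2_measurable x)). Qed.

Lemma haar_bad : haar (~` good_frames) = 0%E.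
Proof.
rewrite /haar /mfrestr /mrestr (_ : _ `&` _ = set0) ?measure0//.
by apply/seteqP; split=> // M [/= h [/h]].
Qed.

(** Reflecting all rows of a matrix reflects its frame, and coordinates of a reflected vector in a
    reflected frame are the old coordinates. The reflection is thus absorbed by a change of variable
    that preserves [haar]. *)
Lemma haar_refl (a : Rn) (x y : V) (f g : V -> R) : bdfun f -> bdfun g ->
  \int[haar]_M (f (act M (refl a x)) * g (act M (refl a y))) =
  \int[haar]_M (f (act M x) * g (act M y)).
Proof.
move=> bf bg.
have bF u v : bdfun (fun M => f (act M u) * g (act M v)).
  by apply: bdfunM; [apply: bdfun_comp bf _|apply: bdfun_comp bg _]; exact: measurable_act2.
have mm := measurable_map_rows (measurable_refl a).
have hm : forall A, measurable A -> haar A = haar ((map_rows (refl a) : Om -> Om) @^-1` A).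
  move=> A mA; rewrite haar_map_rows//; [exact: reflD|exact: reflZ|exact: reflK|exact: inner_refl|].
  exact: measurable_refl.
rewrite (Rintegral_image mm hm (bF _ _)).
apply: (bdfun_ae_eq_Rintegral measurable_good_frames haar_bad) => //.
  by apply: bdfun_comp (bF _ _) _.
move=> M; rewrite inE => gM.
have E u : act (map_rows (refl a) M) (refl a u) = act M u.
  rewrite !act_good//; last by rewrite good_frames_map//; [exact: reflD|exact: reflZ|exact: inner_refl].
  apply/rowP => j; rewrite !mxE gs_map_rows ?inner_refl//; [exact: reflD|exact: reflZ|exact: inner_refl].
by rewrite !E.
Qed.

Lemma haar_pair (x y x' y' : V) (f g : V -> R) : bdfun f -> bdfun g ->
  inner x x = inner x' x' -> inner y y = inner y' y' -> inner x y = inner x' y' ->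
  \int[haar]_M (f (act M x) * g (act M y)) = \int[haar]_M (f (act M x') * g (act M y')).
Proof.
move=> bf bg xx yy xy; have [a [b [<- <-]]] := refl_pair xx yy xy.
by rewrite !haar_refl.
Qed.

End Haar.

(** * Density points *)

Lemma leb_nbhs_gt0 (R : realType) n (x : 'rV[R]_n.+1) (U : set (eucl R n)) :
  nbhs x (U : set 'rV[R]_n.+1) -> (0 < leb U)%E.
Proof.
move=> /nbhs_ballP[e /= e0 eU].
have sub : box (x - const_mx (e / 2)) x `<=` U.
  move=> y xy; apply: eU; split=> // i j; rewrite ord1.
  have := xy j; rewrite !mxE => /andP[h1 h2].
  by rewrite /ball/= ger0_norm; lra.
apply: lt_le_trans (le_outer_measure (@lebesgue_outer R n.+1) _ _ sub).
rewrite [ltRHS](@leb_box R n) => [|i]; last by rewrite !mxE lerBlDr lerDl divr_ge0// ltW.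
rewrite lte_fin; apply: prodr_gt0 => i _ /=; rewrite !mxE.
by rewrite opprD opprK addrA subrr add0r divr_gt0.
Qed.

Section NearIdentity.
Variables (R : realType) (n : nat).
Local Notation V := (eucl R n).
Local Notation Rn := 'rV[R]_n.+1.
Local Notation N := (n.+1 * n.+1).-1.
Local Notation Om := (eucl R N).

Definition near_id (e : R) : set Om := good_frames (n := n) `&`
  [set M : Om | forall i j : 'I_n.+1, `|gs (frame_rows M) i 0 j - (i == j)%:R| < e].

Lemma measurable_near_id e : measurable (near_id e).
Proof.
apply: measurableI; first exact: measurable_good_frames.
rewrite (_ : [set M | _] = \bigcap_(i : 'I_n.+1) \bigcap_(j : 'I_n.+1)
  ((fun M : Om => `|gs (frame_rows M) i 0 j - (i == j)%:R|) @^-1` `]-oo, e[%classic)).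
  apply: fin_bigcap_measurable => // i _; apply: fin_bigcap_measurable => // j _.
  rewrite -[X in measurable X]setTI.
  have m1 : measurable_fun setT (fun M : Om => gs (frame_rows M) i 0 j - (i == j)%:R).
    apply: measurable_funB; last exact: measurable_cst.
    exact: (measurableT_comp (@measurable_coord R n j) (measurable_gs i (@measurable_frame_rows R n))).
  exact: (measurableT_comp (@normr_measurable _ _) m1) _ (measurable_itv _).
apply/seteqP; split=> [M h i _ j _|M h i j]; first by rewrite /= in_itv/=; exact: h.
by have := h i I j I; rewrite /= in_itv.
Qed.

(** Gram-Schmidt is continuous at the identity matrix, so the set contains a neighbourhood of it, up
    to the restriction to [haar_dom]. *)
Lemma haar_near_id_gt0 e : 0 < e -> (0 < @haar R n (near_id e))%E.
Proof.
move=> e0.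
pose M0 : 'rV[R]_N.+1 := tovec 1%:M.
pose b (i : nat) : Rn := row (inord i) 1%:M.
have bb i j : (i < n.+1)%N -> (j < n.+1)%N -> inner (b i) (b j) = (i == j)%:R.
  move=> iN jN; rewrite /b /inner (bigD1 (inord i))//= big1 => [|k ki].
    rewrite !mxE eqxx mul1r addr0; congr (nat_of_bool _)%:R.
    by rewrite -(inj_eq val_inj)/= !inordK// eq_sym.
  by rewrite !mxE eq_sym (negPf ki) mul0r.
have fb i : cvgv (nbhs M0) (fun M => frame_rows M i) (b i).
  move=> j.
  rewrite (_ : (fun M => _) = (fun M : 'rV[R]_N.+1 => M 0 (cast_ord (sqr_dimE n) (mxvec_index (inord i) j)))); last first.
    by apply/funext => M; rewrite mxE unvecE.
  rewrite (_ : b i 0 j = M0 0 (cast_ord (sqr_dimE n) (mxvec_index (inord i) j))); last first.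
    by rewrite -unvecE tovecK mxE.
  exact: coord_continuous.
have FF : Filter (nbhs M0) by exact: nbhs_filter.
have near1 : \forall M \near M0, forall i : 'I_n.+1, forall j : 'I_n.+1,
    `|gs (frame_rows M) i 0 j - (i == j)%:R| < e.
  apply: (@filter_forall _ _ _ (nbhs M0) FF) => i; apply: (@filter_forall _ _ _ (nbhs M0) FF) => j.
  have [c _] := cvgv_gs fb (ltn_ord i) bb.
  have /cvgrPdist_lt/(_ _ e0) := c j; apply: filterS => M.
  by rewrite distrC /b !mxE inord_val.
have near2 : \forall M \near M0, forall i : 'I_n.+1, inner (gs (frame_rows M) i) (gs (frame_rows M) i) = 1.
  by apply: (@filter_forall _ _ _ (nbhs M0) FF) => i; have [_] := cvgv_gs fb (ltn_ord i) bb.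
(* The identity has squared norm n+1. The radius n+1+1 in [haar_dom] leaves room for a neighbourhood
   of it. *)
have near3 : \forall M \near M0, inner M M < n.+1%:R + 1.
  have c : cvgv (nbhs M0) id M0 by move=> j; exact: coord_continuous.
  have := cvgv_inner c c.
  have -> : inner M0 M0 = n.+1%:R.
    rewrite inner_unvec tovecK (eq_bigr (fun=> 1)).
      by rewrite sumr_const card_ord.
    move=> i _; have := bb i i (ltn_ord i) (ltn_ord i).
    by rewrite /b inord_val eqxx.
  by move=> /(_ _) h; apply: (cvgr_lt _ h); rewrite ltrDl.
rewrite /haar /mfrestr /mrestr.
apply: (@leb_nbhs_gt0 R N M0).
apply: filterS3 near1 near2 near3 => M h1 h2 h3.
have g : good_frames (M : Om) by move=> k kn; exact: (h2 (Ordinal kn)).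
by split; split.
Qed.

Lemma act_near_id e (M : Om) (x : V) j : near_id e M ->
  `|act M x 0 j - x 0 j| <= e * \sum_(l < n.+1) `|x 0 l|.
Proof.
move=> [g h]; rewrite act_good// mxE.
have -> : x 0 j = \sum_(l < n.+1) x 0 l * (j == l)%:R.
  rewrite (bigD1 j)//= eqxx mulr1 big1 ?addr0// => l lj.
  by rewrite eq_sym (negPf lj) mulr0.
rewrite /inner -sumrB mulr_sumr; apply: (le_trans (ler_norm_sum _ _ _)).
apply: ler_sum => l _; rewrite -mulrBr normrM mulrC ler_wpM2r//.
by rewrite ltW.
Qed.

Variable sigma : {finite_measure set V -> \bar R}.
Hypothesis sigmaE : forall A, sigma A = leb ((@dir R n : V -> V) @^-1` A `&` @pball R n).

(** Let [U] be open around the cone [S'] over [S], with excess at most eta/2. Most points of [U]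
    have a cube of fixed size around them inside [U], and a small rotation keeps such points in [U].
    If one of them leaves [S'], it lands in [U] minus [S'], whose preimage is as small as the excess
    because rotations preserve measure. *)
Lemma near_id_displacement (S : set V) (eta : R) : measurable S -> 0 < eta ->
  exists2 e, 0 < e & forall M, near_id e M ->
    (sigma [set x | S x /\ ~ S (act M x)] <= eta%:E)%E.
Proof.
move=> mS eta0.
pose S' : set V := (@dir R n : V -> V) @^-1` S `&` @pball R n.
have mS' : measurable S'.
  apply: measurableI; last exact: measurable_pball.
  by rewrite -[X in measurable X]setTI; exact: measurable_dir.
have eta20 : 0 < eta / 2 by rewrite divr_gt0.
have [U [oU SU leO]] := lebesgue_outer_regular (S' : set Rn) eta20.
have mO : measurable (U : set V) by exact: measurable_open.
have fS' : (leb S' < +oo)%E.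
  apply: le_lt_trans (leb_pball_lty R n); apply: le_measure; rewrite ?inE//.
    exact: measurable_pball.
  by move=> x [].
have OS : (leb (U `\` S') <= (eta / 2)%:E)%E.
  have f'S : leb S' \is a fin_num by rewrite ge0_fin_numE ?leb_ge0.
  rewrite -(@leeD2lE _ (leb S'))//.
  have <- : leb (S' `|` (U `\` S')) = (leb S' + leb (U `\` S'))%E.
    apply: measureU => //; first exact: measurableD.
    by rewrite setDE setIA [S' `&` U]setIC -setIA setICr setI0.
  by rewrite setDUK.
pose Ok (k : nat) : set V := [set p : V | forall y : V, (forall j, `|y 0 j - p 0 j| < k.+1%:R^-1) -> U y].
have mOk k : measurable (Ok k).
  rewrite -(setCK (Ok k)); apply: measurableC; apply: measurable_open.
  rewrite openE => p /= /existsNP[y /not_implyP[py nOy]].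
  have FF : Filter (nbhs (p : Rn)) by exact: nbhs_filter.
  have : nbhs (p : Rn) [set q : Rn | forall j, `|y 0 j - q 0 j| < k.+1%:R^-1].
    apply: (@filter_forall _ _ _ _ FF) => j.
    have c : (fun q : Rn => `|y 0 j - q 0 j|) @ (p : Rn) --> `|y 0 j - p 0 j|.
      by apply: cvg_norm; apply: cvgB; [exact: cvg_cst|exact: coord_continuous].
    by apply: (cvgr_lt _ c); exact: py.
  by apply: filterS => q h; apply/existsNP; exists y; apply/not_implyP.
have OkO k : Ok k `<=` U by move=> p; apply=> j; rewrite subrr normr0 invr_gt0 ltr0n.
pose D k := @pball R n `&` (U `\` Ok k).
have mD k : measurable (D k).
  by apply: measurableI; [exact: measurable_pball|exact: measurableD].
have [k Dk] : exists k, (leb (D k) <= (eta / 2)%:E)%E.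
  have c : (@leb R n \o D) k @[k --> \oo] --> leb (\bigcap_k D k).
    apply: nonincreasing_cvg_mu => //.
    - apply: le_lt_trans (leb_pball_lty R n); apply: le_measure; rewrite ?inE//.
        exact: measurable_pball.
      by move=> x [].
    - exact: bigcapT_measurable.
    - move=> k l kl; apply/subsetPset => p [pp [Op nOk]]; split=> //; split=> // Okp.
      apply: nOk => y yp; apply: Okp => j; apply: (lt_le_trans (yp j)).
      by rewrite lef_pV2 ?posrE ?ltr0n// ler_nat.
  have D0 : \bigcap_k D k = set0.
    apply/seteqP; split=> // p H; have [pp [Op _]] := H 0%N I.
    have : nbhs (p : Rn) U by exact: open_nbhs_nbhs.
    move=> /nbhs_ballP[d /= d0 dO].
    have [_ [_]] := H (Num.truncn d^-1) I; apply=> y yp; apply: dO; split=> // i j.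
    rewrite ord1 /ball/= distrC; apply: (lt_trans (yp j)).
    by rewrite invf_plt ?posrE ?ltr0n// Num.Theory.truncnS_gt.
  move: c; rewrite D0 measure0 => /fine_cvgP[_ /cvgrPdist_le/(_ _ eta20)[k _ /(_ k (leqnn k))]] /=.
  rewrite sub0r normrN ger0_norm ?fine_ge0// => h; exists k.
  rewrite -lee_fin fineK// in h; rewrite ge0_fin_numE ?leb_ge0//.
  apply: le_lt_trans (leb_pball_lty R n); apply: le_measure; rewrite ?inE//.
    exact: measurable_pball.
  by move=> x [].
(* Coordinates of points of the ball are at most 1 in absolute value, so a rotation moves each
   coordinate by at most e (n+1) < 1/(k+1). *)
pose e : R := (k.+1%:R * n.+2%:R)^-1.
have e0 : 0 < e by rewrite invr_gt0 mulr_gt0// ltr0n.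
exists e => // M Me.
have dact p : dir (act M p : Rn) = act M (dir (p : Rn)).
  by apply: dir_isom => [t y|y]; [exact: actZ|exact: inner_act].
have mact := measurable_act1 M.
rewrite sigmaE.
have sub : ((@dir R n : V -> V) @^-1` [set x | S x /\ ~ S (act M x)] `&` @pball R n) `<=`
    D k `|` (act M @^-1` (U `\` S')).
  move=> p [/= [Sp nSp] pp].
  have pS' : S' p by [].
  have npS' : ~ S' (act M p) by move=> [/=]; rewrite dact.
  have [Okp|nOkp] := pselect (Ok k p); last by left; split=> //; split=> //; exact: SU.
  right; split=> //; apply: Okp => j; apply: (le_lt_trans (act_near_id _ _ Me)).
  apply: (@le_lt_trans _ _ (e * n.+1%:R)).
    rewrite ler_wpM2l ?(ltW e0)// -[n.+1 in leRHS]card_ord -sumr_const.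
    apply: ler_sum => l _; have /andP[_ p1] := pp.
    have : `|p 0 l| ^+ 2 <= 1.
      rewrite real_normK ?num_real//; apply: le_trans (ltW p1).
      by rewrite /inner (bigD1 l)//= -expr2 lerDl sumr_ge0// => i _; rewrite -expr2 sqr_ge0.
    by rewrite -[X in _ <= X](expr1n R 2) ler_pXn2r// nnegrE.
  rewrite /e invfM -mulrA gtr_pMr ?invr_gt0 ?ltr0n//.
  by rewrite mulrC ltr_pdivrMr ?ltr0n// mul1r ltr_nat.
have [T TS] := act_surj M.
have mOS : measurable (U `\` S' : set V) by exact: measurableD.
have iso : leb (act M @^-1` (U `\` S')) = leb (U `\` S').
  apply: (leb_isometry (T := act M) (S := T)) => //; [exact: actD|].
  by move=> x; exact: inner_act.
have mpre : measurable (act M @^-1` (U `\` S')) by rewrite -[X in measurable X]setTI; exact: mact.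
apply: (le_trans (le_outer_measure (@lebesgue_outer R n.+1) _ _ sub)).
apply: (le_trans (outer_measureU2 (@lebesgue_outer R n.+1) _ _)).
by rewrite [eta in leRHS](splitr eta) EFinD; apply: leeD => //; rewrite [leLHS]iso.
Qed.

End NearIdentity.

(** Markov's inequality: by Fubini the sections have total integral at most eta c, and the threshold
    is c/2. *)
Lemma section_le_small d1 d2 (T1 : measurableType d1) (T2 : measurableType d2) (R : realType)
  (m1 : {sigma_finite_measure set T1 -> \bar R}) (m2 : {sigma_finite_measure set T2 -> \bar R})
  (G : set (T1 * T2)) (F : set T2) (c eta : R) : measurable G -> measurable F ->
  0 < c -> 0 <= eta ->
  (forall z, G z -> F z.2) -> m2 F = c%:E ->
  (forall y, F y -> (m1 [set x | G (x, y)] <= eta%:E)%E) ->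
  (m1 [set x | (c / 2)%:E <= m2 [set y | G (x, y)]] <= (eta * 2)%:E)%E.
Proof.
move=> mG mF c0 eta0 GF Fc Geta.
have mx := measurable_fun_xsection m2 mG.
have my := measurable_fun_ysection m1 mG.
have xE x : (m2 \o xsection G) x = m2 [set y | G (x, y)].
  by rewrite /= /xsection; congr (m2 _); apply/seteqP; split=> y; rewrite /= in_setE.
have yE y : (m1 \o ysection G) y = m1 [set x | G (x, y)].
  by rewrite /= /ysection; congr (m1 _); apply/seteqP; split=> x; rewrite /= in_setE.
have {xE}mx : measurable_fun setT (fun x => m2 [set y | G (x, y)]).
  by rewrite (_ : (fun x => _) = m2 \o xsection G)//; apply/funext => x; rewrite xE.
have {yE}my : measurable_fun setT (fun y => m1 [set x | G (x, y)]).
  by rewrite (_ : (fun y => _) = m1 \o ysection G)//; apply/funext => y; rewrite yE.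
have c20 : 0 < c / 2 by rewrite divr_gt0.
have := le_integral_abse m1 measurableT mx c20; rewrite setTI.
rewrite (_ : [set x | _] = [set x | (c / 2)%:E <= m2 [set y | G (x, y)]]%E); last first.
  by apply/seteqP; split=> x /=; rewrite gee0_abs.
under eq_integral do rewrite gee0_abs//.
rewrite fubini_set// => h.
have le2 : (\int[m2]_y m1 [set x | G (x, y)] <= (eta * c)%:E)%E.
  rewrite EFinM -Fc -(integral_cst m2 mF).
  rewrite -(setUv F) ge0_integral_setU//=; last 3 first.
  - exact: measurableC.
  - by rewrite setUv.
  - by rewrite disj_set2E setICr.
  rewrite [X in (_ + X)%E]integral0_eq ?adde0; last first.
    move=> y nFy; rewrite (_ : [set x | _] = set0) ?measure0//.
    by apply/seteqP; split=> // x /= /GF.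
  apply: ge0_le_integral => //.
  - exact: measurable_funS my.
rewrite -(@lee_pmul2l _ (c / 2)%:E)// -EFinM (_ : c / 2 * (eta * 2) = eta * c) ?(le_trans h)//.
by field.
Qed.

Section DensitySet.
Variables (R : realType) (n : nat).
Local Notation V := (eucl R n).
Local Notation N := (n.+1 * n.+1).-1.
Local Notation Om := (eucl R N).
Variable sigma : {finite_measure set V -> \bar R}.
Hypothesis sigmaE : forall A, sigma A = leb ((@dir R n : V -> V) @^-1` A `&` @pball R n).

(* Small rotations move [S] little, so outside a null set a point of [S] remains
   in [S] under more than half of the rotations in some neighbourhoods of the
   identity, and any two such points do so simultaneously. *)
Lemma density_set (S : set V) : measurable S ->
  exists I0 : set V, [/\ measurable I0, I0 `<=` S, sigma (S `\` I0) = 0%E &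
    forall x y, I0 x -> I0 y -> (0 < @haar R n [set M | S (act M x) /\ S (act M y)])%E].
Proof.
move=> mS.
(* The exceptional set at stage j has measure at most 2 [eta j] = 2^-(j+1). The sum is finite, so by
   Borel-Cantelli almost every point is exceptional only finitely often. *)
pose eta (j : nat) : R := (2 ^ j.+1)%:R^-1 / 2.
have eta0 j : 0 < eta j by rewrite divr_gt0// invr_gt0 ltr0n expn_gt0.
have /choice[e he] : forall j, exists e, 0 < e /\ forall M, near_id e M ->
    (sigma [set x | S x /\ ~ S (act M x)] <= (eta j)%:E)%E.
  by move=> j; have [e e0 h] := near_id_displacement sigmaE mS (eta0 j); exists e.
pose E j : set Om := near_id (e j).
have mE j : measurable (E j) by exact: measurable_near_id.
pose c j := fine (@haar R n (E j)).
have cE j : @haar R n (E j) = (c j)%:E by rewrite fineK// fin_num_measure.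
have c0 j : 0 < c j by rewrite -lte_fin -cE; apply: haar_near_id_gt0; have [] := he j.
pose G j : set (V * Om) := [set z | S z.1 /\ E j z.2 /\ ~ S (act z.2 z.1)].
have mG j : measurable (G j).
  have mact : measurable_fun setT (fun z : V * Om => act z.2 z.1).
    exact: (measurableT_comp (@measurable_act R n) (@measurable_swap _ _ V Om)).
  rewrite (_ : G j = (fst @^-1` S) `&` ((snd @^-1` E j) `&` ~` ((fun z : V * Om => act z.2 z.1) @^-1` S)))//.
  apply: measurableI; first by rewrite -[X in measurable X]setTI; exact: measurable_fst.
  apply: measurableI; first by rewrite -[X in measurable X]setTI; exact: measurable_snd.
  by apply: measurableC; rewrite -[X in measurable X]setTI; exact: mact.
pose bad j : set V := [set x | ((c j / 2)%:E <= @haar R n [set M | G j (x, M)])%E].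
have badE j : bad j = [set x | ((c j / 2)%:E <= (@haar R n \o xsection (G j)) x)%E].
  apply/seteqP; split=> x; rewrite /bad/= /xsection;
  by rewrite (_ : [set M | (x, M) \in G j] = [set M | G j (x, M)])//; apply/seteqP; split=> M; rewrite /= in_setE.
have mbad j : measurable (bad j).
  rewrite badE -[X in measurable X]setTI.
  apply: emeasurable_fun_c_infty => //; exact: measurable_fun_xsection.
have sbad j : (sigma (bad j) <= (1 / (2 ^ j.+1)%:R)%:E)%E.
  rewrite (_ : 1 / _ = eta j * 2); last by rewrite /eta mul1r divfK.
  apply: (section_le_small (F := E j) (m2 := @haar R n)) => //; first exact: ltW.
    by move=> z [_ []].
  exact: cE.
  move=> M EM; have [_ /(_ _ EM)] := he j; apply: le_trans.
  apply: le_measure; rewrite ?inE.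
  - rewrite -[X in measurable X]setTI; exact: (pair2_measurable M) _ (mG j).
  - apply: measurableI => //; apply: measurableC.
    by rewrite -[X in measurable X]setTI; exact: measurable_act1.
  - by move=> x [Sx [_]].
have lim0 : sigma (lim_sup_set bad) = 0%E.
  apply: lim_sup_set_cvg0 => //.
  apply: (@le_lt_trans _ _ 1%:E); last exact: ltry.
  apply: (le_trans _ (@epsilon_trick0 R 1 xpredT ler01)).
  by apply: lee_nneseries => *; [exact: measure_ge0|exact: sbad].
have mlim : measurable (lim_sup_set bad) by apply: bigcap_measurable => // k _;
  apply: bigcup_measurable => *; exact: mbad.
exists (S `\` lim_sup_set bad); split.
- exact: measurableD.
- by move=> x [].
- rewrite setDD; apply/eqP; rewrite -measure_le0 -lim0; apply: le_measure; rewrite ?inE//.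
  exact: measurableI.
move=> x y [Sx nx] [Sy ny].
have good z : ~ lim_sup_set bad z -> exists k, forall j, (k <= j)%N -> ~ bad j z.
  move=> /existsNP[k] /not_implyP[_ h]; exists k => j kj bj; apply: h; exists j => //.
have [k1 h1] := good _ nx; have [k2 h2] := good _ ny.
have := h1 _ (leq_maxl k1 k2); have := h2 _ (leq_maxr k1 k2).
set j := maxn k1 k2 => /negP; rewrite -ltNge => b2 /negP; rewrite -ltNge => b1.
set A := [set M | _]; rewrite lt_neqAle measure_ge0 andbT; apply/eqP => A0.
have mA : measurable A.
  by apply: measurableI; rewrite -[X in measurable X]setTI; exact: measurable_act2.
have mGs z : measurable [set M | G j (z, M)].
  by rewrite -[X in measurable X]setTI; exact: (pair1_measurable z) _ (mG j).
have sub : E j `<=` A `|` ([set M | G j (x, M)] `|` [set M | G j (y, M)]).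
  move=> M EM; have [ax|ax] := pselect (S (act M x)); last by right; left.
  by have [ay|ay] := pselect (S (act M y)); [left|right; right].
have : (@haar R n (E j) < (c j / 2)%:E + (c j / 2)%:E)%E.
  apply: le_lt_trans (lteD b1 b2).
  apply: (le_trans (le_measure _ _ _ sub)); rewrite ?inE//.
    by apply: measurableU => //; exact: measurableU.
  apply: (le_trans (measureU2 _ _ _)) => //; first exact: measurableU.
  rewrite -[leRHS]add0e; apply: leeD; first by rewrite A0.
  exact: measureU2.
by rewrite cE -EFinD -splitr ltxx.
Qed.

End DensitySet.

(** * Absolute continuity of the inner product of two points of a circle *)

(** A Lipschitz image of a null set is null, with the map given as a correspondence [P] so that no
    function has to be chosen. Each interval of length l covering [N] yields one of length 2 C l
    around a point matched to it. *)
Lemma lipschitz_null (R : realType) (M N : set 'rV[R]_1) (C : R) (P : 'rV[R]_1 -> 'rV[R]_1 -> Prop) :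
  0 < C -> lebesgue_outer N = 0%E ->
  (forall s, M s -> exists2 r, N r & P s r) ->
  (forall s r s' r', P s r -> P s' r' -> `|s 0 0 - s' 0 0| <= C * `|r 0 0 - r' 0 0|) ->
  lebesgue_outer M = 0%E.
Proof.
move=> C0 N0 MN lip; apply/eqP; rewrite eq_le lebesgue_outer_ge0 andbT.
apply/lee_addgt0Pr => e e0; rewrite add0e.
have C20 : 0 < C * 2 by rewrite mulr_gt0.
have : (lebesgue_outer N < (e / (C * 2))%:E)%E by rewrite N0 lte_fin divr_gt0.
move=> /ereal_inf_lt[_ [c [c0 Nc] <-] cle].
have /choice[s hs] : forall k, exists s : 'rV[R]_1, forall t r, M t ->
    box (c k).1 (c k).2 r -> P t r -> exists2 r0, box (c k).1 (c k).2 r0 & P s r0.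
  move=> k; have [[t [r [tr rc]]]|no] := pselect (exists t r, P t r /\ box (c k).1 (c k).2 r).
    by exists t => *; exists r.
  by exists 0 => t r _ rc tr; exfalso; apply: no; exists t, r.
pose l k := (c k).2 0 0 - (c k).1 0 0.
have l0 k : 0 <= l k by rewrite subr_ge0.
pose d (k : nat) : 'rV[R]_1 * 'rV[R]_1 :=
  (const_mx (s k 0 0 - C * l k), const_mx (s k 0 0 + C * l k)).
have dM : box_cover M d.
  split=> [k i|t Mt].
    by rewrite /d/= !mxE; have := mulr_ge0 (ltW C0) (l0 k); lra.
  have [r Nr tr] := MN _ Mt; have [k _ rk] := Nc _ Nr.
  exists k => // i; rewrite ord1 /d/= !mxE.
  have [r0 r0k sr0] := hs k _ _ Mt rk tr.
  have := lip _ _ _ _ tr sr0.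
  have : `|r 0 0 - r0 0 0| < l k.
    have := rk 0; have := r0k 0; rewrite /l ltr_norml; lra.
  rewrite -(ltr_pM2l C0) => h1 h2; have := le_lt_trans h2 h1.
  by rewrite ltr_norml => /andP[h3 h4]; apply/andP; split; lra.
apply: (@le_trans _ _ (\sum_(k <oo) (\prod_(i < 1) ((d k).2 0 i - (d k).1 0 i))%:E)%E).
  by apply: ereal_inf_lbound; exists d.
rewrite (eq_eseriesr (g := fun k => ((C * 2)%:E * (\prod_(i < 1) ((c k).2 0 i - (c k).1 0 i))%:E)%E)); last first.
  by move=> k _; rewrite -EFinM !big_ord1 /d/= !mxE -/(l k); congr (_%:E); ring.
rewrite nneseriesZl; last by move=> k _; rewrite lee_fin big_ord1; exact: l0.
by rewrite -lee_pdivlMl// -EFinM ltW// mulrC.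
Qed.

Lemma fubini_null d1 d2 (T1 : measurableType d1) (T2 : measurableType d2) (R : realType)
    (m1 : {sigma_finite_measure set T1 -> \bar R}) (m2 : {sigma_finite_measure set T2 -> \bar R})
    (E : set (T1 * T2)) :
  measurable E -> (forall y, m1 [set x | E (x, y)] = 0%E) ->
  exists N, [/\ measurable N, m1 N = 0%E & forall x, ~ N x -> m2 [set y | E (x, y)] = 0%E].
Proof.
move=> mE E0.
have mx := measurable_fun_xsection m2 mE.
have xE x : (m2 \o xsection E) x = m2 [set y | E (x, y)].
  by rewrite /= /xsection; congr (m2 _); apply/seteqP; split=> y; rewrite /= in_setE.
have {xE}mx : measurable_fun setT (fun x => m2 [set y | E (x, y)]).
  by rewrite (_ : (fun x => _) = m2 \o xsection E)//; apply/funext => x; rewrite xE.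
have : (\int[m1]_x `|m2 [set y | E (x, y)]| = 0)%E.
  under eq_integral do rewrite gee0_abs//.
  by rewrite fubini_set//; under eq_integral do rewrite E0; rewrite integral0.
move=> /(ae_eq_integral_abs m1 measurableT mx)[N [mN N0 h]].
exists N; split=> // x nNx; apply: contrapT => ne; apply: nNx; apply: h => /=.
by move/(_ I).
Qed.

Section Orthogonal.
Variables (R : realType) (n : nat).
Local Notation V := (eucl R n).
Local Notation Rn := 'rV[R]_n.+1.

Lemma orth_unit k (a : 'I_k -> Rn) : (k <= n)%N ->
  exists e : Rn, inner e e = 1 /\ forall i, inner (a i) e = 0.
Proof.
move=> kn; pose A : 'M[R]_(n.+1, k) := \matrix_(i, j) a j 0 i.
have : kermx A != 0.
  rewrite kermx_eq0 /row_free; apply/eqP => h.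
  by have := rank_leq_col A; rewrite h ltnNge kn.
move=> /rowV0Pn[v /sub_kermxP vA v0]; exists (dir v); split; first exact: inner_dir.
move=> j; rewrite /dir innerZr.
have := congr1 (fun B => fun_of_matrix B 0 j) vA.
rewrite !mxE => h; have -> : inner (a j) v = 0.
  by rewrite -[RHS]h; apply: eq_bigr => i _; rewrite mxE mulrC.
by rewrite mulr0.
Qed.

Lemma inner_le1 (x y : Rn) : inner x x = 1 -> inner y y = 1 -> inner x y ^+ 2 <= 1.
Proof.
move=> x1 y1; have := inner_ge0 (x - inner x y *: y).
rewrite !(innerDl, innerDr, innerNl, innerNr, innerZl, innerZr) x1 y1 [inner y x]innerC.
by rewrite expr2; lra.
Qed.

Variable sigma : {finite_measure set V -> \bar R}.
Hypothesis sigmaE : forall A, sigma A = leb ((@dir R n : V -> V) @^-1` A `&` @pball R n).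

(* The cone over the null slice is null, hence so are almost all of its traces
   on the lines parallel to [x0]. *)
Lemma sphere_slice_null (x0 : Rn) (Z : set R) : (0 < n)%N -> inner x0 x0 = 1 ->
  measurable Z -> sigma [set z | Z (inner x0 z)] = 0%E ->
  exists a q : R, 0 < q /\
    lebesgue_outer [set r : 'rV[R]_1 | Z ((r 0 0 + a) / Num.sqrt ((r 0 0 + a) ^+ 2 + q))] = 0%E.
Proof.
move=> n0 x01 mZ; rewrite sigmaE => Z0.
pose D : set V := [set p : V | inner p p != 0 /\ Z (inner x0 (dir (p : Rn)))].
have mD : measurable D.
  have -> : D = ~` ((fun p : V => inner p p) @^-1` [set 0]) `&`
      ((fun p : V => inner x0 (dir (p : Rn))) @^-1` Z).
    by apply/seteqP; split=> p [/eqP].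
  apply: measurableI.
    apply: measurableC; rewrite -[X in measurable X]setTI.
    by apply: measurable_inner => //; exact: measurable_id.
  rewrite -[X in measurable X]setTI.
  suff : measurable_fun setT (fun p : V => inner x0 (dir (p : Rn))) by apply.
  by apply: measurable_inner; [exact: measurable_cst|exact: measurable_dir].
have D0 : leb D = 0%E.
  apply/eqP; rewrite eq_le leb_ge0 andbT.
  (* [D] is a cone, so dividing by k+1 carries each of its points into the ball for large k; [D] is
     covered by countably many dilates of one null set. *)
  pose F k : set Rn := [set p : Rn | (D `&` @pball R n) ((k.+1%:R^-1 : R) *: p)].
  have k0 k : (0 : R) < k.+1%:R^-1 by rewrite invr_gt0 ltr0n.
  have F0 k : lebesgue_outer (F k) = 0%E.
    rewrite /F; apply: lebesgue_outer_scale0 => //.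
    apply/eqP; rewrite eq_le lebesgue_outer_ge0 andbT -Z0.
    by apply: (le_outer_measure (@lebesgue_outer R n.+1)) => p [[]].
  have DF : D `<=` \bigcup_k F k.
    move=> p [p0 Zp]; exists (Num.truncn (inner p p)) => //; split.
      split; last by rewrite dirZ.
      by rewrite innerZl innerZr !mulf_eq0 !negb_or p0 !gt_eqF.
    rewrite /pball/= innerZl innerZr; set k := Num.truncn _.
    have p1 : inner p p < k.+1%:R by exact: Num.Theory.truncnS_gt.
    have pp : 0 < inner p p by rewrite lt_def p0 inner_ge0.
    rewrite !mulr_gt0//= mulrA -invfM mulrC ltr_pdivrMr ?mulr_gt0// ?ltr0n// mul1r.
    by apply: (lt_le_trans p1); rewrite ler_peMr// ler1n.
  apply: (le_trans (lebesgue_outer_subadditive DF)).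
  by under eq_eseriesr do rewrite F0; rewrite eseries0.
pose E : set (V * eucl R 0) := [set z | D ((z.1 : Rn) + ((z.2 : 'rV[R]_1) 0 0) *: x0)].
have mE : measurable E.
  rewrite -[X in measurable X]setTI.
  have mf : measurable_fun setT ((fun z => (z.1 : Rn) + ((z.2 : 'rV[R]_1) 0 0) *: x0) : V * eucl R 0 -> V).
    apply: measurable_pair_eucl_add; first exact: measurable_fst.
    apply: measurable_scale; last exact: measurable_cst.
    exact: (measurableT_comp (@measurable_coord R 0 0) measurable_snd).
  exact: mf.
have [N [mN N0 NE]] := @fubini_null _ _ _ _ R (@leb R n) (@leb R 0) E mE
  (fun y => etrans (leb_translate D ((y : 'rV[R]_1) 0 0 *: x0)) D0).
(* A line parallel to [x0] is needed that avoids the origin and does not meet the exceptional set at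
   its base point z. Points near a unit vector orthogonal to [x0] lie off the axis and form a set of
   positive measure. Then [a] is the height of z along [x0] and [q] its squared distance to the
   axis. *)
have [e [e1 e0]] := orth_unit (fun _ : 'I_1 => x0) n0.
have near : nbhs (e : Rn) [set z : Rn | 0 < inner z z - inner x0 z ^+ 2].
  have c1 : cvgv (nbhs e) id e by move=> j; exact: coord_continuous.
  have c2 : cvgv (nbhs e) (fun=> x0) x0 by move=> j; exact: cvg_cst.
  have := cvgv_inner c1 c1; have := cvgv_inner c2 c1 => /(_ _) h1 /(_ _) h2.
  have h3 : (inner z z - inner x0 z ^+ 2) @[z --> e] --> (inner e e - inner x0 e ^+ 2).
    have FF : Filter (nbhs (e : Rn)) by exact: nbhs_filter.
    exact: (@cvgB _ _ _ _ FF _ _ _ _ h2 (cvgM h1 h1)).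
  by apply: (cvgr_gt _ h3); rewrite e1 (e0 ord0) expr2 mulr0 subr0 ltr01.
have [z [nz zW]] : exists z : Rn, ~ N z /\ 0 < inner z z - inner x0 z ^+ 2.
  apply: contrapT => no; have := leb_nbhs_gt0 near; apply/negP; rewrite -leNgt -N0.
  apply: (le_outer_measure (@lebesgue_outer R n.+1)) => z zW; apply: contrapT => nNz.
  by apply: no; exists z.
exists (inner x0 z), (inner z z - inner x0 z ^+ 2); split=> //.
rewrite -[RHS](NE z nz); congr lebesgue_outer; apply/seteqP.
have eqr (r : R) : inner (z + r *: x0) (z + r *: x0) =
    (r + inner x0 z) ^+ 2 + (inner z z - inner x0 z ^+ 2).
  by rewrite !(innerDl, innerDr, innerZl, innerZr) x01 [inner z x0]innerC; ring.
have dE (r : R) : inner x0 (dir (z + r *: x0)) =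
    (r + inner x0 z) / Num.sqrt ((r + inner x0 z) ^+ 2 + (inner z z - inner x0 z ^+ 2)).
  by rewrite /dir innerZr eqr innerDr innerZr x01 mulr1 mulrC addrC.
split=> r /= => [h|[_] /=]; last by rewrite dE.
by split=> /=; [rewrite eqr gt_eqF// ltr_wpDl// sqr_ge0|rewrite dE].
Qed.

End Orthogonal.

(** * Lipschitz estimates for inner products along a line and along a circle *)

Section OneVariable.
Variable R : realType.
Implicit Types q x y c s u v d : R.

(** The cosine of the angle between an axis and a point at height x and squared distance q from that
    axis. *)
Definition angle q x : R := x / Num.sqrt (x ^+ 2 + q).

Lemma angle_lipschitz q x y : 0 < q ->
  `|angle q x - angle q y| <= 2 / Num.sqrt q * `|x - y|.
Proof.
move=> q0; rewrite /angle.
set A := Num.sqrt (x ^+ 2 + q); set B := Num.sqrt (y ^+ 2 + q).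
have xq0 (z : R) : 0 < z ^+ 2 + q by rewrite ltr_wpDl// sqr_ge0.
have A0 : 0 < A by rewrite sqrtr_gt0.
have B0 : 0 < B by rewrite sqrtr_gt0.
have sq0 : 0 < Num.sqrt q by rewrite sqrtr_gt0.
have A2 : A ^+ 2 = x ^+ 2 + q by rewrite sqr_sqrtr// ltW.
have B2 : B ^+ 2 = y ^+ 2 + q by rewrite sqr_sqrtr// ltW.
have qA : Num.sqrt q <= A by rewrite ler_wsqrtr// lerDr sqr_ge0.
have norm_le (z C : R) : 0 < C -> C ^+ 2 = z ^+ 2 + q -> `|z| <= C.
  move=> C0 C2; rewrite -(ger0_norm (ltW C0)) -ler_sqr ?nnegrE// !real_normK ?num_real//.
  by rewrite C2 lerDl ltW.
have xA := norm_le x A A0 A2; have yB := norm_le y B B0 B2.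
have AB : `|B - A| <= `|x - y|.
  rewrite -(ler_pM2r (addr_gt0 A0 B0)).
  rewrite -{1}(gtr0_norm (addr_gt0 A0 B0)) -normrM.
  have -> : (B - A) * (A + B) = (y - x) * (x + y).
    by transitivity (B ^+ 2 - A ^+ 2); [ring|rewrite A2 B2; ring].
  rewrite normrM distrC ler_wpM2l//.
  by apply: (le_trans (ler_normD _ _)); apply: lerD.
have -> : x / A - y / B = ((x - y) + y / B * (B - A)) / A.
  by field; rewrite !gt_eqF.
rewrite normrM normfV (gtr0_norm A0).
have h : `|x - y + y / B * (B - A)| <= 2 * `|x - y|.
  apply: (le_trans (ler_normD _ _)); rewrite mulr2n mulrDl mul1r lerD2l.
  rewrite normrM normrM normfV (gtr0_norm B0) -[leRHS]mul1r.
  by apply: ler_pM => //; [rewrite divr_ge0// ltW|rewrite ler_pdivrMr// mul1r].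
rewrite [leRHS]mulrAC; apply: ler_pM => //; first by rewrite invr_ge0 ltW.
by rewrite lef_pV2 ?posrE.
Qed.

Lemma angle_surj q u : 0 < q -> -1 < u < 1 -> exists x, angle q x = u.
Proof.
move=> q0 /andP[u1 u2].
have h : 0 < 1 - u ^+ 2.
  by rewrite (_ : 1 - u ^+ 2 = (1 - u) * (u - -1)); [rewrite mulr_gt0// subr_gt0|ring].
pose S := Num.sqrt (1 - u ^+ 2); pose Q := Num.sqrt q.
have S0 : 0 < S by rewrite sqrtr_gt0.
have Q0 : 0 < Q by rewrite sqrtr_gt0.
have S2 : S ^+ 2 = 1 - u ^+ 2 by rewrite sqr_sqrtr// ltW.
have Q2 : Q ^+ 2 = q by rewrite sqr_sqrtr// ltW.
exists (Q * u / S); rewrite /angle.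
have -> : (Q * u / S) ^+ 2 + q = (Q / S) ^+ 2.
  rewrite !expr_div_n exprMn Q2 S2; field; rewrite gt_eqF//.
rewrite sqrtr_sqr gtr0_norm ?divr_gt0//.
by field; rewrite !gt_eqF.
Qed.

(** The inner product of two points of a circle of radius c on the unit sphere, at rational
    parameters s and v: one minus half the squared distance. *)
Definition chord c v s : R := 1 - 2 * c ^+ 2 * ((s - v) ^+ 2 / ((1 + s ^+ 2) * (1 + v ^+ 2))).

Lemma chord_bound c v s : 0 < c -> c ^+ 2 <= 1 -> 0 <= s -> 0 <= v -> s != v ->
  -1 < chord c v s < 1.
Proof.
move=> c0 c1 s0 v0 sv; rewrite /chord; set h := (_ / _).
have pos (z : R) : 0 < 1 + z ^+ 2 by have := sqr_ge0 z; lra.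
have h0 : 0 < h.
  by apply: divr_gt0; [rewrite exprn_even_gt0// subr_eq0|exact: mulr_gt0].
have c20 : 0 < c ^+ 2 by rewrite exprn_gt0.
have h1 : h < 1.
  rewrite ltr_pdivrMr ?mulr_gt0// mul1r -subr_gt0.
  rewrite (_ : _ - _ = (1 + s * v) ^+ 2); last by ring.
  by rewrite exprn_gt0// ltr_pwDl// mulr_ge0.
have := mulr_gt0 c20 h0.
have : c ^+ 2 * h < 1 by apply: le_lt_trans h1; rewrite ler_piMl// ltW.
by rewrite -mulrA => *; apply/andP; split; lra.
Qed.

(** The difference of the two values is, up to sign, 2 c^2 (s - u) Q / D. On one side of v, selected
    by the sign [eps], both terms of Q have the same sign and |Q| >= 2d, while D <= 8 on the unit
    interval. *)
Lemma chord_expand (eps c v d s u : R) : 0 < c -> 0 < d -> `|eps| = 1 ->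
  0 <= s <= 1 -> 0 <= u <= 1 -> 0 <= v <= 1 -> d <= eps * (s - v) -> d <= eps * (u - v) ->
  `|s - u| <= 2 / (c ^+ 2 * d) * `|chord c v s - chord c v u|.
Proof.
move=> c0 d0 eps1 /andP[s0 s1] /andP[u0 u1] /andP[v0 v1] ds du.
have pos (z : R) : 0 < 1 + z ^+ 2 by have := sqr_ge0 z; lra.
have c20 : 0 < c ^+ 2 by rewrite exprn_gt0.
have le2 (z : R) : 0 <= z -> z <= 1 -> 1 + z ^+ 2 <= 2.
  by move=> z0 z1; have := @exprn_ile1 _ 2 z z0 z1; lra.
pose Q := (s - v) * (1 + v * u) + (u - v) * (1 + v * s).
have E : chord c v s - chord c v u =
    - (2 * c ^+ 2 * ((s - u) * Q / ((1 + s ^+ 2) * (1 + u ^+ 2) * (1 + v ^+ 2)))).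
  have := lt0r_neq0 (pos s); have := lt0r_neq0 (pos u); have := lt0r_neq0 (pos v).
  rewrite /chord /Q => h1 h2 h3; field; apply/and3P; split=> //.
have Q2 : 2 * d <= `|Q|.
  have le (z y : R) : 0 <= z -> d <= y -> d <= y * (1 + z).
    by move=> z0 dy; apply: (le_trans dy); rewrite ler_peMr ?lerDl// (le_trans (ltW d0)).
  have : 2 * d <= eps * Q.
    rewrite /Q mulrDr !mulrA; have := le _ _ (mulr_ge0 v0 u0) ds.
    by have := le _ _ (mulr_ge0 v0 s0) du; lra.
  by move=> h; apply: (le_trans h); rewrite -[leRHS]mul1r -eps1 -normrM ler_norm.
set D := (1 + s ^+ 2) * (1 + u ^+ 2) * (1 + v ^+ 2) in E.
have D0 : 0 < D by rewrite !mulr_gt0.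
have D8 : D <= 8.
  rewrite (_ : 8 = 2 * 2 * 2); last by rewrite -!natrM.
  by rewrite ler_pM ?le2// ?mulr_ge0// ?ler_pM ?le2// ltW.
rewrite E normrN normrM (gtr0_norm (mulr_gt0 _ c20))// normrM normrM normfV (gtr0_norm D0).
rewrite (_ : 2 / _ * _ = `|s - u| * (4 * `|Q| / (d * D))); last first.
  by have := lt0r_neq0 D0; move: (D) => D' D1; field; rewrite D1 !gt_eqF.
rewrite ler_peMr// ler_pdivlMr ?mulr_gt0// mul1r.
by have := ler_wpM2l (ltW d0) D8; lra.
Qed.

(* Away from [s = v] the chord has an inverse Lipschitz bound, while [angle] is
   Lipschitz: the null set is transported between the two parametrisations. *)
Lemma chord_null (c v a q : R) (Z : set R) : 0 < c -> c ^+ 2 <= 1 -> 0 <= v <= 1 -> 0 < q ->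
  lebesgue_outer [set r : 'rV[R]_1 | Z (angle q (r 0 0 + a))] = 0%E ->
  lebesgue_outer [set s : 'rV[R]_1 | 0 <= s 0 0 <= 1 /\ Z (chord c v (s 0 0))] = 0%E.
Proof.
move=> c0 c1 v01 q0 N0.
set M := [set s : 'rV[R]_1 | 0 <= s 0 0 <= 1 /\ Z (chord c v (s 0 0))].
have cd0 (d : R) : 0 < d -> 0 < 2 / (c ^+ 2 * d).
  by move=> d0; rewrite divr_gt0// mulr_gt0// exprn_gt0.
have piece0 (eps d : R) : `|eps| = 1 -> 0 < d ->
    lebesgue_outer (M `&` [set s | d <= eps * (s 0 0 - v)]) = 0%E.
  move=> eps1 d0.
  have Sq : 0 < 2 / Num.sqrt q by rewrite divr_gt0// sqrtr_gt0.
  pose C := 2 / (c ^+ 2 * d) * (2 / Num.sqrt q).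
  pose P (s r : 'rV[R]_1) := (0 <= s 0 0 <= 1 /\ d <= eps * (s 0 0 - v)) /\
        chord c v (s 0 0) = angle q (r 0 0 + a).
  apply: (lipschitz_null (C := C) (P := P) _ N0); rewrite /P ?/C.
  - by rewrite mulr_gt0// cd0.
  - move=> s [[s01 Zs] /= sd].
    have sv : s 0 0 != v.
      by apply/eqP => sv; move: sd; rewrite sv subrr mulr0 leNgt d0.
    have [x xs] := angle_surj q0 (chord_bound c0 c1 (andP s01).1 (andP v01).1 sv).
    exists (const_mx (x - a)) => /=; first by rewrite mxE subrK xs.
    by rewrite mxE subrK.
  - move=> s r s' r' [[s01 sd] sr] [[s01' sd'] sr'].
    apply: (le_trans (chord_expand c0 d0 eps1 s01 s01' v01 sd sd')).
    rewrite /C -[leRHS]mulrA ler_wpM2l ?(ltW (cd0 _ d0))// sr sr'.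
    apply: (le_trans (angle_lipschitz _ _ q0)).
    by rewrite opprD addrACA subrr addr0.
(* Index 0 is the single point s = v, where the expansion degenerates; index k > 0 takes the
   parameters at distance at least 1/k on either side. *)
pose F (k : nat) : set 'rV[R]_1 := if k == 0%N then [set const_mx v] else
  (M `&` [set s | k%:R^-1 <= 1 * (s 0 0 - v)]) `|` (M `&` [set s | k%:R^-1 <= -1 * (s 0 0 - v)]).
have F0 k : lebesgue_outer (F k) = 0%E.
  case: k => [|k]; first exact: (@leb_set1 R 0).
  apply/eqP; rewrite eq_le lebesgue_outer_ge0 andbT /F /=.
  apply: (le_trans (outer_measureU2 (@lebesgue_outer R 1) _ _)).
  have k0 : 0 < k.+1%:R^-1 :> R by rewrite invr_gt0 ltr0n.
  rewrite [X in (X + _)%E](piece0 1 _ (normr1 _) k0) add0e.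
  by rewrite [leLHS](piece0 (-1) _ (normrN1 _) k0).
have MF : M `<=` \bigcup_k F k.
  move=> s Ms; have [sv|sv] := eqVneq (s 0 0) v.
    by exists 0%N => //; apply/rowP => i; rewrite ord1 mxE.
  have sv0 : 0 < `|s 0 0 - v| by rewrite normr_gt0 subr_eq0.
  pose k := Num.truncn (`|s 0 0 - v|^-1); exists k.+1 => //.
  have kv : k.+1%:R^-1 <= `|s 0 0 - v|.
    by rewrite invf_ple ?posrE ?ltr0n// ltW// Num.Theory.truncnS_gt.
  have [h|h] := leP 0 (s 0 0 - v); [left|right]; split=> //=.
    by rewrite mul1r -(ger0_norm h).
  by rewrite mulN1r -(ltr0_norm h).
apply/eqP; rewrite eq_le lebesgue_outer_ge0 andbT.
apply: (le_trans (lebesgue_outer_subadditive MF)).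
by under eq_eseriesr do rewrite F0; rewrite eseries0.
Qed.

End OneVariable.

(** [Lam] is the law of [phi] under the product measure. By Fubini a set is null for it as soon as
    its sections are null for almost every second coordinate. *)
Lemma iterated_law_ex d1 d2 d (T1 : measurableType d1) (T2 : measurableType d2)
    (U : measurableType d) (R : realType) (m1 : {finite_measure set T1 -> \bar R})
    (m2 : {finite_measure set T2 -> \bar R}) (phi : T1 * T2 -> U) :
  measurable_fun setT phi -> exists Lam : {finite_measure set U -> \bar R},
    (forall f : U -> R, bdfun f ->
      \int[m1]_x \int[m2]_y f (phi (x, y)) = \int[Lam]_r f r) /\
    (forall Z D, measurable Z -> measurable D -> m2 (~` D) = 0%E ->
      (forall y, D y -> m1 [set x | Z (phi (x, y))] = 0%E) -> Lam Z = 0%E).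
Proof.
move=> mphi.
pose pr0 : {measure set (T1 * T2) -> \bar R} := (m1 \x m2)%E.
have mfin : fin_num_fun pr0.
  move=> A mA; rewrite ge0_fin_numE ?measure_ge0//.
  apply: (@le_lt_trans _ _ (pr0 (setT `*` setT))).
    by apply: le_measure; rewrite ?inE//; exact: measurableX.
  by rewrite [ltLHS]product_measure1E// -ge0_fin_numE ?mule_ge0// fin_numM// fin_num_measure.
pose mf := Measure_isFinite.Build _ _ _ pr0 mfin.
pose pr : {finite_measure set (T1 * T2)%type -> \bar R} := HB.pack (Measure.sort pr0) mf.
have [Lam LamE] := image_measure_ex pr mphi.
exists Lam; split.
  move=> f bf; rewrite (Rintegral_image mphi (fun A _ => LamE A) bf).
  have bff : bdfun (f \o phi) by exact: bdfun_comp bf mphi.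
  rewrite /Rintegral; congr fine.
  rewrite -(integral12_prod_meas1 (bdfun_integrable_prod m1 m2 bff)).
  apply: eq_integral => x _; rewrite /= fineK//; apply: integrable_fin_num => //.
  exact: bdfun_integrable (bdfun_section1 bff x).
move=> Z D mZ mD D0 Z0; rewrite LamE.
have mpre : measurable (phi @^-1` Z) by rewrite -[X in measurable X]setTI; exact: mphi.
have -> : pr (phi @^-1` Z) = (\int[m1]_x m2 [set y | Z (phi (x, y))])%E.
  apply: eq_integral => x _ /=; congr (m2 _); rewrite /xsection.
  by apply/seteqP; split=> y; rewrite /= in_setE.
rewrite (@fubini_set _ _ _ _ _ m1 m2 _ mpre).
have my : measurable_fun setT (fun y => m1 [set x | Z (phi (x, y))]).
  have := measurable_fun_ysection m1 mpre; congr measurable_fun; apply/funext => y /=.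
  by congr (m1 _); rewrite /ysection; apply/seteqP; split=> x; rewrite /= in_setE.
have mDC : measurable (~` D) by exact: measurableC.
rewrite -(setUv D) ge0_integral_setU//=; last 2 first.
  by rewrite setUv.
  by rewrite disj_set2E setICr.
rewrite (eq_integral (fun=> 0%E)) ?integral0 ?add0e => [|y]; last by rewrite inE => /Z0.
by rewrite null_set_integral//; exact: measurable_funS my.
Qed.

(** * Decay of mean products at inner products strictly between -1 and 1 *)

Section HaarCompactness.
Variables (R : realType) (n : nat).
Local Notation V := (eucl R n).
Local Notation Rn := 'rV[R]_n.+1.
Local Notation N := (n.+1 * n.+1).-1.
Local Notation Om := (eucl R N).
Variable sigma : {finite_measure set V -> \bar R}.
Hypothesis sigmaE : forall A, sigma A = leb ((@dir R n : V -> V) @^-1` A `&` @pball R n).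
Hypothesis n2 : (2 <= n)%N.
Variables (x0 y0 : Rn).
Hypotheses (x01 : inner x0 x0 = 1) (y01 : inner y0 y0 = 1) (xy1 : inner x0 y0 ^+ 2 < 1).

(** For a unit vector [e] orthogonal to [x0], the point of the sphere on the great circle through
    [x0] and [e] at inner product r with [x0]. *)
Definition polar_point (e : Rn) (r : R) : V := r *: x0 + Num.sqrt (1 - r ^+ 2) *: e.

Lemma measurable_polar_point e : measurable_fun setT (polar_point e).
Proof.
apply: measurable_pair_eucl_add; apply: measurable_scale => //.
have msqrt : measurable_fun setT (Num.sqrt : R -> R).
  by apply: continuous_measurable_fun; exact: sqrt_continuous.
apply: (measurableT_comp msqrt); apply: measurable_funB; first exact: measurable_cst.
exact: measurable_funX.
Qed.

Lemma polar_pointP e r : inner e e = 1 -> inner x0 e = 0 -> r ^+ 2 <= 1 ->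
  inner (polar_point e r) (polar_point e r) = 1 /\ inner x0 (polar_point e r) = r.
Proof.
move=> e1 e0 r1; rewrite /polar_point; set S := Num.sqrt _.
have S2 : S ^+ 2 = 1 - r ^+ 2 by rewrite sqr_sqrtr// subr_ge0.
rewrite !(innerDl, innerDr, innerZl, innerZr) x01 e1 e0 [inner e x0]innerC e0.
by split; rewrite ?mulr1 ?mulr0 ?addr0 ?add0r// -!expr2 S2 addrC subrK.
Qed.

Let t := inner x0 y0.
Let c := Num.sqrt (1 - t ^+ 2).
Let c2 : c ^+ 2 = 1 - t ^+ 2. Proof. by rewrite sqr_sqrtr// subr_ge0 ltW. Qed.

(* The rational parametrisation of the circle of unit vectors having inner
   product [t] with [y0]. *)
Definition circle_point (e1 e2 : Rn) (s : 'rV[R]_1) : V :=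
  t *: y0 + ((c * (1 - s 0 0 ^+ 2) / (1 + s 0 0 ^+ 2)) *: e1 +
             (c * (2 * s 0 0) / (1 + s 0 0 ^+ 2)) *: e2).

Lemma measurable_circle_point e1 e2 : measurable_fun setT (circle_point e1 e2 : eucl R 0 -> V).
Proof.
have ms : measurable_fun setT (fun s : eucl R 0 => (s : 'rV[R]_1) 0 0) by exact: measurable_coord.
have ms2 : measurable_fun setT (fun s : eucl R 0 => (s : 'rV[R]_1) 0 0 ^+ 2).
  exact: (measurableT_comp (exprn_measurable 2) ms).
have mi : measurable_fun setT (fun s : eucl R 0 => (1 + (s : 'rV[R]_1) 0 0 ^+ 2)^-1).
  by apply: measurable_invr; apply: measurable_funD => //; exact: measurable_cst.
apply: measurable_pair_eucl_add; first exact: measurable_cst.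
apply: measurable_pair_eucl_add; apply: measurable_scale; try exact: measurable_cst.
  apply: measurable_funM => //; apply: measurable_funM; first exact: measurable_cst.
  by apply: measurable_funB => //; exact: measurable_cst.
apply: measurable_funM => //; apply: measurable_funM; first exact: measurable_cst.
by apply: measurable_funM => //; exact: measurable_cst.
Qed.

Lemma inner_circle_point e1 e2 s s' : inner e1 e1 = 1 -> inner e2 e2 = 1 ->
  inner e1 e2 = 0 -> inner y0 e1 = 0 -> inner y0 e2 = 0 ->
  inner (circle_point e1 e2 s) (circle_point e1 e2 s') = chord c (s' 0 0) (s 0 0).
Proof.
move=> e11 e22 e12 ye1 ye2; rewrite /circle_point.
rewrite !(innerDl, innerDr, innerZl, innerZr) y01 e11 e22 e12 [inner e2 e1]innerC e12.
rewrite [inner e1 y0]innerC [inner e2 y0]innerC ye1 ye2 !mulr0 !addr0 !add0r mulr1.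
have pos (z : R) : 1 + z ^+ 2 != 0 by apply: lt0r_neq0; have := sqr_ge0 z; lra.
have t2 : t * t = 1 - c ^+ 2 by rewrite c2 -expr2; ring.
rewrite t2 /chord; move: (pos (s 0 0)) (pos (s' 0 0)); move: (s 0 0) (s' 0 0) => a b a0 b0.
by field; rewrite a0 b0.
Qed.

(** The ambient dimension is n+1 >= 3, which leaves room for [e'] and [e''] orthonormal and
    orthogonal to [y0]; they span the plane of the circle, whose radius is positive by [xy1].
    Parameters uniform in [0, 1] trace a quarter of the circle, on which the inner product with a
    fixed point already has an absolutely continuous law. *)
Lemma haar_bilinear_cvg0 (u v : nat -> V -> R) :
  (forall k, measurable_fun setT (u k)) -> (forall k, measurable_fun setT (v k)) ->
  (forall k x, `|u k x| <= 1) -> (forall k x, `|v k x| <= 1) ->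
  (forall h : V -> R, bdfun h -> (\int[sigma]_x (u k x * h x)) @[k --> \oo] --> 0) ->
  (\int[@haar R n]_M (u k (act M x0) * v k (act M y0))) @[k --> \oo] --> 0.
Proof.
move=> mu_ mv_ u1 v1 u_weak.
have n1 : (1 <= n)%N by exact: ltnW.
have [e [e1 /(_ ord0) e0]] := orth_unit (fun _ : 'I_1 => x0) n1.
have [e' [e'1 /(_ ord0) e'0]] := orth_unit (fun _ : 'I_1 => y0) n1.
have [e'' [e''1 e''0]] := orth_unit (fun i : 'I_2 => if i == ord0 then y0 else e') n2.
have e''y := e''0 ord0; have e''e := e''0 (lift ord0 ord0); rewrite /= in e''y e''e.
pose I01 : set (eucl R 0) := box (0 : 'rV[R]_1) (const_mx 1).
have mI : measurable I01 by exact: measurable_box.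
have I1 : leb I01 = 1%E.
  by rewrite [LHS]leb_box => [|i]; rewrite ?mxE// /box_vol big_ord1/= !mxE subr0.
have Ifin : (leb I01 < +oo)%E by rewrite I1 ltry.
pose tau := mfrestr mI Ifin.
have wE s s' := inner_circle_point s s' e'1 e''1 e''e e'0 e''y.
have mw := measurable_circle_point e' e''.
have mphi : measurable_fun setT (fun z : eucl R 0 * eucl R 0 =>
    inner (circle_point e' e'' z.1) (circle_point e' e'' z.2)).
  by apply: measurable_inner; [exact: (measurableT_comp mw measurable_fst)|
    exact: (measurableT_comp mw measurable_snd)].
have [Lam [LamE Lam0]] := iterated_law_ex tau tau mphi.
apply: (@bilinear_cvg0 R _ V _ Om _ (eucl R 0) (fun x y : V => inner (x : Rn) y) (@act R n)
  (@unit_sphere R n.+1) sigma (@haar R n) tau _ _ _ _ _ _ _ _ x0 y0 _ _ (polar_point e) _ _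
  (circle_point e' e'') _ _ _ Lam) => //.
- by rewrite -I1 -[in RHS](setTI I01).
- by apply: measurable_inner; [exact: measurable_fst|exact: measurable_snd].
- exact: measurable_act.
- exact: inner_act.
- move=> M A mA; have [S MS] := act_surj M.
  apply: (cone_measure_isom sigmaE (T := act M) (S := S)) => //.
  + exact: actD.
  + exact: actZ.
  + by move=> x; exact: inner_act.
  + exact: measurable_act1.
- exact: measurable_sphere.
- exact: cone_measure_sphere.
- move=> x y x' y' Sx Sy Sx' Sy' xy f g bf bg.
  by apply: haar_pair => //; [rewrite Sx Sx'|rewrite Sy Sy'].
- exact: measurable_polar_point.
- by move=> a b Sa Sb; apply: polar_pointP => //; exact: inner_le1.
- by move=> s; rewrite /unit_sphere/= wE /chord subrr expr0n/= mul0r mulr0 subr0.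
- move=> s; rewrite /circle_point !(innerDl, innerZl) y01 [inner e' y0]innerC e'0.
  by rewrite [inner e'' y0]innerC e''y !mulr0 !addr0 mulr1.
- move=> Z mZ Z0.
  have [a [q [q0 aq0]]] := sphere_slice_null sigmaE n1 x01 mZ Z0.
  apply: (Lam0 Z I01 mZ mI).
    by rewrite -(@measure0 _ _ _ (@leb R 0)) -(setICl I01).
  move=> s' Is'; have s'01 : 0 <= s' 0 0 <= 1.
    by have /andP[h1 h2] := Is' 0; move: h1 h2; rewrite !mxE => /ltW -> ->.
  have c0 : 0 < c by rewrite sqrtr_gt0 subr_gt0.
  have c1 : c ^+ 2 <= 1 by rewrite c2 gerBl sqr_ge0.
  have := chord_null c0 c1 s'01 q0 aq0 => null.
  apply/eqP; rewrite eq_le measure_ge0 andbT -null.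
  apply: (le_outer_measure (@lebesgue_outer R 1)) => s [/= Zs Is]; split.
    by have /andP[h1 h2] := Is 0; move: h1 h2; rewrite !mxE => /ltW -> ->.
  by move: Zs; rewrite wE.
Qed.

End HaarCompactness.

(** * Inner regularity of the surface measure *)

Section InnerRegularity.
Variables (R : realType) (n : nat).
Local Notation V := (eucl R n).
Local Notation Rn := 'rV[R]_n.+1.
Variable sigma : {finite_measure set V -> \bar R}.
Hypothesis sigmaE : forall A, sigma A = leb ((@dir R n : V -> V) @^-1` A `&` @pball R n).

Lemma outer_sector (E : set Rn) : E `<=` @unit_sphere R n.+1 ->
  lebesgue_outer (sector E) = sigma E.
Proof. by move=> ES; rewrite sectorE// sigmaE. Qed.

Lemma borel_sphere_measurable (E : set V) : measurable E -> E `<=` @unit_sphere R n.+1 ->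
  sphere_measurable (E : set Rn).
Proof.
move=> mE ES; split=> //; rewrite sectorE//; apply: measurable_caratheodory.
apply: measurableI; last exact: measurable_pball.
by rewrite -[X in measurable X]setTI; exact: measurable_dir.
Qed.

(** These sets exhaust the punctured ball by compact sets that stay away from the origin, where
    [dir] is not continuous. *)
Definition annulus (k : nat) : set Rn := [set p | k.+1%:R^-1 <= inner p p <= 1 - k.+1%:R^-1].

Lemma continuous_inner_self : continuous (fun p : Rn => inner p p).
Proof.
move=> p; have c : cvgv (nbhs p) id p by move=> j; exact: coord_continuous.
by have /(_ _) := cvgv_inner c c; exact.
Qed.

Lemma closed_annulus k : closed (annulus k).
Proof.
rewrite (_ : annulus k = (fun p : Rn => inner p p) @^-1` `[k.+1%:R^-1, 1 - k.+1%:R^-1]%classic).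
  apply: preimage_closed; last exact: interval_closed.
  by move=> p _; exact: continuous_inner_self.
by apply/seteqP; split=> p /=; rewrite in_itv.
Qed.

Lemma annulus_bounded k : annulus k `<=` [set v : Rn | forall i, `[-1, 1]%classic (v ord0 i)].
Proof.
move=> p /andP[_ p1] i; rewrite /= in_itv/= -ler_norml.
have h : p 0 i ^+ 2 <= 1.
  apply: (@le_trans _ _ (inner p p)).
    by rewrite /inner (bigD1 i)//= -expr2 lerDl sumr_ge0// => j _; rewrite -expr2 sqr_ge0.
  by apply: (le_trans p1); rewrite gerBl invr_ge0.
by rewrite -ler_sqr ?nnegrE// real_normK ?num_real// expr1n.
Qed.

Lemma annulus_pball k : annulus k `<=` @pball R n.
Proof.
have k0 : (0 : R) < k.+1%:R^-1 by rewrite invr_gt0 ltr0n.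
move=> p /andP[h1 h2]; apply/andP; split; first exact: lt_le_trans h1.
by apply: (le_lt_trans h2); rewrite gtrBl.
Qed.

Lemma continuous_dir (p : Rn) : inner p p != 0 -> {for p, continuous (@dir R n)}.
Proof.
move=> p0; have FF : Filter (nbhs p) by exact: nbhs_filter.
have s0 : Num.sqrt (inner p p) != 0 by rewrite sqrtr_eq0 -ltNge lt_def p0 inner_ge0.
have h : Num.sqrt (inner q q) @[q --> p] --> Num.sqrt (inner p p).
  exact: (@continuous_cvg _ _ _ _ FF _ _ _ (@sqrt_continuous R _) (continuous_inner_self (x := p))).
exact: (@cvgZ _ _ _ _ FF _ _ _ _ (@cvgV _ _ _ FF _ _ s0 h) cvg_id).
Qed.

Lemma annulus_exhaust (e : R) : 0 < e -> exists k,
  (leb (@pball R n) <= leb (annulus k : set V) + e%:E)%E.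
Proof.
move=> e0; pose F k : set V := @pball R n `\` annulus k.
have mA k : measurable (annulus k : set V) by apply: measurable_closed; exact: closed_annulus.
have mB := @measurable_pball R n.
have mF k : measurable (F k) by exact: measurableD.
have Flty k : (leb (F k) < +oo)%E.
  apply: le_lt_trans (leb_pball_lty R n); apply: le_measure; rewrite ?inE//.
  by move=> p [].
have c : (@leb R n \o F) k @[k --> \oo] --> leb (\bigcap_k F k).
  apply: nonincreasing_cvg_mu => //; [exact: Flty|exact: bigcapT_measurable|].
  move=> k l kl; apply/subsetPset => p [pp nA]; split=> // /andP[h1 h2]; apply: nA.
  have : l.+1%:R^-1 <= k.+1%:R^-1 :> R by rewrite lef_pV2 ?posrE ?ltr0n// ler_nat.
  by move=> lk; apply/andP; split; [exact: le_trans h1|apply: (le_trans h2); rewrite lerB].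
have F0 : \bigcap_k F k = set0.
  apply/seteqP; split=> // p H; have [/andP[p0 p1] _] := H 0%N I.
  pose d := Num.min (inner p p) (1 - inner p p).
  have d0 : 0 < d by rewrite lt_min p0 subr_gt0.
  have [_ /=] := H (Num.truncn d^-1) I; apply.
  set k := Num.truncn _; have : k.+1%:R^-1 <= d.
    by rewrite invf_ple ?posrE ?ltr0n// ltW// Num.Theory.truncnS_gt.
  by rewrite le_min => /andP[h1 h2]; apply/andP; split => //; rewrite lerBrDr addrC -lerBrDr.
move: c; rewrite F0 measure0 => /fine_cvgP[_ /cvgrPdist_le/(_ _ e0)[k _ /(_ k (leqnn k))]] /=.
rewrite sub0r normrN ger0_norm ?fine_ge0// => h; exists k.
have {}h : (leb (F k) <= e%:E)%E by rewrite -lee_fin fineK// ge0_fin_numE ?leb_ge0 in h.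
have -> : @pball R n = annulus k `|` F k by rewrite setDUK//; exact: annulus_pball.
apply: (le_trans (outer_measureU2 (@lebesgue_outer R n.+1) _ _)).
exact: leeD.
Qed.

(** Removing from an annulus an open set that barely covers the rest of the ball leaves a compact
    part of the sector. Its radial projection is compact, hence Borel, lies in [E], and has a sector
    containing that part. *)
Lemma borel_inner_approx (E : set Rn) (e : R) : sphere_measurable E -> 0 < e ->
  exists E' : set V, [/\ measurable E', E' `<=` E & (sigma E <= sigma E' + e%:E)%E].
Proof.
move=> [ES cE] e0; have e20 : 0 < e / 2 by rewrite divr_gt0.
pose B : set Rn := @pball R n `\` sector E.
have sE : sector E `<=` @pball R n by rewrite sectorE// => p [].
(* The Caratheodory property of the sector enters here: it makes the outer measures of the sector
   and its complement in the ball add up. *)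
have split_ball : leb (@pball R n) = (lebesgue_outer (sector E) + lebesgue_outer B)%E.
  by rewrite [LHS](cE (@pball R n)) (setIidr sE).
have [U [oU BU leU]] := lebesgue_outer_regular B e20.
have [k hk] := annulus_exhaust e20.
pose D : set Rn := annulus k `\` U.
have cD : closed D by apply: closedI; [exact: closed_annulus|exact: open_closedC].
have compD : compact D.
  apply: (subclosed_compact cD (@rV_compact R n.+1 (fun=> `[-1, 1]%classic) _)).
  by move=> i; exact: segment_compact.
move=> p Dp; exact: annulus_bounded Dp.1.
have Dsub : D `<=` sector E.
  move=> p [pA nU]; apply: contrapT => np; apply: nU; apply: BU; split=> //.
  exact: annulus_pball pA.
have Dball : D `<=` @pball R n by move=> p /Dsub /sE.
pose E' : set V := [set dir p | p in D].
have E'E : E' `<=` E by move=> q [p /Dsub Sp <-]; move: Sp; rewrite sectorE// => -[].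
have compE' : compact (E' : set Rn).
  apply: continuous_compact => //; apply: continuous_in_subspaceT => p; rewrite inE => Dp.
  by apply: continuous_dir; have /andP[p0 _] := Dball _ Dp; rewrite gt_eqF.
have mE' : measurable E'.
  apply: measurable_closed; apply: compact_closed => //; exact: norm_hausdorff.
exists E'; split=> //.
have DE' : (lebesgue_outer D <= sigma E')%E.
  rewrite sigmaE; apply: (le_outer_measure (@lebesgue_outer R n.+1)) => p Dp.
  by split; [exists p|exact: Dball].
have ballfin : leb (@pball R n) \is a fin_num by rewrite ge0_fin_numE ?leb_ge0// leb_pball_lty.
have Bfin : lebesgue_outer B \is a fin_num.
  rewrite ge0_fin_numE ?lebesgue_outer_ge0//; apply: le_lt_trans (leb_pball_lty R n).
  by apply: (le_outer_measure (@lebesgue_outer R n.+1)) => p [].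
have Afin : (leb (annulus k : set V) <= lebesgue_outer D + lebesgue_outer U)%E.
  apply: le_trans (outer_measureU2 (@lebesgue_outer R n.+1) _ _).
  apply: (le_outer_measure (@lebesgue_outer R n.+1)) => p pA.
  by have [pU|pU] := pselect (U p); [right|left].
rewrite -outer_sector// -(leeD2rE _ _ Bfin) -split_ball.
apply: (le_trans hk); rewrite [e in leRHS]splitr EFinD.
apply: (@le_trans _ _ (sigma E' + (lebesgue_outer B + (e / 2)%:E) + (e / 2)%:E)%E).
  by apply: leeD => //; apply: (le_trans Afin); exact: leeD.
by rewrite !addeA [X in (_ <= X)%E]addeAC (addeAC (sigma E')).
Qed.

End InnerRegularity.

(** * Sets of maximal measure *)

Section Sign.
Variables (R : realType) (n : nat).
Local Notation V := (eucl R n).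
Local Notation Rn := 'rV[R]_n.+1.

(** The first nonzero coordinate is positive: a Borel choice of one point from each antipodal
    pair. *)
Definition lex_pos : set Rn :=
  [set x | exists i : 'I_n.+1, 0 < x 0 i /\ forall j : 'I_n.+1, (j < i)%N -> x 0 j = 0].

Lemma measurable_lex_pos : measurable (lex_pos : set V).
Proof.
have -> : (lex_pos : set V) = \bigcup_(i : 'I_n.+1) (((fun x : V => x 0 i) @^-1` `]0, +oo[%classic) `&`
    \bigcap_(j in [set j : 'I_n.+1 | (j < i)%N]) ((fun x : V => x 0 j) @^-1` [set 0])).
  apply/seteqP; split=> [x [i [xi xj]]|x [i _ [/= xi xj]]].
    by exists i => //; split=> [|j /= ji]; [rewrite /= in_itv/= xi|exact: xj].
  by exists i; split=> [|j ji]; [move: xi; rewrite in_itv/= andbT|exact: xj].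
have mc (j : 'I_n.+1) (Z : set R) : measurable Z -> measurable ((fun x : V => x 0 j) @^-1` Z).
  by move=> mZ; rewrite -[X in measurable X]setTI; exact: measurable_coord.
apply: fin_bigcup_measurable => // i _; apply: measurableI; first exact: mc.
by apply: fin_bigcap_measurable => // j _; exact: mc.
Qed.

Lemma lex_posN x : lex_pos x -> ~ lex_pos (- x).
Proof.
move=> [i [xi xj]] [i' [xi' xj']]; rewrite mxE in xi'.
case: (ltngtP i i') => [ii'|i'i|/val_inj ii'].
- by have := xj' _ ii'; rewrite mxE => h; move: xi; rewrite -oppr_lt0 h ltxx.
- by move: xi'; rewrite xj// oppr0 ltxx.
- by move: xi'; rewrite -ii' oppr_gt0 ltNge ltW.
Qed.

Lemma lex_pos_total x : x != 0 -> lex_pos x \/ lex_pos (- x).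
Proof.
move=> /rV0Pn[i0 xi0].
case: (arg_minnP (P := fun i : 'I_n.+1 => x 0 i != 0) (fun i : 'I_n.+1 => nat_of_ord i) xi0) => i xi min.
have x0 (j : 'I_n.+1) : (j < i)%N -> x 0 j = 0.
  by move=> ji; apply/eqP; apply: contraTT ji => /min; rewrite -leqNgt.
have [h|h] := ltP 0 (x 0 i); [left|right]; exists i; split=> //.
  by rewrite mxE oppr_gt0 lt_neqAle xi h.
by move=> j ji; rewrite mxE x0// oppr0.
Qed.

End Sign.

Section Attainment.
Variables (R : realType) (n : nat).
Local Notation V := (eucl R n).
Local Notation Rn := 'rV[R]_n.+1.
Variable sigma : {finite_measure set V -> \bar R}.
Hypothesis sigmaE : forall A, sigma A = leb ((@dir R n : V -> V) @^-1` A `&` @pball R n).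
Hypothesis n2 : (2 <= n)%N.
Variable X : set R.
Variables (A : nat -> set V) (f : V -> R).
Hypotheses (mA : forall k, measurable (A k)) (avA : forall k, avoiding X (A k : set Rn)).
Hypotheses (bf : bdfun f) (f01 : forall x, 0 <= f x <= 1).
Hypothesis Af : forall h : V -> R, bdfun h ->
  (\int[sigma]_x ((\1_(A k) x - f x) * h x)) @[k --> \oo] --> 0.

Local Notation mass D := (fine (sigma D)).
Local Notation J D := (\int[sigma]_x (f x * \1_D x)).

Let f1 x : `|f x| <= 1.
Proof. by have /andP[h1 h2] := f01 x; rewrite ger0_norm. Qed.

Let indic1 k (x : V) : `|\1_(A k) x : R| <= 1.
Proof. by rewrite indicE ger0_norm// lern1 leq_b1. Qed.

Let diff1 k (x : V) : `|\1_(A k) x - f x| <= 1.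
Proof.
have /andP[h1 h2] := f01 x; rewrite indicE; case: (_ \in _) => /=.
  by rewrite ger0_norm; lra.
by rewrite sub0r normrN.
Qed.

Let bA k : bdfun (\1_(A k) : V -> R). Proof. exact: bdfun_indic. Qed.
Let bd k : bdfun (fun x => \1_(A k) x - f x). Proof. exact: bdfunB. Qed.

(** With a the indicator of [A k], f(x) f(y) = a(x) a(y) - (a(x) - f(x)) a(y) - (a(y) - f(y)) f(x).
    Both subtracted terms contain the weakly null factor a - f, so their means over rotations tend
    to 0. *)
Lemma haar_limit_eq0 (x y : Rn) : inner x x = 1 -> inner y y = 1 -> inner x y ^+ 2 < 1 ->
  X (inner x y) -> \int[@haar R n]_M (f (act M x) * f (act M y)) = 0.
Proof.
move=> x1 y1 xy1 Xxy.
have yx1 : inner y x ^+ 2 < 1 by rewrite innerC.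
have c1 := haar_bilinear_cvg0 sigmaE n2 x1 y1 xy1 (fun k => (bd k).1) (fun k => (bA k).1)
  diff1 indic1 Af.
have c2 := haar_bilinear_cvg0 sigmaE n2 y1 x1 yx1 (fun k => (bd k).1) (fun=> bf.1)
  diff1 (fun=> f1) Af.
have bact g (z : V) : bdfun g -> bdfun (fun M => g (act M z)).
  by move=> bg; apply: bdfun_comp bg _; exact: measurable_act2.
have E k : \int[@haar R n]_M (f (act M x) * f (act M y)) =
   - (\int[@haar R n]_M ((\1_(A k) (act M x) - f (act M x)) * \1_(A k) (act M y)))
   - \int[@haar R n]_M ((\1_(A k) (act M y) - f (act M y)) * f (act M x)).
  rewrite -opprD -RintegralD//; last 2 first.
  - by apply: bdfun_integrable; apply: bdfunM; [exact: bact (bd k)|exact: bact].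
  - by apply: bdfun_integrable; apply: bdfunM; [exact: bact (bd k)|exact: bact].
  rewrite -mulN1r -RintegralZl//; last first.
    apply: bdfun_integrable; apply: bdfunD; apply: bdfunM; try exact: bact.
      exact: bact (bd k).
    exact: bact (bd k).
  apply: eq_Rintegral => M _.
  (* Avoidance enters here: rotations keep the inner product in [X], so both rotated points cannot
     lie in [A k]. *)
  have -> : \1_(A k) (act M x) = (1 - \1_(A k) (act M y)) * \1_(A k) (act M x) :> R.
    rewrite !indicE; case: (boolP (act M y \in A k)) => [|_]; last by rewrite subr0 mul1r.
    rewrite inE => My; case: (boolP (act M x \in A k)) => [|_]; last by rewrite mulr0.
    by rewrite inE => Mx; case: (avA Mx My); rewrite inner_act.
  rewrite !indicE; case: (act M y \in A k); case: (act M x \in A k) => /=; ring.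
have c3 : (fun=> \int[@haar R n]_M (f (act M x) * f (act M y))) @ \oo --> (0 : R).
  have c12 := cvgB (cvgN c1) c2; rewrite oppr0 addr0 in c12.
  by rewrite (funext E : (fun=> _) = _); exact: c12.
exact: (cvg_unique _ (cvg_cst _) c3).
Qed.

Let S : set V := [set x | unit_sphere x /\ 0 < f x].

Let mS : measurable S.
Proof.
have -> : S = (@unit_sphere R n.+1 : set V) `&` f @^-1` `]0, +oo[%classic.
  by apply/seteqP; split=> x [Sx fx]; split=> //; move: fx; rewrite /= in_itv/= andbT.
apply: measurableI; first exact: measurable_sphere.
by rewrite -[X in measurable X]setTI; apply: bf.1.
Qed.

Lemma positive_pairs (x y : V) : S x -> S y ->
  (0 < @haar R n [set M | S (act M x) /\ S (act M y)])%E -> X (inner (x : Rn) y) ->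
  inner (x : Rn) y ^+ 2 = 1.
Proof.
move=> [x1 _] [y1 _] pos Xxy; have := inner_le1 x1 y1; rewrite le_eqVlt => /predU1P[//|xy1].
have I0 := haar_limit_eq0 x1 y1 xy1 Xxy.
pose h M := f (act M x) * f (act M y).
have bh : bdfun h by apply: bdfunM; apply: bdfun_comp bf _; exact: measurable_act2.
have h0 M : 0 <= h M by rewrite mulr_ge0//; [have /andP[] := f01 (act M x)|have /andP[] := f01 (act M y)].
have inth := bdfun_integrable (@haar R n) bh.
have mhpos : measurable [set M | 0 < h M].
  rewrite (_ : [set _ | _] = setT `&` h @^-1` `]0, +oo[%classic).
    by apply: bh.1 => //; exact: measurable_itv.
  by rewrite setTI; apply/seteqP; split=> M /=; rewrite in_itv/= andbT.
have : @haar R n [set M | 0 < h M] = 0%E.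
  apply: (pos_integral_le0_null inth).
  have <- : (\int[@haar R n]_M (h M)%:E = 0)%E.
    by rewrite -(fineK (integrable_fin_num measurableT inth)); congr EFin.
  apply: ge0_subset_integral => //; first exact: measurable_int inth.
  by move=> M _; rewrite lee_fin.
move=> z; suff : (0 < @haar R n [set M | (0 < h M)%R])%E by rewrite z ltxx.
apply: (lt_le_trans pos); apply: le_measure; rewrite ?inE//.
  by apply: measurableI; rewrite -[X in measurable X]setTI; exact: measurable_act2.
by move=> M [[_ fx] [_ fy]]; exact: mulr_gt0.
Qed.

Lemma limit_mass D : measurable D -> (mass (A k `&` D)) @[k --> \oo] --> J D.
Proof.
move=> mD; have bD := @bdfun_indic _ _ R _ mD.
have E k : \int[sigma]_x ((\1_(A k) x - f x) * \1_D x) = mass (A k `&` D) - J D.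
  rewrite -Rintegral_indic; last exact: measurableI.
  rewrite -RintegralB//.
  - by apply: eq_Rintegral => x _; rewrite indicI/= mulrBl.
  - by apply: bdfun_integrable; apply: bdfun_indic; exact: measurableI.
  - by apply: bdfun_integrable; exact: bdfunM.
have c : (mass (A k `&` D) - J D) @[k --> \oo] --> 0.
  by under eq_fun do rewrite -E; exact: Af bD.
have -> : (fun k => mass (A k `&` D)) = (fun k => (mass (A k `&` D) - J D) + J D).
  by apply/funext => k; rewrite subrK.
by rewrite -[X in _ --> X]add0r; apply: cvgD c _; exact: cvg_cst.
Qed.

Lemma limit_le_mass D : measurable D -> J D <= mass D.
Proof.
move=> mD; rewrite -Rintegral_indic//; apply: le_Rintegral => //.
- by apply: bdfun_integrable; apply: bdfunM => //; exact: bdfun_indic.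
- by apply: bdfun_integrable; exact: bdfun_indic.
- move=> x _; rewrite indicE; case: (_ \in _) => /=; last by rewrite mulr0.
  by rewrite mulr1; have /andP[] := f01 x.
Qed.

Lemma limitU B C : measurable B -> measurable C -> B `&` C = set0 -> J (B `|` C) = J B + J C.
Proof.
move=> mB mC BC; rewrite -RintegralD//.
- apply: eq_Rintegral => x _; rewrite -mulrDr; congr (_ * _); rewrite !indicE in_setU.
  case: (boolP (x \in B)) => [|_] /=; last by rewrite add0r.
  case: (boolP (x \in C)) => [|_] /=; last by rewrite addr0.
  rewrite !inE => Cx Bx; have : (B `&` C) x by [].
  by rewrite BC.
- by apply: bdfun_integrable; apply: bdfunM => //; exact: bdfun_indic.
- by apply: bdfun_integrable; apply: bdfunM => //; exact: bdfun_indic.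
Qed.

Let neg (x : V) : V := - (x : Rn).

Let mneg D : measurable D -> measurable (neg @^-1` D).
Proof.
move=> mD; rewrite -[X in measurable X]setTI.
by apply: (measurable_euclN (@measurable_id _ _ setT)).
Qed.

Let mass_neg D : measurable D -> mass (neg @^-1` D) = mass D.
Proof.
move=> mD; congr fine.
apply: (cone_measure_isom sigmaE (T := neg) (S := neg)) => //.
- by move=> x y; rewrite /neg opprD.
- by move=> t y; rewrite /neg scalerN.
- by move=> x; rewrite /neg opprK.
- by move=> x; rewrite /neg innerNl innerNr opprK.
- exact: (measurable_euclN (@measurable_id _ _ setT)).
Qed.

Hypothesis AS : forall k, A k `<=` @unit_sphere R n.+1.

(* [A k] and its antipodal set are disjoint when [-1] is forbidden. *)
Lemma symmetric_limit D : X (-1) -> measurable D -> neg @^-1` D = D ->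
  J D <= mass D / 2.
Proof.
move=> Xm1 mD Ds.
have le k : mass (A k `&` D) <= mass D / 2.
  rewrite ler_pdivlMr// mulr_natr mulr2n -{2}mass_neg; last exact: measurableI.
  have mAD := measurableI _ _ (mA k) mD.
  rewrite -fine_measureU//; last 2 first.
  - exact: mneg.
  - apply/seteqP; split=> // x [[Ax _] [Anx _]]; apply: (avA Ax Anx).
    by rewrite /neg innerNr (AS Ax).
  apply: fine_le; rewrite ?fin_num_measure//; first by apply: measurableU => //; exact: mneg.
  apply: le_measure; rewrite ?inE//; first by apply: measurableU => //; exact: mneg.
  move=> x [[]//|[_ Dnx]]; by rewrite -Ds.
apply: (cvgr_to_le (limit_mass mD)).
by near=> k; exact: le.
Unshelve. all: by end_near. Qed.

Lemma attaining_set : ~ X 1 -> exists I : set V, [/\ measurable I, I `<=` @unit_sphere R n.+1,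
  avoiding X (I : set Rn) & J setT <= mass I].
Proof.
move=> X1.
have [I0 [mI0 I0S SI0 pairs]] := density_set sigmaE mS.
have JI0 : J setT = J I0.
  (* On the sphere f vanishes outside [S], and [I0] fills [S] up to a null set, so the integral of f
     is already carried by [I0]. *)
  have mU : measurable (I0 `|` ((@unit_sphere R n.+1 : set V) `\` S)).
    by apply: measurableU => //; apply: measurableD => //; exact: measurable_sphere.
  apply: (bdfun_ae_eq_Rintegral mU).
  - apply/eqP; rewrite -measure_le0.
    apply: (@le_trans _ _ (sigma (S `\` I0) + sigma (~` @unit_sphere R n.+1))%E).
      apply: le_trans (measureU2 _ _ _).
      + apply: le_measure; rewrite ?inE.
        * exact: measurableC.
        * by apply: measurableU; [exact: measurableD|apply: measurableC; exact: measurable_sphere].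
        * move=> x /= /not_orP[nI /not_andP[|/contrapT]]; [by right|by left].
      + exact: measurableD.
      + by apply: measurableC; exact: measurable_sphere.
    by rewrite SI0 (cone_measure_sphere sigmaE) adde0.
  - by apply: bdfunM => //; exact: bdfun_indic.
  - by apply: bdfunM => //; exact: bdfun_indic.
  - move=> x; rewrite inE => xU; rewrite !indicE in_setT mulr1.
    case: (boolP (x \in I0)) => [_|/negP nI]; first by rewrite mulr1.
    move: xU => [xI|[Sx nS]]; first by rewrite inE in nI.
    rewrite mulr0; apply/eqP; rewrite eq_le; have /andP[-> _] := f01 x; rewrite andbT.
    by rewrite leNgt; apply/negP => fx; apply: nS.
have I0pairs (x y : V) : I0 x -> I0 y -> X (inner (x : Rn) y) -> inner (x : Rn) y = -1.
  move=> Ix Iy Xxy; have /eqP := positive_pairs (I0S _ Ix) (I0S _ Iy) (pairs _ _ Ix Iy) Xxy.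
  by rewrite sqrf_eq1 => /orP[/eqP h|/eqP//]; move: Xxy; rewrite h => /X1.
have I0sphere : I0 `<=` @unit_sphere R n.+1 by move=> x /I0S[].
have [Xm1|Xm1] := pselect (X (-1)); last first.
  exists I0; split=> //; last by rewrite JI0; exact: limit_le_mass.
  by move=> x y Ix Iy Xxy; move: (Xxy); rewrite I0pairs.
(* The symmetric part of [I0] contains all its antipodal pairs. Only this part is halved; outside it
   the bound f <= 1 is enough. *)
pose D := I0 `&` neg @^-1` I0.
have mD : measurable D by apply: measurableI => //; exact: mneg.
have Ds : neg @^-1` D = D.
  by apply/seteqP; split=> x [/= h1 h2]; split=> //; move: h2; rewrite /= /neg opprK.
have mP : measurable (@lex_pos R n : set V) by exact: measurable_lex_pos.
have mDP : measurable (D `&` @lex_pos R n) by exact: measurableI.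
have mID : measurable (I0 `\` D) by exact: measurableD.
exists ((I0 `\` D) `|` (D `&` @lex_pos R n)); split.
- exact: measurableU.
- by move=> x [[/I0sphere]|[[/I0sphere]]].
- move=> x y xI yI Xxy.
  have x0 : I0 x by case: xI => [[]|[[]]].
  have y0 : I0 y by case: yI => [[]|[[]]].
  have xy := I0pairs _ _ x0 y0 Xxy.
  have yx : y = - (x : Rn).
    apply/eqP; rewrite -addr_eq0 -inner_eq0 !(innerDl, innerDr) (I0sphere _ x0) (I0sphere _ y0).
    by rewrite [inner y x]innerC xy; apply/eqP; ring.
  have Dx : D x by split=> //; rewrite /neg/= -yx.
  have Dy : D y by split=> //; rewrite /neg/= yx opprK.
  case: xI => [[]//|[_ Px]]; case: yI => [[]//|[_ Py]].
  by apply: (lex_posN Px); rewrite -yx.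
rewrite fine_measureU//; last first.
  by apply/seteqP; split=> // x [[_ nD] [/nD]].
have D2 : mass D = mass (D `&` @lex_pos R n) + mass (D `&` @lex_pos R n).
  rewrite -[X in _ = _ + X]mass_neg// -fine_measureU//; last 2 first.
  - exact: mneg.
  - apply/seteqP; split=> // x [[_ Px] [_ Pnx]]; exact: lex_posN Pnx.
  congr (mass _); rewrite preimage_setI Ds -setIUr; apply/seteqP; split=> x; last by case.
  (* Points of the sphere are nonzero, so [D] is the disjoint union of its lexicographically
     positive half and the negative of that half, which have equal mass. *)
  move=> Dx; split=> //; apply: lex_pos_total; apply/eqP => x0.
  by have := I0sphere _ Dx.1; rewrite x0 /unit_sphere/= inner0l => /eqP; rewrite eq_sym oner_eq0.
have -> : mass (D `&` @lex_pos R n) = mass D / 2 by rewrite D2; field.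
rewrite JI0 -[X in J X](setDUK (_ : D `<=` I0)); last by move=> x [].
rewrite setUC limitU//; last by apply/seteqP; split=> // x [[_ nD] /nD].
by apply: lerD; [exact: limit_le_mass|exact: symmetric_limit].
Qed.

End Attainment.

Section MaximalAvoiding.
Variables (R : realType) (n : nat).
Local Notation V := (eucl R n).
Local Notation Rn := 'rV[R]_n.+1.

Definition rat_box_enum (j : nat) : set V :=
  let ab := odflt (0, 0) (unpickle j : option ('rV[rat]_n.+1 * 'rV[rat]_n.+1)) in
  box (ratr_row R ab.1) (ratr_row R ab.2).

Lemma range_rat_box_enum : range rat_box_enum = @rat_box R n.+1.
Proof.
apply/seteqP; split=> [_ [j _ <-]|_ [ab _ <-]].
  by exists (odflt (0, 0) (unpickle j)).
by exists (pickle ab) => //; rewrite /rat_box_enum pickleK.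
Qed.

Variable sigma : {finite_measure set V -> \bar R}.
Hypothesis sigmaE : forall A, sigma A = leb ((@dir R n : V -> V) @^-1` A `&` @pball R n).
Hypothesis n2 : (2 <= n)%N.
Variable X : set R.

(** By [sigmaE] the value [sigma E] is the outer measure of a sector for every subset [E] of the
    sphere, Borel or not, so the supremum runs over all measurable avoiding sets although the
    maximiser is Borel. *)
Lemma maximal_avoiding_ex : exists I : set V, [/\ measurable I, I `<=` @unit_sphere R n.+1,
  avoiding X (I : set Rn) &
  forall E : set Rn, sphere_measurable E -> avoiding X E -> (sigma E <= sigma I)%E].
Proof.
have [X1|X1] := pselect (X 1).
  exists set0; split; [exact: measurable0|by []|by move=> x y []|move=> E [ES _] avE].
  rewrite (_ : E = set0)//; apply/seteqP; split=> // x Ex.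
  by apply: (avE x x Ex Ex); rewrite (ES x Ex).
pose T := [set sigma E | E in [set E : set Rn | sphere_measurable E /\ avoiding X E]].
pose s := ereal_sup T.
have T0 : T (sigma set0).
  exists set0 => //; split; last by move=> x y [].
  by apply: borel_sphere_measurable => //; exact: measurable0.
have sfin : s \is a fin_num.
  rewrite ge0_fin_numE; last by apply: le_trans (ereal_sup_ubound T0).
  apply: (@le_lt_trans _ _ (sigma (@unit_sphere R n.+1))); last first.
    by rewrite -ge0_fin_numE ?measure_ge0// fin_num_measure//; exact: measurable_sphere.
  apply: ge_ereal_sup => _ [E [[ES _] _] <-].
  by rewrite !sigmaE; apply: (le_outer_measure (@lebesgue_outer R n.+1)) => p [/ES].
(* One 1/(k+1) is lost in approaching the supremum and another in passing to a Borel subset. *)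
have /choice[A HA] : forall k, exists B : set V, [/\ measurable B, B `<=` @unit_sphere R n.+1,
    avoiding X (B : set Rn) & fine s - 2 / k.+1%:R <= fine (sigma B)].
  move=> k; have k0 : (0 : R) < k.+1%:R^-1 by rewrite invr_gt0 ltr0n.
  have [_ [E [smE avE] <-] sE] := ub_ereal_sup_adherent k0 sfin.
  have [B [mB BE EB]] := borel_inner_approx sigmaE smE k0.
  exists B; split=> //; [by move=> x /BE /smE.1|by move=> x y /BE Ex /BE Ey; exact: avE|].
  have : (s - (k.+1%:R^-1)%:E <= sigma B + (k.+1%:R^-1)%:E)%E by exact: le_trans (ltW sE) EB.
  rewrite -(fineK sfin) -(fineK (fin_num_measure sigma B mB)) -EFinB -EFinD lee_fin.
  rewrite (_ : 2 / _ = k.+1%:R^-1 + k.+1%:R^-1); last by ring.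
  by move=> h; rewrite opprD addrA lerBlDr.
have mA k : measurable (A k) by have [] := HA k.
have [phi [f [phik bf f01 Af]]] := @weak_limit R _ V sigma rat_box_enum
  (congr1 _ (esym range_rat_box_enum)) (eq_ind_r _ (@rat_boxI R n) range_rat_box_enum) A mA.
have mA' k : measurable (A (phi k)) by [].
have avA' k : avoiding X (A (phi k) : set Rn) by have [] := HA (phi k).
have A'S k : A (phi k) `<=` @unit_sphere R n.+1 by have [] := HA (phi k).
have [I [mI IS avI sI]] := attaining_set sigmaE n2 mA' avA' bf f01 Af A'S X1.
exists I; split=> // E smE avE.
suff ss : fine s <= fine (sigma I).
  apply: (@le_trans _ _ s); first by apply: ereal_sup_ubound; exists E.
  by rewrite -(fineK sfin) -(fineK (fin_num_measure sigma I mI)) lee_fin.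
apply: le_trans sI; apply/ler_addgt0Pr => d d0; rewrite -lerBlDr.
have lim := limit_mass mA' bf Af (measurableT).
apply: (cvgr_to_ge lim).
exists (Num.truncn (2 / d)) => // k /= dk; rewrite setIT.
have [_ _ _] := HA (phi k); apply: le_trans; rewrite lerB// ler_pdivrMr// mulrC -ler_pdivrMr//.
apply: (le_trans (ltW (Num.Theory.truncnS_gt _))); rewrite ler_nat ltnS.
exact: leq_trans dk (phik k).
Qed.

End MaximalAvoiding.

Theorem theorem16 (R : realType) (n : nat) (hn : (3 <= n)%N)
    (X : set R) (hX : X `<=` [set` `[-1, 1]%R]) :
  exists I : set 'rV[R]_n,
    [/\ sphere_measurable I, avoiding X I & sphere_measure I = alpha n X].
Proof.
(* The measure on R^n is built in dimension [n.+1]; after this step the bound on the dimension reads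
   2 <= n. *)
case: n hn => // n hn.
have [sigma sigmaE] := cone_measure_ex R n.
have [I [mI IS avI Imax]] := maximal_avoiding_ex sigmaE hn X.
have smI := borel_sphere_measurable mI IS.
exists I; split=> //; apply/le_anti/andP; split.
  by apply: ereal_sup_ubound; exists I.
apply: ge_ereal_sup => _ [E [smE avE] <-].
rewrite /sphere_measure lee_wpmul2r// ?lee_fin ?invr_ge0 ?fine_ge0 ?lebesgue_outer_ge0//.
by rewrite (outer_sector sigmaE IS) (outer_sector sigmaE smE.1) Imax.
Qed.
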